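(* Let $X$ be an arbitrary real random variable such that $\mathrm{Var}(X)=1$ and $\mathbb{E}[|X|^{2+\varepsilon}]<\infty$ for some $\varepsilon>0$. Let $\{X_k : k=1,2,\ldots\}$ be independent copies of $X$, and for $n\in\mathbb{N}$ let $H_n=[X_{ij}]_{1\le i,j\le n}$ be the random $n\times n$ Helson matrix, whose $(i,j)$ entry is $X_{m}$ with $m=i\cdot j$ the product of $i$ and $j$. Then, with probability $1$, $\widehat{\mu}(H_n/\sqrt{n})$ converges weakly to the Wigner semi-circular law $\gamma_{sc}$ as $n\to\infty$.
   Context: $\mathbb{N}=\{1,2,\ldots\}$. For a symmetric $n\times n$ real matrix $A$ with eigenvalues $\lambda_1(A)\ge\cdots\ge\lambda_n(A)$ (with multiplicity), the spectral measure is $\widehat{\mu}(A)=\frac1n\sum_{j=1}^n\delta_{\lambda_j(A)}$. The standard Wigner semi-circular law $\gamma_{sc}$ is the probability measure on $\mathbb{R}$ given by $d\gamma_{sc}(x)=\mathbf{1}_{[-2,2]}(x)\,\frac{\sqrt{4-x^2}}{2\pi}\,dx$. All matrices $H_n$ are built from the same sequence $(X_k)_{k\ge1}$. *)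

(* Defs.v *)
From HB Require Import structures.
From mathcomp Require Import all_boot all_order all_algebra finmap.
From mathcomp Require Import ring lra.
From mathcomp Require Import all_classical all_reals all_analysis.
From mathcomp Require Import measurable_realfun.
From mathcomp.real_closed Require complex.

Set Implicit Arguments.
Unset Strict Implicit.
Unset Printing Implicit Defensive.

Import Order.TTheory GRing.Theory Num.Theory.
Import numFieldNormedType.Exports.

Local Open Scope classical_set_scope.
Local Open Scope ring_scope.

(* Mutual independence of the subfamily of [X] indexed by [D]: the product
   rule for every finite subset of [D] and all measurable events. *)
Definition mutually_independent (R : realType) (d d' : measure_display)
    (T : measurableType d) (T' : measurableType d') (P : probability T R)
    (I : choiceType) (D : set I) (X : I -> {RV P >-> T'}) : Prop :=
  forall (J : {fset I}) (A : I -> set T'),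
    [set` J] `<=` D -> (forall i, measurable (A i)) ->
    P (\bigcap_(i in [set` J]) X i @^-1` A i) =
    (\prod_(i <- J) P (X i @^-1` A i))%E.

(* Equality is required on measurable sets only: the value of a measure on
   other sets is unconstrained. *)
Definition same_distribution (R : realType) (d1 d2 d' : measure_display)
    (T1 : measurableType d1) (T2 : measurableType d2) (T' : measurableType d')
    (P1 : probability T1 R) (P2 : probability T2 R)
    (X : {RV P1 >-> T'}) (Y : {RV P2 >-> T'}) : Prop :=
  forall A : set T', measurable A -> distribution P1 X A = distribution P2 Y A.

(* Row and column indices in ['I_n] start at 0, hence the successors. *)
Definition helson (R : realType) (x : nat -> R) (n : nat) : 'M[R]_n :=
  \matrix_(i, j) x (i.+1 * j.+1)%N.

Lemma helson_sym (R : realType) (x : nat -> R) (n : nat) :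
  (helson x n)^T = helson x n.
Proof. by apply/matrixP => i j; rewrite !mxE mulnC. Qed.

Definition is_spectrum (R : realType) (n : nat) (A : 'M[R]_n) (s : seq R) :=
  sorted >=%R s /\ char_poly A = \prod_(a <- s) ('X - a%:P).

Section spectrum_existence.
Import complex.

Lemma char_poly_conj (F : fieldType) n (P A : 'M[F]_n) : P \in unitmx ->
  char_poly (invmx P *m A *m P) = char_poly A.
Proof.
move=> uP; rewrite /char_poly.
have -> : char_poly_mx (invmx P *m A *m P) =
  map_mx polyC (invmx P) *m char_poly_mx A *m map_mx polyC P.
  rewrite /char_poly_mx !map_mxM mulmxBr mulmxBl; congr (_ - _).
  by rewrite -mulmxA -scalar_mxC mulmxA -map_mxM mulVmx// map_mx1 mul1mx.
rewrite !det_mulmx mulrAC -det_mulmx -map_mxM mulVmx// map_mx1 det1.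
by rewrite mul1r.
Qed.

Lemma is_spectrum_exists (R : realType) (n : nat) (A : 'M[R]_n) :
  A^T = A -> exists s, is_spectrum A s.
Proof.
move=> symA; pose AC := map_mx (real_complex R) A.
have hA : AC \is hermsymmx.
  apply: realsym_hermsym; last first.
    by apply/mxOverP => i j; rewrite mxE complex_real.
  apply/is_hermitianmxP; rewrite expr0 scale1r; apply/matrixP => i j.
  by rewrite !mxE -[in LHS]symA mxE.
have rD := hermitian_spectral_diag_real hA.
have /orthomx_spectralP AE := hermitian_normalmx hA.
pose s := [seq complex.Re (spectral_diag AC 0 i) | i <- enum 'I_n].
exists (sort >=%R s); split; first exact: (sort_sorted (fun x y => le_total y x)).
apply: (map_poly_inj (real_complex R)).
rewrite map_char_poly -/AC AE char_poly_conj ?spectral_unit//.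
rewrite char_poly_trig ?diag_mx_is_trig//.
rewrite (perm_big s) ?perm_sort//= rmorph_prod big_map big_enum /=.
apply: eq_bigr => i _; rewrite rmorphB/= map_polyX map_polyC/=.
rewrite RRe_real ?mxE ?eqxx//.
by have /mxOverP := rD; apply.
Qed.

End spectrum_existence.

(* The nonincreasing sequence of eigenvalues, with algebraic multiplicity;
   the default [::] is never used when [A] is symmetric, see [eigenvaluesP]. *)
Definition eigenvalues (R : realType) (n : nat) (A : 'M[R]_n) : seq R :=
  xget [::] [set s | is_spectrum A s].

Lemma eigenvaluesP (R : realType) (n : nat) (A : 'M[R]_n) :
  A^T = A -> is_spectrum A (eigenvalues A).
Proof. by move=> /is_spectrum_exists[s sA]; exact: (xgetPex [::] (ex_intro _ s sA)). Qed.

Lemma size_eigenvalues (R : realType) (n : nat) (A : 'M[R]_n) :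
  A^T = A -> size (eigenvalues A) = n.
Proof.
move=> /eigenvaluesP[_ /(congr1 (fun p : {poly R} => size p))].
by rewrite size_char_poly size_prod_XsubC => -[].
Qed.

Definition spectral_measure (R : realType) (n : nat) (A : 'M[R]_n) :
    {measure set R -> \bar R} :=
  mscale (n%:R^-1 : R)%:nng (msum (fun j => \d_((eigenvalues A)`_j)) n).

Definition semicircle_pdf (R : realType) (x : R) : R :=
  \1_(`[-2, 2] : set R) x * (Num.sqrt (4 - x ^+ 2) / (2 * pi)).

Definition semicircle (R : realType) (A : set R) : \bar R :=
  (\int[lebesgue_measure]_(x in A) (semicircle_pdf x)%:E)%E.

Section semicircle_probability.
Context {R : realType}.
Local Notation mu := (@lebesgue_measure R).

Let h (x : R) : R := Num.sqrt (4 - x ^+ 2).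

Let ch : continuous h.
Proof.
move=> x; apply: (@continuous_comp _ _ _ (fun x : R => 4 - x ^+ 2)).
  by apply: cvgB; [exact: cvg_cst | exact: exprn_continuous].
exact: sqrt_continuous.
Qed.

Lemma semicircle_pdf_ge0 (x : R) : 0 <= semicircle_pdf x.
Proof. by rewrite mulr_ge0// divr_ge0 ?sqrtr_ge0// mulr_ge0// pi_ge0. Qed.

Lemma measurable_semicircle_pdf :
  measurable_fun [set: R] (@semicircle_pdf R).
Proof.
apply: measurable_funM; first by apply: measurable_indic.
apply: measurable_funM; last by [].
exact: continuous_measurable_fun ch.
Qed.

Let semicircle0 : semicircle set0 = 0%E :> \bar R.
Proof. by rewrite /semicircle integral_set0. Qed.

Let semicircle_ge0 (A : set R) : (0 <= semicircle A)%E.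
Proof.
by apply: integral_ge0 => x _; rewrite lee_fin semicircle_pdf_ge0.
Qed.

Let semicircle_sigma_additive : semi_sigma_additive (@semicircle R).
Proof.
move=> F mF tF mUF; rewrite /semicircle ge0_integral_bigcup//=.
- by apply: is_cvg_ereal_nneg_natsum_cond => n _ _; exact: semicircle_ge0.
- apply/measurable_EFinP; apply: measurable_funTS.
  exact: measurable_semicircle_pdf.
- by move=> x _; rewrite lee_fin semicircle_pdf_ge0.
Qed.

HB.instance Definition _ := isMeasure.Build _ _ _ (@semicircle R)
  semicircle0 semicircle_ge0 semicircle_sigma_additive.

Let integral_h : (\int[mu]_(x in `[(-2)%R, 2%R]) (h x)%:E = (2 * pi)%:E)%E.
Proof.
pose F (t : R) := 2 * sin t.
have dF (x : R) : is_derive x 1 F (2 * cos x).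
  have -> : 2 * cos x = 2 *: cos x by [].
  exact: is_deriveZ.
have F'E : (derive1 F) = (fun t => 2 * cos t).
  by apply/funext => t; rewrite derive1E derive_val.
have F2 : F (pi / 2) = 2 by rewrite /F sin_pihalf mulr1.
have FN2 : F (- (pi / 2)) = -2 by rewrite /F sinN sin_pihalf mulrN1.
have cF : continuous F.
  by move=> x; apply: cvgM; [exact: cvg_cst | exact: continuous_sin].
have cF' : continuous (derive1 F).
  by rewrite F'E => x; apply: cvgM; [exact: cvg_cst | exact: continuous_cos].
have pi20 : - (pi / 2) < pi / 2 :> R.
  by have := pi_gt0 R; set p := (pi : R) => p0; lra.
transitivity (\int[mu]_(x in `[F (- (pi / 2))%R, F (pi / 2)%R]) (h x)%:E)%E.
  by rewrite F2 FN2.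
rewrite integration_by_substitution_increasing; last 7 first.
- exact: ltW.
- by move=> x y xI yI xy; rewrite ltr_pM2l// ltr_sin.
- by move=> x _; exact: cF'.
- by apply/cvg_ex; exists ((derive1 F) (- (pi / 2))); apply: cvg_at_right_filter; exact: cF'.
- by apply/cvg_ex; exists ((derive1 F) (pi / 2)); apply: cvg_at_left_filter; exact: cF'.
- split.
  + by move=> x _; exact: ex_derive.
  + by apply: cvg_at_right_filter; exact: cF.
  + by apply: cvg_at_left_filter; exact: cF.
- exact: continuous_subspaceT.
pose g (t : R) := 4 * cos t ^+ 2.
pose G (t : R) := 2 * t + 2 * (sin t * cos t).
transitivity (\int[mu]_(x in `[(- (pi / 2))%R, (pi / 2)%R]) (g x)%:E)%E.
  apply: eq_integral => t; rewrite inE/= in_itv/= => tI; congr (_ %:E).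
  rewrite F'E -[LHS]/(Num.sqrt (4 - (2 * sin t) ^+ 2) * (2 * cos t)) /g.
  have -> : 4 - (2 * sin t) ^+ 2 = (2 * cos t) ^+ 2.
    by rewrite !exprMn cos2sin2; ring.
  by rewrite sqrtr_sqr ger0_norm ?mulr_ge0 ?cos_ge0_pihalf//; ring.
have dG (x : R) : is_derive x 1 G (g x).
  have -> : g x = 2 *: 1 + 2 *: (sin x *: - sin x + cos x *: cos x).
    rewrite /g /GRing.scale/= mulr1 mulrN -!expr2.
    by rewrite cos2sin2; ring.
  apply: is_deriveD.
have cG : continuous G.
  by move=> x; apply: differentiable_continuous; apply/derivable1_diffP; exact: ex_derive.
rewrite (@continuous_FTC2 _ g G)//; last 3 first.
- apply: continuous_subspaceT => x; apply: cvgM; first exact: cvg_cst.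
  apply: (@continuous_comp _ _ _ _ (fun y : R => y ^+ 2)).
    exact: continuous_cos.
  exact: exprn_continuous.
- split.
  + by move=> x _; exact: ex_derive.
  + by apply: cvg_at_right_filter; exact: cG.
  + by apply: cvg_at_left_filter; exact: cG.
- by move=> x _; rewrite derive1E derive_val.
rewrite /G sinN cosN cos_pihalf sin_pihalf -EFinB; congr (_ %:E); by field.
Qed.

Let semicircle_setT : semicircle [set: R] = 1%E.
Proof.
rewrite /semicircle -[RHS](_ : (2 * pi)^-1%:E * (2 * pi)%:E = 1)%E; last first.
  by rewrite -EFinM mulVf// mulf_neq0// gt_eqF// pi_gt0.
rewrite -integral_h -ge0_integralZl//=; last 3 first.
- apply/measurable_EFinP; apply: measurable_funTS.
  exact: continuous_measurable_fun ch.
- by move=> x _; rewrite lee_fin sqrtr_ge0.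
- by rewrite lee_fin invr_ge0 mulr_ge0// pi_ge0.
rewrite [RHS]integral_mkcond; apply: eq_integral => x _.
rewrite patchE /semicircle_pdf indicE.
case: ifPn => xI; rewrite ?mul0r// mul1r -EFinM.
by rewrite mulrC.
Qed.

HB.instance Definition _ :=
  Measure_isProbability.Build _ _ _ (@semicircle R) semicircle_setT.

End semicircle_probability.

Definition weakly_converges (R : realType)
    (mu_ : nat -> {measure set R -> \bar R})
    (mu : {measure set R -> \bar R}) : Prop :=
  forall f : R -> R, continuous f -> (exists M : R, forall x, `|f x| <= M) ->
    ((\int[mu_ n]_x (f x)%:E) @[n --> \oo] --> \int[mu]_x (f x)%:E)%E.

(* Main.v *)
(* By Weierstrass approximation, weak convergence to the semicircle law follows
   from the convergence of the Stieltjes transforms on the imaginary axis at the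
   points i y with y = 3 + 1/k, that is, of the normalized traces of the
   resolvents of H_n / sqrt n at those points.

   Replace X by a centered function of X with finitely many values. Cumulant
   expansion of the expected resolvent M gives the matrix Dyson equation
   1 + z M + s2 eta(M) M = o(1) in normalized Hilbert-Schmidt norm, where
   eta(M)_il = n^-1 sum_jk [i j = k l] M_jk: as an entry occurs at most once in
   each row, eta is a contraction fixing the identity, and for y >= 3 the
   equation is stable around the scalar solution i b, b^2 + y b = 1. The error
   and the fluctuations of the trace are controlled by the multiplicative energy
   #{i j = k l} = O(n^(2 + a)) of {1, .., n}; fourth moments and Borel-Cantelli
   then give almost sure convergence.

   The error of the discretization is n^-2 sum_ij X_ij^2 1(|X_ij| > K). It is
   small almost surely by Chebyshev's inequality along n = 2^k, after truncation
   at n^t with 2 / (2 + eps) < t < 1: it is here, and in the truncation itself,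
   that the moment of order 2 + eps is used. *)

From HB Require Import structures.
From mathcomp Require Import all_boot all_order all_algebra finmap.
From mathcomp Require Import ring lra.
From mathcomp Require Import all_classical all_reals all_analysis measurable_realfun.
From mathcomp.real_closed Require Import complex.
Require Import Defs.

Set Implicit Arguments.
Unset Strict Implicit.
Unset Printing Implicit Defensive.

Import Order.TTheory GRing.Theory Num.Theory.
Import numFieldNormedType.Exports.

Local Open Scope ring_scope.
Local Notation Re := complex.Re.
Local Notation Im := complex.Im.

(** * Expectations over finitely many discrete coordinates *)

(** Since X_m fills every position (i, j) with i j = m, eta(M) is not a scalar matrix: its diagonal
    is the normalized trace, but its entry (i, l) collects all M_jk with i j = k l. These entries of
    M are never estimated one by one. The limit i b is a scalar matrix, so M - i b satisfies a
    linear inequality in squared Hilbert-Schmidt norm; at y >= 3 its coefficients are small enough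
    to close it without analytic continuation, and spectral parameters accumulating at 3i still
    determine the limit.

    Contractivity alone does not justify replacing the mean of eta(G) G by eta(M) M: the resulting
    variance bound for eta(G) has the order of n, the size of the main term. The gain comes from
    separating the pairs (i, l) with few solutions of i j = k l from the rare pairs with many.

    With finitely many values every expectation is a finite sum, so independence and measurability
    enter only where such a sum is identified with a probability. Norms are kept squared, to avoid
    square roots; each triangle inequality then costs a factor 2. *)

Definition upd (T : Type) (x : nat -> T) (k : nat) (v : T) : nat -> T :=
  fun j => if j == k then v else x j.

Lemma updE T (x : nat -> T) k v : upd x k v k = v.
Proof. by rewrite /upd eqxx. Qed.

Lemma le_of_eq d (T : porderType d) (x y : T) : x = y -> (x <= y)%O.
Proof. by move->. Qed.

Section weighted_mean.
Context (R : realFieldType) (V : finType) (p : V -> R).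
Hypotheses (p_ge0 : forall a, 0 <= p a) (p_sum1 : \sum_a p a = 1).

Lemma wmean_cst (c : R) : \sum_a p a * c = c.
Proof. by rewrite -mulr_suml p_sum1 mul1r. Qed.

Lemma wmean_le (f g : V -> R) : (forall a, f a <= g a) ->
  \sum_a p a * f a <= \sum_a p a * g a.
Proof. by move=> fg; apply: ler_sum => a _; rewrite ler_wpM2l. Qed.

Lemma wmean_var (f : V -> R) (c : R) (mf := \sum_a p a * f a) :
  \sum_a p a * (f a - c) ^+ 2 =
  (mf - c) ^+ 2 + \sum_a p a * (f a - mf) ^+ 2.
Proof.
have E d : \sum_a p a * (f a - d) ^+ 2 =
    \sum_a p a * f a ^+ 2 - 2 * d * mf + d ^+ 2.
  rewrite -[d ^+ 2 in RHS]wmean_cst /mf mulr_sumr -sumrB -big_split /=.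
  by apply: eq_bigr => a _; ring.
by rewrite !E; ring.
Qed.

Lemma wmean_sqr (f : V -> R) :
  (\sum_a p a * f a) ^+ 2 <= \sum_a p a * f a ^+ 2.
Proof.
rewrite -[leRHS](_ : \sum_a p a * (f a - 0) ^+ 2 = _); last first.
  by apply: eq_bigr => a _; rewrite subr0.
by rewrite wmean_var subr0; rewrite lerDl sumr_ge0// => a _; rewrite mulr_ge0// sqr_ge0.
Qed.

(** One step of the fourth moment recursion, for a coordinate of oscillation at most [c]: in the
    expansion of the fourth power around [mf], the linear term has mean zero and the cubic one is
    absorbed by its neighbours. *)
Lemma wmean_fourth (f : V -> R) (c m : R) (mf := \sum_a p a * f a) : 0 <= c ->
  (forall a, `|f a - mf| <= c) ->
  \sum_a p a * (f a - m) ^+ 4 <=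
  (mf - m) ^+ 4 + 8 * c ^+ 2 * (mf - m) ^+ 2 + 3 * c ^+ 4.
Proof.
move=> c0 fc.
(* Adding the linear term, of mean zero, on the right makes the inequality true pointwise. *)
have -> : (mf - m) ^+ 4 + 8 * c ^+ 2 * (mf - m) ^+ 2 + 3 * c ^+ 4 =
    \sum_a p a * ((mf - m) ^+ 4 + 8 * c ^+ 2 * (mf - m) ^+ 2 + 3 * c ^+ 4
      + 4 * (mf - m) ^+ 3 * (f a - mf)).
  have Z0 : \sum_a 4 * (mf - m) ^+ 3 * (p a * (f a - mf)) = 0.
    rewrite -mulr_sumr; under eq_bigr do rewrite mulrBr.
    by rewrite sumrB wmean_cst subrr mulr0.
  rewrite -[LHS]wmean_cst -[LHS]addr0 -[X in _ + X]Z0 -big_split /=; apply: eq_bigr => a _; ring.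
apply: wmean_le => a.
have -> : f a - m = (mf - m) + (f a - mf) by ring.
move: (fc a); set s := mf - m; set d := f a - mf => dc.
have {dc}d2 : d ^+ 2 <= c ^+ 2.
  by rewrite -(real_normK (num_real d)) ler_sqr ?nnegrE.
have d4 : d ^+ 4 <= c ^+ 4.
  by rewrite (exprM _ 2 2) (exprM c 2 2) ler_sqr ?nnegrE ?sqr_ge0.
(* AM-GM: [4 s d^3 <= 2 s^2 d^2 + 2 d^4] *)
have H1 : s ^+ 2 * d ^+ 2 <= s ^+ 2 * c ^+ 2 by rewrite ler_wpM2l ?sqr_ge0.
have H2 : 0 <= d ^+ 2 * (s - d) ^+ 2 by rewrite mulr_ge0 ?sqr_ge0.
have E2 : d ^+ 2 * (s - d) ^+ 2 = s ^+ 2 * d ^+ 2 - 2 * s * d ^+ 3 + d ^+ 4 by ring.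
have E1 : (s + d) ^+ 4 = s ^+ 4 + 4 * s ^+ 3 * d + 6 * (s ^+ 2 * d ^+ 2) + 4 * s * d ^+ 3 + d ^+ 4 by ring.
rewrite E1; rewrite E2 in H2; nra.
Qed.

End weighted_mean.

Section product_expectation.
Context (R : realFieldType) (V : finType) (p val : V -> R).
Hypotheses (p_ge0 : forall a, 0 <= p a) (p_sum1 : \sum_a p a = 1).
Implicit Types F G : (nat -> R) -> R.

Definition avg k F : (nat -> R) -> R :=
  fun x => \sum_a p a * F (upd x k (val a)).

(* The coordinates listed in [s] are integrated out, those outside [s] are
   kept: the result is still a function of the sequence. *)
Fixpoint Ex s F : (nat -> R) -> R :=
  if s is k :: s' then Ex s' (avg k F) else F.

Lemma Ex_ext s F G x : (forall y, F y = G y) -> Ex s F x = Ex s G x.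
Proof.
elim: s F G => [|k s IH] F G FG //=.
by apply: IH => y; apply: eq_bigr => a _; rewrite FG.
Qed.

Lemma Ex_le s F G x : (forall y, F y <= G y) -> Ex s F x <= Ex s G x.
Proof. by elim: s F G => [|k s IH] F G FG //=; apply: IH => y; apply: wmean_le. Qed.

Lemma Ex_cst s c x : Ex s (fun=> c) x = c.
Proof.
elim: s => //= k s IH; rewrite -[RHS]IH; apply: Ex_ext => y.
by rewrite /avg wmean_cst.
Qed.

Lemma ExD s F G x : Ex s (fun y => F y + G y) x = Ex s F x + Ex s G x.
Proof.
elim: s F G => //= k s IH F G; rewrite -IH; apply: Ex_ext => y.
by rewrite /avg -big_split; apply: eq_bigr => a _; rewrite mulrDr.
Qed.

Lemma ExZ s c F x : Ex s (fun y => c * F y) x = c * Ex s F x.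
Proof.
elim: s F => //= k s IH F; rewrite -IH; apply: Ex_ext => y.
by rewrite /avg mulr_sumr; apply: eq_bigr => a _; rewrite mulrCA.
Qed.

Lemma Ex_sum s (I : Type) (r : seq I) (P : pred I) (F : I -> (nat -> R) -> R) x :
  Ex s (fun y => \sum_(i <- r | P i) F i y) x = \sum_(i <- r | P i) Ex s (F i) x.
Proof.
elim: r => [|i r IH].
  rewrite big_nil; transitivity (Ex s (fun=> 0) x); last exact: Ex_cst.
  by apply: Ex_ext => y; rewrite big_nil.
rewrite big_cons -IH; case: ifP => Pi; last by apply: Ex_ext => y; rewrite big_cons Pi.
by rewrite -ExD; apply: Ex_ext => y; rewrite big_cons Pi.
Qed.

Lemma upd_same (T : Type) (x : nat -> T) k u v : upd (upd x k u) k v = upd x k v.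
Proof. by apply/funext => j; rewrite /upd; case: eqP. Qed.

Lemma upd_comm (T : Type) (x : nat -> T) k l u v : k != l ->
  upd (upd x k u) l v = upd (upd x l v) k u.
Proof.
move=> kl; apply/funext => j; rewrite /upd; case: eqP => // ->.
by rewrite eq_sym (negbTE kl).
Qed.

Lemma avg_upd k F x v : avg k F (upd x k v) = avg k F x.
Proof. by apply: eq_bigr => a _; rewrite upd_same. Qed.

Lemma avg_avg k F x : avg k (avg k F) x = avg k F x.
Proof.
rewrite -[RHS](wmean_cst p_sum1); apply: eq_bigr => a _.
by rewrite avg_upd.
Qed.

Lemma avgC k l F x : avg k (avg l F) x = avg l (avg k F) x.
Proof.
have [->//|kl] := eqVneq k l.
rewrite /avg; under eq_bigr do rewrite mulr_sumr.
rewrite exchange_big /=; apply: eq_bigr => a _; rewrite mulr_sumr.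
by apply: eq_bigr => b _; rewrite mulrCA upd_comm.
Qed.

(** Averages are idempotent and commute. This is what allows conditioning on all coordinates but [k]
    under an expectation. *)
Lemma Ex_avg s k F x : k \in s -> Ex s (avg k F) x = Ex s F x.
Proof.
elim: s F => //= l s IH F; rewrite inE => /predU1P[->|ks].
  by apply: Ex_ext => y; rewrite avg_avg.
by rewrite -[RHS](IH _ ks); apply: Ex_ext => y; rewrite avgC.
Qed.

(** Twice the conditional variance of [F] in coordinate [k], written with two independent copies so
    that a bound on the oscillation applies directly. *)
Definition vark k F x :=
  \sum_a p a * \sum_b p b * (F (upd x k (val a)) - F (upd x k (val b))) ^+ 2.

(** Jensen's inequality: integrating out another coordinate does not increase the conditional
    variance. *)
Lemma vark_avg_ge k l F x : k != l -> vark k (avg l F) x <= avg l (vark k F) x.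
Proof.
move=> kl; rewrite /avg /vark.
under [leRHS]eq_bigr do rewrite mulr_sumr.
rewrite [leRHS]exchange_big /=; apply: ler_sum => a _.
under [leRHS]eq_bigr do rewrite mulrCA.
rewrite -mulr_sumr ler_wpM2l//.
under [leRHS]eq_bigr do rewrite mulr_sumr.
rewrite [leRHS]exchange_big /=; apply: ler_sum => b _.
under [leRHS]eq_bigr do rewrite mulrCA.
rewrite -mulr_sumr ler_wpM2l//.
rewrite -sumrB; under eq_bigr do rewrite -mulrBr.
apply: le_trans (wmean_sqr _ _ _) _ => //; apply: ler_sum => c _.
by rewrite !(upd_comm _ _ _ kl).
Qed.

Lemma avg_var_le k F mu x :
  avg k (fun y => (F y - mu) ^+ 2) x <= (avg k F x - mu) ^+ 2 + vark k F x.
Proof.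
rewrite /avg (wmean_var p_sum1) lerD2l; apply: ler_sum => a _.
rewrite ler_wpM2l// -[F (upd x k (val a)) in leLHS](wmean_cst p_sum1) -sumrB.
by under eq_bigr do rewrite -mulrBr; exact: wmean_sqr.
Qed.

(* Efron-Stein, in the vector-valued form with a uniform bound *)
Lemma Ex_variance (I : finType) s (F : I -> (nat -> R) -> R) (C : nat -> R) x0 :
  uniq s -> (forall k x, k \in s -> \sum_i vark k (F i) x <= C k) ->
  \sum_i Ex s (fun x => (F i x - Ex s (F i) x0) ^+ 2) x0 <= \sum_(k <- s) C k.
Proof.
elim: s F => [|k s IH] F /=.
  by move=> _ _; rewrite big_nil big1// => i _; rewrite subrr expr0n.
move=> /andP[ks us] FC; rewrite big_cons.
apply: (@le_trans _ _ (\sum_i Ex s (fun x =>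
    (avg k (F i) x - Ex s (avg k (F i)) x0) ^+ 2 + vark k (F i) x) x0)).
  by apply: ler_sum => i _; apply: Ex_le => x; exact: avg_var_le.
rewrite (eq_bigr _ (fun i _ => ExD _ _ _ _)).
rewrite big_split /= addrC lerD//.
  rewrite -Ex_sum -[leRHS](Ex_cst s (C k) x0); apply: Ex_le => x.
  by apply: FC; rewrite mem_head.
apply: IH => // l x ls.
have lk : l != k by apply: contraNneq ks => <-.
apply: (@le_trans _ _ (\sum_i avg k (vark l (F i)) x)).
  by apply: ler_sum => i _; exact: vark_avg_ge.
rewrite /avg exchange_big /= -[leRHS](wmean_cst p_sum1); apply: ler_sum => a _.
by rewrite -mulr_sumr ler_wpM2l// FC// in_cons ls orbT.
Qed.

Lemma vark_le k F c x :
  (forall a b, (F (upd x k (val a)) - F (upd x k (val b))) ^+ 2 <= c) ->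
  vark k F x <= c.
Proof.
move=> Fc; rewrite -[c](wmean_cst p_sum1); apply: wmean_le => // a.
by rewrite -[c](wmean_cst p_sum1); apply: wmean_le.
Qed.

Lemma sum_sqr_le (I : eqType) (s : seq I) (c : I -> R) :
  (forall i, 0 <= c i) -> \sum_(i <- s) c i ^+ 2 <= (\sum_(i <- s) c i) ^+ 2.
Proof.
move=> c0; elim: s => [|i s IH]; first by rewrite !big_nil expr0n.
have S0 : 0 <= \sum_(i <- s) c i by rewrite sumr_ge0.
rewrite !big_cons; have := mulr_ge0 (c0 i) S0; nra.
Qed.

(** Coordinates are peeled off one at a time with [wmean_fourth]; the quadratic term it produces is
    controlled by the Efron-Stein bound on the remaining coordinates. *)
Lemma Ex_fourth_moment s (F : (nat -> R) -> R) (c : nat -> R) x0 :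
  uniq s -> (forall k, 0 <= c k) ->
  (forall k x a b, k \in s ->
    `|F (upd x k (val a)) - F (upd x k (val b))| <= c k) ->
  Ex s (fun x => (F x - Ex s F x0) ^+ 4) x0 <=
  11 * (\sum_(k <- s) c k ^+ 2) ^+ 2.
Proof.
move=> us c0 Fc.
(* The two-term bound is the one stable under induction; 11 = 8 + 3 after bounding the sum of fourth
   powers by the square of the sum of squares. *)
suff : Ex s (fun x => (F x - Ex s F x0) ^+ 4) x0 <=
    8 * (\sum_(k <- s) c k ^+ 2) ^+ 2 + 3 * \sum_(k <- s) (c k ^+ 2) ^+ 2.
  by move=> /le_trans; apply; have := sum_sqr_le s (fun k => sqr_ge0 (c k)); lra.
elim: s F us Fc => [|k s IH] F /=.
  by move=> _ _; rewrite !big_nil subrr !expr0n/= !mulr0 addr0.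
move=> /andP[ks us] Fc; rewrite !big_cons.
have FCk l x a b : l \in s ->
    `|avg k F (upd x l (val a)) - avg k F (upd x l (val b))| <= c l.
  move=> ls; have kl : k != l by apply: contraNneq ks => ->.
  rewrite /avg -sumrB -[c l](wmean_cst p_sum1).
  apply: le_trans (ler_norm_sum _ _ _) _; apply: ler_sum => d _.
  rewrite -mulrBr normrM ger0_norm// ler_wpM2l// -!(upd_comm _ _ _ kl) Fc//.
  by rewrite in_cons ls orbT.
set mu := Ex s (avg k F) x0.
have V2 : Ex s (fun x => (avg k F x - mu) ^+ 2) x0 <= \sum_(l <- s) c l ^+ 2.
  have := @Ex_variance 'I_1 s (fun _ => avg k F) (fun l => c l ^+ 2) x0 us.
  rewrite big_ord1; apply=> l x ls; rewrite big_ord1.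
  apply: vark_le => a b; rewrite -real_normK ?num_real//.
  by rewrite ler_sqr ?nnegrE// FCk.
apply: (@le_trans _ _ (Ex s (fun x => (avg k F x - mu) ^+ 4 +
   (8 * c k ^+ 2 * (avg k F x - mu) ^+ 2 + 3 * c k ^+ 4)) x0)).
  apply: Ex_le => x; rewrite /avg addrA; apply: wmean_fourth => // a.
  rewrite -[F (upd x k (val a)) in leLHS](wmean_cst p_sum1) -sumrB.
  rewrite -[c k](wmean_cst p_sum1) (le_trans (ler_norm_sum _ _ _))//.
  apply: ler_sum => b _; rewrite -mulrBr normrM (ger0_norm (p_ge0 b)).
  by rewrite ler_wpM2l// Fc// mem_head.
rewrite ExD ExD Ex_cst ExZ.
have := IH _ us FCk; rewrite -/mu.
set S := \sum_(l <- s) c l ^+ 2 in V2 *.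
have := ler_wpM2l (sqr_ge0 (c k)) V2.
have : 0 <= (c k ^+ 2) ^+ 2 by rewrite sqr_ge0.
have : 0 <= c k ^+ 2 * S.
  by rewrite mulr_ge0 ?sqr_ge0// sumr_ge0// => l _; rewrite sqr_ge0.
rewrite -exprM; nra.
Qed.

End product_expectation.

(** * Resolvents and normalized traces *)

Local Open Scope complex_scope.

Lemma sqr_sum_le (R : realFieldType) (I : finType) (P : pred I) (f : I -> R) :
  (\sum_(i | P i) f i) ^+ 2 <= #|P|%:R * \sum_(i | P i) f i ^+ 2.
Proof.
have E : \sum_(i | P i) \sum_(j | P j) (f i - f j) ^+ 2 =
    2 * (#|P|%:R * \sum_(i | P i) f i ^+ 2 - (\sum_(i | P i) f i) ^+ 2).
  rewrite [RHS](_ : _ = #|P|%:R * (\sum_(i | P i) f i ^+ 2)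
    + #|P|%:R * (\sum_(i | P i) f i ^+ 2) - 2 * (\sum_(i | P i) f i) ^+ 2);
    last by ring.
  have -> : \sum_(i | P i) \sum_(j | P j) (f i - f j) ^+ 2 =
      \sum_(i | P i) \sum_(j | P j) (f i ^+ 2 + f j ^+ 2 - 2 * (f i * f j)).
    by apply: eq_bigr => i _; apply: eq_bigr => j _; ring.
  under eq_bigr do rewrite sumrB big_split /= sumr_const.
  rewrite sumrB big_split /= sumr_const; congr (_ + _ - _).
  - by rewrite mulr_natl sumrMnl.
  - by rewrite mulr_natl.
  - rewrite expr2 mulr_suml mulr_sumr; apply: eq_bigr => i _.
    by rewrite -!mulr_sumr.
have : 0 <= \sum_(i | P i) \sum_(j | P j) (f i - f j) ^+ 2.
  by do 2 (apply: sumr_ge0 => ? _); exact: sqr_ge0.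
rewrite E; lra.
Qed.

Section squared_modulus.
Context (R : rcfType).
Local Notation C := R[i].

(** Squared modulus with values in [R]: the norm of [R[i]] takes values in [R[i]], whereas all
    estimates below compare reals. *)
Definition nsq (z : C) : R := Re z ^+ 2 + Im z ^+ 2.

Lemma ReD (x y : C) : Re (x + y) = Re x + Re y. Proof. by case: x y => [a b] []. Qed.
Lemma ImD (x y : C) : Im (x + y) = Im x + Im y. Proof. by case: x y => [a b] []. Qed.

Lemma Re_sum (I : Type) (r : seq I) (P : pred I) (F : I -> C) :
  Re (\sum_(i <- r | P i) F i) = \sum_(i <- r | P i) Re (F i).
Proof. exact: (big_morph _ ReD). Qed.
Lemma Im_sum (I : Type) (r : seq I) (P : pred I) (F : I -> C) :
  Im (\sum_(i <- r | P i) F i) = \sum_(i <- r | P i) Im (F i).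
Proof. exact: (big_morph _ ImD). Qed.

Lemma ReZ (a : R) (z : C) : Re (a%:C * z) = a * Re z.
Proof. by case: z => b c /=; rewrite mul0r subr0. Qed.
Lemma ImZ (a : R) (z : C) : Im (a%:C * z) = a * Im z.
Proof. by case: z => b c /=; rewrite mul0r addr0. Qed.

Lemma nsq_ge0 z : 0 <= nsq z. Proof. by rewrite addr_ge0 ?sqr_ge0. Qed.
Lemma nsq0 : nsq 0 = 0. Proof. by rewrite /nsq expr0n addr0. Qed.
Lemma nsq_eq0 z : nsq z = 0 -> z = 0.
Proof.
case: z => a b /eqP; rewrite /nsq /= paddr_eq0 ?sqr_ge0// !sqrf_eq0.
by move=> /andP[/eqP-> /eqP->].
Qed.
Lemma nsqM z w : nsq (z * w) = nsq z * nsq w.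
Proof. by case: z w => [a b] [c d]; rewrite /nsq /=; ring. Qed.
Lemma nsqR (a : R) : nsq a%:C = a ^+ 2.
Proof. by rewrite /nsq /= expr0n addr0. Qed.
Lemma nsqN z : nsq (- z) = nsq z.
Proof. by case: z => a b; rewrite /nsq /=; ring. Qed.
Lemma nsqD z w : nsq (z + w) <= 2 * nsq z + 2 * nsq w.
Proof.
case: z w => [a b] [c d]; rewrite /nsq /=.
have := sqr_ge0 (a - c); have := sqr_ge0 (b - d); nra.
Qed.

Lemma nsq_sum (I : finType) (P : pred I) (F : I -> C) :
  nsq (\sum_(i | P i) F i) <= #|P|%:R * \sum_(i | P i) nsq (F i).
Proof.
rewrite /nsq Re_sum Im_sum big_split mulrDr.
by apply: lerD; exact: sqr_sum_le.
Qed.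

Lemma nsq_wmean (V : finType) (p : V -> R) (F : V -> C) :
  (forall a, 0 <= p a) -> \sum_a p a = 1 ->
  nsq (\sum_a (p a)%:C * F a) <= \sum_a p a * nsq (F a).
Proof.
move=> p0 p1; rewrite /nsq Re_sum Im_sum.
under eq_bigr do rewrite ReZ; under [X in _ + X ^+ 2]eq_bigr do rewrite ImZ.
under [leRHS]eq_bigr do rewrite mulrDr.
by rewrite big_split /= lerD// wmean_sqr.
Qed.

End squared_modulus.

Section squared_norm.
Context (R : rcfType).
Local Notation C := R[i].

Definition hs m n (M : 'M[C]_(m, n)) : R := \sum_i \sum_j nsq (M i j).

(* A bound [c] on the square of the operator norm for right multiplication *)
Definition opb m n (M : 'M[C]_(m, n)) (c : R) :=
  forall u : 'rV[C]_m, hs (u *m M) <= c * hs u.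

Lemma hs_ge0 m n (M : 'M[C]_(m, n)) : 0 <= hs M.
Proof. by do 2 (apply: sumr_ge0 => ? _); exact: nsq_ge0. Qed.

Lemma hs_row m n (M : 'M[C]_(m, n)) : hs M = \sum_i hs (row i M).
Proof.
apply: eq_bigr => i _; rewrite /hs big_ord1.
by apply: eq_bigr => j _; rewrite mxE.
Qed.

Lemma hs_tr m n (M : 'M[C]_(m, n)) : hs M^T = hs M.
Proof.
by rewrite /hs exchange_big; do 2 (apply: eq_bigr => ? _); rewrite mxE.
Qed.

Lemma hs_eq0 m n (M : 'M[C]_(m, n)) : hs M <= 0 -> M = 0.
Proof.
move=> M0; have /eqP : hs M = 0 by apply/le_anti; rewrite M0 hs_ge0.
rewrite psumr_eq0 => [/allP HM|i _]; last by apply: sumr_ge0 => j _; exact: nsq_ge0.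
apply/matrixP => i j; rewrite mxE; apply: nsq_eq0; apply/eqP.
have := HM i (mem_index_enum i); rewrite /= psumr_eq0 => [/allP H|k _].
  exact: H (mem_index_enum j).
exact: nsq_ge0.
Qed.

Lemma hsZ m n z (M : 'M[C]_(m, n)) : hs (z *: M) = nsq z * hs M.
Proof.
rewrite /hs mulr_sumr; apply: eq_bigr => i _; rewrite mulr_sumr.
by apply: eq_bigr => j _; rewrite mxE nsqM.
Qed.

Lemma hsN m n (M : 'M[C]_(m, n)) : hs (- M) = hs M.
Proof. by do 2 (apply: eq_bigr => ? _); rewrite mxE nsqN. Qed.

Lemma hsD m n (A B : 'M[C]_(m, n)) : hs (A + B) <= 2 * hs A + 2 * hs B.
Proof.
rewrite /hs !mulr_sumr -big_split; apply: ler_sum => i _ /=.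
rewrite !mulr_sumr -big_split; apply: ler_sum => j _ /=.
by rewrite mxE nsqD.
Qed.

Lemma hs_wmean (V : finType) (p : V -> R) m n (F : V -> 'M[C]_(m, n)) :
  (forall a, 0 <= p a) -> \sum_a p a = 1 ->
  hs (\sum_a (p a)%:C *: F a) <= \sum_a p a * hs (F a).
Proof.
move=> p0 p1; rewrite /hs.
under [leRHS]eq_bigr do rewrite mulr_sumr.
rewrite [leRHS]exchange_big /=; apply: ler_sum => i _.
under [leRHS]eq_bigr do rewrite mulr_sumr.
rewrite [leRHS]exchange_big /=; apply: ler_sum => j _.
rewrite summxE; under [X in nsq X]eq_bigr do rewrite mxE.
exact: nsq_wmean.
Qed.

Lemma hs_mulr l m n (A : 'M[C]_(l, m)) (B : 'M[C]_(m, n)) c :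
  opb B c -> hs (A *m B) <= c * hs A.
Proof.
move=> Bc; rewrite !hs_row mulr_sumr; apply: ler_sum => i _.
by rewrite row_mul Bc.
Qed.

Lemma hs_mull l m n (A : 'M[C]_(l, m)) (B : 'M[C]_(m, n)) c :
  opb A^T c -> hs (A *m B) <= c * hs B.
Proof. by move=> Ac; rewrite -hs_tr trmx_mul -(hs_tr B) hs_mulr. Qed.

Lemma opbM l m n (A : 'M[C]_(l, m)) (B : 'M[C]_(m, n)) a b : 0 <= b ->
  opb A a -> opb B b -> opb (A *m B) (b * a).
Proof.
move=> b0 Aa Bb u; rewrite mulmxA (le_trans (Bb _))// -mulrA ler_wpM2l//.
Qed.

Lemma opb_le m n (A : 'M[C]_(m, n)) a b : a <= b -> opb A a -> opb A b.
Proof. by move=> ab Aa u; rewrite (le_trans (Aa u))// ler_wpM2r// hs_ge0. Qed.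

Lemma opbN m n (A : 'M[C]_(m, n)) a : opb A a -> opb (- A) a.
Proof. by move=> Aa u; rewrite mulmxN hsN. Qed.

Lemma opbZ m n z (A : 'M[C]_(m, n)) a : opb A a -> opb (z *: A) (nsq z * a).
Proof.
by move=> Aa u; rewrite -scalemxAr hsZ -mulrA ler_wpM2l// nsq_ge0.
Qed.

Lemma opbD m n (A B : 'M[C]_(m, n)) a b : opb A a -> opb B b ->
  opb (A + B) (2 * a + 2 * b).
Proof.
move=> Aa Bb u; rewrite mulmxDr (le_trans (hsD _ _))//.
have := Aa u; have := Bb u; lra.
Qed.

Lemma opb_wmean (V : finType) (p : V -> R) m n (F : V -> 'M[C]_(m, n)) c :
  (forall a, 0 <= p a) -> \sum_a p a = 1 -> (forall a, opb (F a) c) ->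
  opb (\sum_a (p a)%:C *: F a) c.
Proof.
move=> p0 p1 Fc u; rewrite mulmx_sumr.
under eq_bigr do rewrite -scalemxAr.
rewrite (le_trans (hs_wmean _ p0 p1))// -[leRHS](wmean_cst p1).
by apply: wmean_le => // a; exact: Fc.
Qed.

Lemma hs_delta n (i : 'I_n) : hs (delta_mx 0 i : 'rV[C]_n) = 1.
Proof.
rewrite /hs big_ord1 (bigD1 i)//= big1 => [|j ji].
  by rewrite mxE !eqxx /= nsqR expr1n addr0.
by rewrite mxE (negbTE ji) andbF nsq0.
Qed.

Lemma opb_row m n (M : 'M[C]_(m, n)) c i : opb M c -> hs (row i M) <= c.
Proof. by move=> /(_ (delta_mx 0 i)); rewrite -rowE hs_delta mulr1. Qed.

Lemma opb_hs n (M : 'M[C]_n) c : opb M c -> hs M <= c * n%:R.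
Proof.
move=> Mc; rewrite hs_row; apply: le_trans (ler_sum _ (fun i _ => opb_row i Mc)) _.
by rewrite sumr_const card_ord mulr_natr.
Qed.

Lemma nsq_le_hs m n (M : 'M[C]_(m, n)) i j : nsq (M i j) <= hs M.
Proof.
rewrite /hs (bigD1 i)//= (bigD1 j)//= -addrA lerDl addr_ge0//.
  by apply: sumr_ge0 => k _; exact: nsq_ge0.
by do 2 (apply: sumr_ge0 => ? _); exact: nsq_ge0.
Qed.

Lemma opb_entry m n (M : 'M[C]_(m, n)) c i j : opb M c -> nsq (M i j) <= c.
Proof.
move=> /(opb_row i); apply: le_trans.
by rewrite (le_trans _ (nsq_le_hs (row i M) 0 j))// mxE.
Qed.

(** Each column of the matrix contains at most one 1, so an entry of [u *m M] is an entry of [u] or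
    0, and no entry of [u] is used twice. *)
Lemma opb_partial_perm n (r : rel 'I_n) :
  (forall i j k, r i j -> r i k -> j = k) ->
  (forall i j k, r i k -> r j k -> i = j) ->
  opb (\matrix_(i, j) (r i j)%:R : 'M[C]_n) 1.
Proof.
move=> rl rr u; rewrite mul1r /hs !big_ord1.
apply: (@le_trans _ _ (\sum_j \sum_(k | r k j) nsq (u 0 k))).
  apply: ler_sum => j _; rewrite mxE.
  under eq_bigr do rewrite mxE mulr_natr mulrb.
  rewrite -big_mkcond; apply: le_trans (nsq_sum _ _) _.
  apply: ler_piMl; first by apply: sumr_ge0 => k _; exact: nsq_ge0.
  rewrite lern1; apply/card_le1_eqP => i l ri rl'; exact: (rr _ _ j).
rewrite (exchange_big_dep xpredT)//=; apply: ler_sum => k _.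
rewrite sumr_const -mulr_natl ler_piMl ?nsq_ge0// lern1.
by apply/card_le1_eqP => i j ri rj; exact: (rl k).
Qed.

End squared_norm.

Section resolvent.
Context (R : rcfType) (n : nat).
Local Notation C := R[i].
Implicit Types (S : 'M[R]_n) (y : R).

Definition shift_i y S : 'M[C]_n := map_mx (real_complex R) S - ((0 +i* y)%C)%:M.

Definition res y S : 'M[C]_n := invmx (shift_i y S).

(** For real symmetric [S] the cross terms between real and imaginary parts of [u] cancel. Both the
    invertibility of [S - i y] and the bound 1 / y on its inverse follow. *)
Lemma hs_shift_i y S (u : 'rV[C]_n) : S^T = S ->
  hs (u *m shift_i y S) = hs (u *m map_mx (real_complex R) S) + y ^+ 2 * hs u.
Proof.
move=> symS.
pose a := map_mx (@complex.Re R) u; pose b := map_mx (@complex.Im R) u.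
have uSE j : (u *m map_mx (real_complex R) S) 0 j = (a *m S) 0 j +i* (b *m S) 0 j.
  apply/eqP; rewrite eq_complex /= !mxE Re_sum Im_sum; apply/andP; split; apply/eqP;
  by apply: eq_bigr => k _; rewrite !mxE mulrC ?ReZ ?ImZ mulrC.
have cross : \sum_j (a *m S) 0 j * b 0 j = \sum_j (b *m S) 0 j * a 0 j.
  transitivity ((a *m S *m b^T) 0 0).
    by rewrite [RHS]mxE; apply: eq_bigr => j _; rewrite [b^T _ _]mxE.
  have -> : a *m S *m b^T = (b *m S *m a^T)^T by rewrite !trmx_mul trmxK symS mulmxA.
  rewrite [LHS]mxE [LHS]mxE.
  by apply: eq_bigr => j _; rewrite [a^T _ _]mxE.
rewrite /hs !big_ord1 mulr_sumr -big_split /=.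
rewrite [RHS](_ : _ = \sum_j (nsq ((u *m map_mx (real_complex R) S) 0 j)
    + y ^+ 2 * nsq (u 0 j)
    + 2 * y * ((a *m S) 0 j * b 0 j - (b *m S) 0 j * a 0 j))); last first.
  by rewrite [RHS]big_split /= -mulr_sumr sumrB cross subrr mulr0 addr0.
apply: eq_bigr => j _.
have -> : (u *m shift_i y S) 0 j =
    (u *m map_mx (real_complex R) S) 0 j - (0 +i* y)%C * u 0 j.
  by rewrite /shift_i mulmxBr mul_mx_scalar [LHS]mxE; congr (_ + _); rewrite !mxE.
have -> : a 0 j = Re (u 0 j) by rewrite mxE.
have -> : b 0 j = Im (u 0 j) by rewrite mxE.
rewrite uSE; move: ((a *m S) 0 j) ((b *m S) 0 j) => e f.
by case: (u 0 j) => c d; rewrite /nsq /=; ring.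
Qed.

Lemma shift_i_unit y S : S^T = S -> 0 < y -> shift_i y S \in unitmx.
Proof.
move=> symS y0; rewrite -row_free_unit; apply/row_freeP.
suff : kermx (shift_i y S) = 0.
  move=> /eqP; rewrite kermx_eq0 => /row_freeP//.
apply/row_matrixP => i; rewrite row0; apply: hs_eq0.
have := hs_shift_i y (row i (kermx (shift_i y S))) symS.
rewrite -row_mul mulmx_ker row0 => /esym H.
have : y ^+ 2 * hs (row i (kermx (shift_i y S))) <= 0.
  rewrite (_ : 0 = hs (0 : 'rV[C]_n)); last first.
    by rewrite /hs big_ord1 big1// => j _; rewrite mxE nsq0.
  by rewrite -H lerDr hs_ge0.
by rewrite pmulr_rle0// exprn_gt0.
Qed.

Lemma opb_res y S : S^T = S -> 0 < y -> opb (res y S) (y ^- 2).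
Proof.
move=> symS y0 u; rewrite mulrC ler_pdivlMr ?exprn_gt0// mulrC.
have := hs_shift_i y (u *m res y S) symS.
rewrite mulmxKV ?shift_i_unit// => ->.
by rewrite lerDr hs_ge0.
Qed.

Lemma res_tr y S : S^T = S -> (res y S)^T = res y S.
Proof.
move=> symS; rewrite /res trmx_inv; congr invmx; apply/matrixP => i j.
by rewrite !mxE -[in LHS]symS mxE (eq_sym j).
Qed.

Lemma res_sub y S S' : S^T = S -> S'^T = S' -> 0 < y ->
  res y S' - res y S =
  res y S *m map_mx (real_complex R) (S - S') *m res y S'.
Proof.
move=> s s' y0.
have -> : map_mx (real_complex R) (S - S') = shift_i y S - shift_i y S'.
  by rewrite /shift_i map_mxB opprB addrA subrK.
rewrite mulmxBr mulmxBl mulVmx ?shift_i_unit// mul1mx.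
by rewrite -mulmxA mulmxV ?shift_i_unit// mulmx1.
Qed.

Lemma res_eq y S : S^T = S -> 0 < y ->
  1%:M + ((0 +i* y)%C) *: res y S = map_mx (real_complex R) S *m res y S.
Proof.
move=> s y0; have := mulmxV (shift_i_unit s y0).
rewrite {1}/shift_i mulmxBl mul_scalar_mx -/(res y S) => <-.
by rewrite subrK.
Qed.

End resolvent.

Section normalized_trace.
Context (R : rcfType) (n : nat).
Hypothesis n_gt0 : (0 < n)%N.
Local Notation C := R[i].
Local Notation N := (n%:R : R).
Implicit Types (S : 'M[R]_n) (A B : 'M[C]_n).

Definition ntr A : C := (N^-1)%:C * \tr A.

Let N0 : 0 < N. Proof. by rewrite ltr0n. Qed.

Lemma ntrB A B : ntr (A - B) = ntr A - ntr B.
Proof. by rewrite /ntr raddfB mulrBr. Qed.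

Lemma ntr_scalar z : ntr z%:M = z.
Proof.
rewrite /ntr mxtrace_scalar -[z *+ n]mulr_natr mulrCA -(rmorph_nat (real_complex R)).
by rewrite -rmorphM mulVf ?gt_eqF// mulr1.
Qed.

Lemma nsq_ntr A : nsq (ntr A) <= N^-1 * hs A.
Proof.
rewrite /ntr nsqM nsqR.
have tD : nsq (\tr A) <= N * hs A.
  apply: le_trans (nsq_sum _ _) _; rewrite cardT size_enum_ord ler_wpM2l//.
  apply: ler_sum => i _; rewrite (bigD1 i)//= lerDl sumr_ge0// => j _.
  exact: nsq_ge0.
apply: le_trans (ler_wpM2l (sqr_ge0 _) tD) _.
by rewrite mulrA expr2 divfK// gt_eqF.
Qed.

Variable y : R.
Hypothesis y_ge1 : 1 <= y.
Let y0 : 0 < y. Proof. by apply: lt_le_trans y_ge1. Qed.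
Let w1 : y ^- 2 <= 1. Proof. by rewrite invf_le1 ?exprn_gt0// exprn_ege1. Qed.
Let opb1 S : S^T = S -> opb (res y S) 1.
Proof. by move=> sS; apply: opb_le (opb_res sS y0). Qed.

(** A substitute for the Hoffman-Wielandt inequality, from the resolvent identity and the norm bound
    1 on both resolvents. It controls the discretization error. *)
Lemma ntr_res_perturb S S' : S^T = S -> S'^T = S' ->
  nsq (ntr (res y S') - ntr (res y S)) <= N^-1 * \sum_i \sum_j (S i j - S' i j) ^+ 2.
Proof.
move=> sS sS'; rewrite -ntrB res_sub//; apply: le_trans (nsq_ntr _) _.
rewrite ler_pM2l ?invr_gt0//.
apply: le_trans (hs_mulr _ (opb1 sS')) _; rewrite mul1r.
have oT : opb (res y S)^T 1 by rewrite res_tr//; exact: opb1.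
apply: le_trans (hs_mull _ oT) _; rewrite mul1r.
by do 2 (apply: ler_sum => ? _); rewrite !mxE nsqR.
Qed.

(** The sum is the quadratic form of [Z] at the all-ones vector, whose squared norm is [n]. *)
Lemma nsq_sum_entries (Z : 'M[C]_n) : opb Z 1 ->
  nsq (\sum_i \sum_j Z i j) <= N ^+ 2.
Proof.
move=> /(_ (const_mx 1)); set u : 'rV[C]_n := const_mx 1 => uZ.
have -> : \sum_i \sum_j Z i j = \sum_j (u *m Z) 0 j.
  rewrite exchange_big; apply: eq_bigr => j _; rewrite mxE.
  by apply: eq_bigr => i _; rewrite [u 0 i]mxE mul1r.
have uN : hs u = N.
  rewrite /hs big_ord1 (eq_bigr (fun=> 1)) => [|j _]; last by rewrite mxE nsqR expr1n.
  by rewrite sumr_const card_ord.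
apply: le_trans (nsq_sum _ _) _; rewrite cardT size_enum_ord expr2 ler_wpM2l//.
by move: uZ; rewrite mul1r uN {1}/hs big_ord1.
Qed.

(* A rank-one shift of the entries is invisible in the limit although its
   Hilbert-Schmidt norm is not small. *)
Lemma ntr_res_shift S t : S^T = S ->
  nsq (ntr (res y (S + const_mx t)) - ntr (res y S)) <= t ^+ 2.
Proof.
move=> sS; have sS' : (S + const_mx t)^T = S + const_mx t.
  by rewrite linearD /= sS trmx_const.
rewrite -ntrB res_sub// opprD addrA subrr sub0r.
set G := res y S; set G' := res y _.
have -> : map_mx (real_complex R) (- const_mx t) =
    (- t)%:C *: const_mx 1 :> 'M[C]_n.
  by apply/matrixP => i j; rewrite !mxE mulr1.
rewrite -scalemxAr -scalemxAl /ntr linearZ /= mulrCA nsqM nsqR sqrrN.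
rewrite ler_piMr ?sqr_ge0// -mulmxA mxtrace_mulC -mulmxA.
have oZ : opb (G' *m G) 1 by rewrite -[1]mul1r; apply: opbM => //; exact: opb1.
(* By cyclicity the trace reduces to the sum of all entries of [G' *m G], a matrix of norm at most
   1. *)
have -> : \tr ((const_mx 1 : 'M[C]_n) *m (G' *m G)) = \sum_i \sum_j (G' *m G) i j.
  rewrite exchange_big; apply: eq_bigr => j _; rewrite mxE.
  by apply: eq_bigr => i _; rewrite [const_mx 1 _ _]mxE mul1r.
rewrite nsqM nsqR exprVn mulrC ler_pdivrMr ?exprn_gt0// mul1r.
exact: nsq_sum_entries.
Qed.

End normalized_trace.

(** * The matrix Dyson equation *)

Section matrix_expectation.
Context (R : rcfType) (V : finType) (p val : V -> R).
Hypotheses (p_ge0 : forall a, 0 <= p a) (p_sum1 : \sum_a p a = 1).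
Local Notation C := R[i].
Local Notation Ex := (Ex p val).

Definition avgM m n k (F : (nat -> R) -> 'M[C]_(m, n)) : (nat -> R) -> 'M[C]_(m, n) :=
  fun x => \sum_a (p a)%:C *: F (upd x k (val a)).

Fixpoint ExM m n s (F : (nat -> R) -> 'M[C]_(m, n)) : (nat -> R) -> 'M[C]_(m, n) :=
  if s is k :: s' then ExM s' (avgM k F) else F.

Lemma ExM_ext m n s (F G : (nat -> R) -> 'M[C]_(m, n)) x :
  (forall y, F y = G y) -> ExM s F x = ExM s G x.
Proof. by move=> /funext ->. Qed.

Lemma avgM_cst m n k (A : 'M[C]_(m, n)) x : avgM k (fun=> A) x = A.
Proof. by rewrite /avgM -scaler_suml -rmorph_sum p_sum1 scale1r. Qed.

Lemma ExM_cst m n s (A : 'M[C]_(m, n)) x : ExM s (fun=> A) x = A.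
Proof.
elim: s => //= k s IH; rewrite -[RHS]IH; apply: ExM_ext => y; exact: avgM_cst.
Qed.

Lemma ExM_linear m n m' n' s (phi : {linear 'M[C]_(m, n) -> 'M[C]_(m', n')})
    (F : (nat -> R) -> 'M[C]_(m, n)) x :
  ExM s (fun y => phi (F y)) x = phi (ExM s F x).
Proof.
elim: s F => //= k s IH F; rewrite -IH; apply: ExM_ext => y.
by rewrite /avgM linear_sum; apply: eq_bigr => a _; rewrite linearZ.
Qed.

Lemma ExMD m n s (F G : (nat -> R) -> 'M[C]_(m, n)) x :
  ExM s (fun y => F y + G y) x = ExM s F x + ExM s G x.
Proof.
elim: s F G => //= k s IH F G; rewrite -IH; apply: ExM_ext => y.
by rewrite /avgM -big_split; apply: eq_bigr => a _; rewrite scalerDr.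
Qed.

Lemma ExM_sum (I : finType) m n s (F : I -> (nat -> R) -> 'M[C]_(m, n)) x :
  ExM s (fun y => \sum_i F i y) x = \sum_i ExM s (F i) x.
Proof.
elim: s F => //= k s IH F; rewrite -IH; apply: ExM_ext => y.
by rewrite /avgM exchange_big; apply: eq_bigr => a _; rewrite scaler_sumr.
Qed.

Lemma avgM_upd m n k (F : (nat -> R) -> 'M[C]_(m, n)) x v :
  avgM k F (upd x k v) = avgM k F x.
Proof. by apply: eq_bigr => a _; rewrite upd_same. Qed.

Lemma avgMC m n k l (F : (nat -> R) -> 'M[C]_(m, n)) x :
  avgM k (avgM l F) x = avgM l (avgM k F) x.
Proof.
have [->//|kl] := eqVneq k l.
rewrite /avgM; under eq_bigr do rewrite scaler_sumr.
rewrite exchange_big /=; apply: eq_bigr => a _; rewrite scaler_sumr.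
by apply: eq_bigr => b _; rewrite !scalerA mulrC upd_comm.
Qed.

Lemma avgM_avgM m n k (F : (nat -> R) -> 'M[C]_(m, n)) x :
  avgM k (avgM k F) x = avgM k F x.
Proof.
by rewrite -[RHS](avgM_cst k _ x); apply: eq_bigr => a _; rewrite avgM_upd.
Qed.

Lemma ExM_avg m n s k (F : (nat -> R) -> 'M[C]_(m, n)) x :
  k \in s -> ExM s (avgM k F) x = ExM s F x.
Proof.
elim: s F => //= l s IH F; rewrite inE => /predU1P[->|ks].
  by apply: ExM_ext => y; rewrite avgM_avgM.
by rewrite -[RHS](IH _ ks); apply: ExM_ext => y; rewrite avgMC.
Qed.

Lemma hs_ExM m n s (F : (nat -> R) -> 'M[C]_(m, n)) x :
  hs (ExM s F x) <= Ex s (fun y => hs (F y)) x.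
Proof.
elim: s F => //= k s IH F; apply: le_trans (IH _) _; apply: Ex_le => // y.
exact: hs_wmean.
Qed.

Lemma opb_ExM m n s (F : (nat -> R) -> 'M[C]_(m, n)) c x :
  (forall y, opb (F y) c) -> opb (ExM s F x) c.
Proof. by elim: s F => //= k s IH F Fc; apply: IH => y; exact: opb_wmean. Qed.

Lemma Re_ExM m n s (F : (nat -> R) -> 'M[C]_(m, n)) x i j :
  Re (ExM s F x i j) = Ex s (fun y => Re (F y i j)) x.
Proof.
elim: s F => //= k s IH F; rewrite IH; apply: Ex_ext => y.
by rewrite /avgM summxE Re_sum; apply: eq_bigr => a _; rewrite mxE ReZ.
Qed.

Lemma Im_ExM m n s (F : (nat -> R) -> 'M[C]_(m, n)) x i j :
  Im (ExM s F x i j) = Ex s (fun y => Im (F y i j)) x.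
Proof.
elim: s F => //= k s IH F; rewrite IH; apply: Ex_ext => y.
by rewrite /avgM summxE Im_sum; apply: eq_bigr => a _; rewrite mxE ImZ.
Qed.

(** Writes [hs] as a sum of squares of real coordinates, the form in which the vector-valued
    Efron-Stein inequality applies to matrices. *)
Lemma hs_sum_pair m n (M : 'M[C]_(m, n)) :
  hs M = \sum_(t : 'I_m * 'I_n * bool)
    (if t.2 then Re (M t.1.1 t.1.2) else Im (M t.1.1 t.1.2)) ^+ 2.
Proof.
rewrite -(pair_bigA _ (fun (ij : 'I_m * 'I_n) (b : bool) =>
  (if b then Re (M ij.1 ij.2) else Im (M ij.1 ij.2)) ^+ 2)) /=.
rewrite -(pair_bigA _ (fun (i : 'I_m) (j : 'I_n) =>
  \sum_b (if b then Re (M i j) else Im (M i j)) ^+ 2)) /=.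
by do 2 (apply: eq_bigr => ? _); rewrite big_bool.
Qed.

Lemma ExM_variance m n s (F : (nat -> R) -> 'M[C]_(m, n)) (c : nat -> R) x0 :
  uniq s ->
  (forall k x a b, k \in s ->
    hs (F (upd x k (val a)) - F (upd x k (val b))) <= c k) ->
  Ex s (fun x => hs (F x - ExM s F x0)) x0 <= \sum_(k <- s) c k.
Proof.
move=> us Fc.
pose f (t : 'I_m * 'I_n * bool) x :=
  if t.2 then Re (F x t.1.1 t.1.2) else Im (F x t.1.1 t.1.2).
have fB (M N : 'M[C]_(m, n)) i j : Re ((M - N) i j) = Re (M i j) - Re (N i j)
    /\ Im ((M - N) i j) = Im (M i j) - Im (N i j).
  by rewrite !mxE; case: (M i j) (N i j) => [? ?] [? ?].
have H k x : k \in s -> \sum_t vark p val k (f t) x <= c k.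
  move=> ks; rewrite /vark exchange_big /= -[leRHS](wmean_cst p_sum1).
  apply: ler_sum => a _; rewrite -mulr_sumr ler_wpM2l// exchange_big /=.
  rewrite -[leRHS](wmean_cst p_sum1).
  apply: ler_sum => b _; rewrite -mulr_sumr ler_wpM2l//.
  apply: le_trans (Fc k x a b ks); rewrite hs_sum_pair; apply: ler_sum => -[[i j] d] _.
  by rewrite /f /=; case: d; rewrite ?(fB _ _ i j).1 ?(fB _ _ i j).2.
apply: le_trans (Ex_variance p_ge0 p_sum1 x0 us H); rewrite -Ex_sum//.
apply: Ex_le => // x; rewrite hs_sum_pair; apply: ler_sum => -[[i j] b] _.
by rewrite /f /=; case: b; rewrite ?(fB _ _ i j).1 ?(fB _ _ i j).2 ?Re_ExM ?Im_ExM.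
Qed.

End matrix_expectation.

(** * Link patterns: multiplicities, energy and the covariance operator *)

Section pattern.
Context (R : rcfType) (n : nat) (c : 'I_n -> 'I_n -> nat) (s : seq nat).
Hypotheses (cC : forall i j, c i j = c j i)
  (c_inj : forall i j k, c i j = c i k -> j = k)
  (cs : forall i j, c i j \in s) (us : uniq s).
Local Notation C := R[i].

(** The derivative of the matrix with entries [x (c i j)] in the variable [x m]. *)
Definition patt m : 'M[C]_n := \matrix_(i, j) (c i j == m)%:R.

Definition mult m : nat := \sum_(i < n) \sum_(j < n) (c i j == m).

Definition cnt i l : nat := \sum_(j < n) \sum_(k < n) (c i j == c k l).

Definition energy : nat := \sum_(i < n) \sum_(l < n) cnt i l.

(** The expectation of W M W, where W has entries [x (c i j)] divided by the square root of [n] and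
    the [x m] are independent, centered, of variance 1. *)
Definition eta (M : 'M[C]_n) : 'M[C]_n :=
  \matrix_(i, l) (n%:R^-1 * \sum_j \sum_k (c i j == c k l)%:R * M j k).

Lemma eta_is_linear : linear eta.
Proof.
move=> a M N; apply/matrixP => i l; rewrite !mxE mulrCA -mulrDr; congr (_ * _).
rewrite mulr_sumr -big_split; apply: eq_bigr => j _.
rewrite mulr_sumr -big_split; apply: eq_bigr => k _.
by rewrite /= !mxE; ring.
Qed.
HB.instance Definition _ := GRing.isLinear.Build _ _ _ _ eta eta_is_linear.

Lemma opb_patt m : opb (patt m) 1.
Proof.
apply: (@opb_partial_perm _ _ (fun i j => c i j == m)).
  by move=> i j k /eqP <- /eqP /c_inj ->.
by move=> i j k /eqP <- /eqP; rewrite cC (cC i) => /c_inj ->.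
Qed.

Lemma hs_patt m : hs (patt m) = (mult m)%:R.
Proof.
rewrite /hs /mult natr_sum; apply: eq_bigr => i _.
rewrite natr_sum; apply: eq_bigr => j _; rewrite mxE.
by case: eqP => _; rewrite ?nsq0// nsqR expr1n.
Qed.

(** By symmetry and injectivity of [c], each [j] leaves at most one [k] with [c i j = c k l]. *)
Lemma cnt_le i l : (cnt i l <= n)%N.
Proof.
rewrite -[leqRHS]card_ord -sum1_card; apply: leq_sum => j _.
rewrite -big_mkcond sum1_card /=; apply/card_le1_eqP => k k'.
by rewrite !unfold_in /= => /eqP -> /eqP; rewrite cC (cC k') => /c_inj ->.
Qed.

(** After exchanging the sums, the weight of [f j k] is [cnt j k], hence at most [n]. *)
Lemma sum_cnt (f : 'I_n -> 'I_n -> R) : (forall j k, 0 <= f j k) ->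
  \sum_i \sum_l \sum_j \sum_k (c i j == c k l)%:R * f j k <=
  n%:R * \sum_j \sum_k f j k.
Proof.
move=> f0; under eq_bigr do rewrite exchange_big /=.
rewrite exchange_big mulr_sumr /=; apply: ler_sum => j _.
under eq_bigr do rewrite exchange_big /=.
rewrite exchange_big mulr_sumr /=; apply: ler_sum => k _.
under eq_bigr do rewrite -mulr_suml.
rewrite -mulr_suml ler_wpM2r//.
under eq_bigr do rewrite -natr_sum.
rewrite -natr_sum ler_nat; apply: leq_trans (cnt_le j k); apply: leq_sum => i _.
by apply: leq_sum => l _; rewrite (cC i) (cC k).
Qed.

Definition cross (i l : 'I_n) (M : 'M[C]_n) : C :=
  \sum_j \sum_k (c i j == c k l)%:R * M j k.

Lemma nsq_mask_sum (e : 'I_n -> 'I_n -> bool) (M : 'M[C]_n) :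
  nsq (\sum_j \sum_k (e j k)%:R * M j k) <=
  (\sum_j \sum_k e j k)%N%:R * \sum_j \sum_k (e j k)%:R * nsq (M j k).
Proof.
rewrite pair_bigA /=.
rewrite [X in nsq X](_ : _ = \sum_(t | e t.1 t.2) M t.1 t.2); last first.
  by rewrite [RHS]big_mkcond; apply: eq_bigr => t _; rewrite mulr_natl mulrb.
apply: le_trans (nsq_sum _ _) _; apply: ler_pM => //.
- by apply: sumr_ge0 => t _; exact: nsq_ge0.
- by rewrite ler_nat pair_bigA /= -sum1_card big_mkcond; apply: leq_sum => t _; rewrite unfold_in; case: (e _ _).
rewrite pair_bigA /= big_mkcond; apply: ler_sum => t _.
by rewrite mulr_natl mulrb; case: ifP; rewrite ?lexx.
Qed.

Lemma nsq_cross i l M :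
  nsq (cross i l M) <= (cnt i l)%:R * \sum_j \sum_k (c i j == c k l)%:R * nsq (M j k).
Proof. exact: nsq_mask_sum. Qed.

Lemma nsq_invn : nsq (n%:R^-1 : C) = n%:R^-1 ^+ 2.
Proof. by rewrite -(rmorph_nat (real_complex R)) -fmorphV nsqR. Qed.

Lemma hs_eta_cross M : hs (eta M) = n%:R^-1 ^+ 2 * \sum_i \sum_l nsq (cross i l M).
Proof.
rewrite /hs mulr_sumr; apply: eq_bigr => i _; rewrite mulr_sumr.
by apply: eq_bigr => l _; rewrite mxE nsqM nsq_invn.
Qed.

Lemma nn_inv_sqr : n%:R^-1 ^+ 2 * (n%:R * n%:R) <= 1 :> R.
Proof.
case: n => [|m]; first by rewrite mul0r mulr0.
by rewrite expr2 mulrACA mulVf ?mulr1// pnatr_eq0.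
Qed.

(** Cauchy-Schwarz in each entry costs [cnt i l <= n], and [sum_cnt] costs another [n]; together
    they cancel the normalization. *)
Lemma hs_eta M : hs (eta M) <= hs M.
Proof.
rewrite hs_eta_cross.
have f0 j k : 0 <= nsq (M j k) by exact: nsq_ge0.
have H : \sum_i \sum_l nsq (cross i l M) <= (n%:R * n%:R) * hs M.
  rewrite -mulrA (le_trans _ (ler_wpM2l (ler0n _ _) (sum_cnt f0)))// mulr_sumr.
  apply: ler_sum => i _; rewrite mulr_sumr; apply: ler_sum => l _.
  rewrite (le_trans (nsq_cross _ _ _))// ler_wpM2r ?ler_nat ?cnt_le//.
  by do 2 (apply: sumr_ge0 => ? _); rewrite mulr_ge0.
rewrite (le_trans (ler_wpM2l _ H)) ?sqr_ge0// mulrA ler_piMl ?hs_ge0//.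
exact: nn_inv_sqr.
Qed.

(** Refines [hs_eta]: where [cnt i l <= tau], Cauchy-Schwarz costs [tau] in place of [n]; the
    remaining pairs number at most [energy / tau] by Markov's inequality, and there the uniform
    bound [q] is used. *)
Lemma hs_eta_tau (M : 'M[C]_n) (q tau : R) : 0 < tau -> 0 <= q ->
  (forall i l, nsq (cross i l M) <= q) ->
  hs (eta M) <= n%:R^-1 ^+ 2 * (energy%:R / tau * q + tau * (n%:R * hs M)).
Proof.
move=> tau0 q0 Mq; rewrite hs_eta_cross ler_wpM2l ?sqr_ge0//.
have f0 j k : 0 <= nsq (M j k) by exact: nsq_ge0.
rewrite (le_trans _ (lerD (lexx _) (ler_wpM2l (ltW tau0) (sum_cnt f0))))//.
rewrite -mulrA mulr_sumr natr_sum mulr_suml -big_split; apply: ler_sum => i _ /=.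
rewrite mulr_sumr natr_sum mulr_suml -big_split; apply: ler_sum => l _ /=.
set S := \sum_j \sum_k _.
have S0 : 0 <= S by do 2 (apply: sumr_ge0 => ? _); rewrite mulr_ge0.
have [cle|clt] := leP (cnt i l)%:R tau.
  rewrite (le_trans (nsq_cross _ _ _))// -[leLHS]add0r lerD ?ler_wpM2r//.
  by rewrite mulr_ge0// mulr_ge0// invr_ge0 ltW.
apply: le_trans (Mq i l) _; apply: ler_wpDr; first by rewrite mulr_ge0// ltW.
by rewrite mulrA ler_peMl// ler_pdivlMr// mul1r ltW.
Qed.

Lemma nsq_tr_patt m (Z : 'M[C]_n) z : opb Z z ->
  nsq (\tr (patt m *m Z)) <= (mult m)%:R ^+ 2 * z.
Proof.
move=> Zz; have -> : \tr (patt m *m Z) = \sum_i \sum_j (c i j == m)%:R * Z^T i j.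
  by apply: eq_bigr => i _; rewrite mxE; apply: eq_bigr => j _; rewrite !mxE.
rewrite (le_trans (nsq_mask_sum _ _))// expr2 -mulrA ler_wpM2l//.
rewrite /mult natr_sum mulr_suml; apply: ler_sum => i _.
rewrite natr_sum mulr_suml; apply: ler_sum => j _.
by rewrite ler_wpM2l// mxE; exact: opb_entry.
Qed.

(** [cross i l] is the trace against a partial permutation [P]; cycling the trace leaves a sum of
    [mult m] entries of [B *m P *m A]. This supplies the uniform bound [q] of [hs_eta_tau]. *)
Lemma nsq_cross_sandwich i l m (A B : 'M[C]_n) a b : 0 <= a -> 0 <= b ->
  opb A a -> opb B b ->
  nsq (cross i l (A *m patt m *m B)) <= (mult m)%:R ^+ 2 * (a * b).
Proof.
move=> a0 b0 Aa Bb; pose P : 'M[C]_n := \matrix_(k, j) (c i j == c k l)%:R.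
have -> : cross i l (A *m patt m *m B) = \tr (patt m *m (B *m P *m A)).
  transitivity (\tr (A *m patt m *m B *m P)).
    apply: eq_bigr => j _; rewrite [RHS]mxE.
    by apply: eq_bigr => k _; rewrite [P _ _]mxE mulrC.
  by rewrite -!mulmxA mxtrace_mulC !mulmxA.
apply: nsq_tr_patt; apply: opbM => //; rewrite -[b]mul1r; apply: opbM => //.
apply: (@opb_partial_perm _ _ (fun k j => c i j == c k l)).
  by move=> k j j' /eqP <- /eqP /c_inj ->.
by move=> j j' k /eqP -> /eqP; rewrite cC (cC j') => /c_inj.
Qed.

Lemma hs_sandwich m (A B : 'M[C]_n) a b : 0 <= b ->
  opb A^T a -> opb B b -> hs (A *m patt m *m B) <= b * (a * (mult m)%:R).
Proof.
move=> b0 Aa Bb; rewrite (le_trans (hs_mulr _ Bb))//.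
by rewrite ler_wpM2l// -hs_patt hs_mull.
Qed.

(** On the diagonal [j = k], the condition [c i j = c j l] says exactly [i = l]. *)
Lemma eta1 : (0 < n)%N -> eta 1%:M = 1%:M.
Proof.
move=> n0; apply/matrixP => i l; rewrite !mxE.
have -> : \sum_j \sum_k (c i j == c k l)%:R * (1%:M : 'M[C]_n) j k =
    n%:R * (i == l)%:R.
  transitivity (\sum_(j < n) ((i == l)%:R : C)).
    apply: eq_bigr => j _; rewrite (bigD1 j)//= big1 => [|k kj].
      rewrite mxE eqxx mulr1 addr0 cC; case: (eqVneq i l) => [->|/eqP il].
        by rewrite eqxx.
      by case: eqP => // /c_inj.
    by rewrite [_%:M _ _]mxE (eq_sym j) (negbTE kj) mulr0.
  by rewrite sumr_const card_ord mulr_natl.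
by rewrite mulrA mulVf ?mul1r// pnatr_eq0 -lt0n.
Qed.

Lemma sum_indic_seq k : k \in s -> (\sum_(m <- s) (k == m) = 1)%N.
Proof.
move=> ks; rewrite (bigD1_seq k)//= eqxx big1 ?addn0// => m.
by rewrite eq_sym => /negbTE ->.
Qed.

Lemma sum_mult : (\sum_(m <- s) mult m = n ^ 2)%N.
Proof.
rewrite exchange_big /=.
under eq_bigr do (rewrite exchange_big /=; under eq_bigr do rewrite sum_indic_seq//).
by rewrite !sum_nat_const card_ord muln1.
Qed.

(** Double counting: the solutions of [c i j = c k l] are grouped by their common value [m]. *)
Lemma sum_mult_sqr : (\sum_(m <- s) mult m ^ 2 = energy)%N.
Proof.
transitivity (\sum_(m <- s) \sum_(i < n) \sum_(j < n) \sum_(k < n) \sum_(l < n)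
    (c i j == m) * (c k l == m))%N.
  apply: eq_bigr => m _; rewrite -mulnn big_distrl; apply: eq_bigr => i _ /=.
  rewrite big_distrl; apply: eq_bigr => j _ /=.
  rewrite big_distrr; apply: eq_bigr => k _ /=.
  by rewrite big_distrr.
rewrite exchange_big; apply: eq_bigr => i _ /=.
rewrite [RHS]exchange_big [LHS]exchange_big; apply: eq_bigr => j _ /=.
rewrite [RHS]exchange_big [LHS]exchange_big; apply: eq_bigr => k _ /=.
rewrite exchange_big; apply: eq_bigr => l _ /=.
rewrite -[RHS]mul1n -(sum_indic_seq (cs i j)) big_distrl /=.
by apply: eq_bigr => m _; case: (eqVneq (c i j) m) => [->|]; rewrite ?mul0n// eq_sym.
Qed.

End pattern.

(** An exact second order expansion at [v = 0], by iterating the resolvent identity. For [v] random,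
    centered and of variance [s2], the terms of order 1 and [h] have mean zero, and only the
    [h ^+ 2] term survives. *)
Lemma resolvent_expansion (F : comNzRingType) n (G0 Gv A : 'M[F]_n) (h s2 v : F)
    (Z := G0 *m A *m (G0 *m A *m Gv)) (Y := G0 *m A *m Gv *m A *m Gv) :
  Gv = G0 - (h * v) *: (G0 *m A *m Gv) ->
  v *: Gv + (h * s2) *: (Gv *m A *m Gv) =
  v *: G0 + (h * (s2 - v ^+ 2)) *: (G0 *m A *m G0)
    + h ^+ 2 *: (v ^+ 3 *: Z - (v * s2) *: (Z + Y)).
Proof.
move=> E1; pose Q := G0 *m A *m Gv; pose X := G0 *m A *m G0.
have E2 : Q = X - (h * v) *: Z.
  by rewrite /Q {1}E1 mulmxBr -scalemxAr.
have E3 : Gv *m A *m Gv = Q - (h * v) *: Y.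
  by rewrite {1}E1 mulmxBl mulmxBl -scalemxAl -scalemxAl.
rewrite E3 E2 {1}E1 -/Q E2 -/X.
move: (X) (Z) (Y) => {E1 E2 E3} xx zz yy; apply/matrixP => i j.
by rewrite !mxE; move: (G0 i j) (xx i j) (zz i j) (yy i j) => g x z t; ring.
Qed.

(** The stability estimate in numbers, with [d] the squared norm of the deviation: after the factors
    2 from successive triangle inequalities, the two terms linear in the deviation contribute at
    most 16/9 [d], against 9 [d] on the left. *)
Lemma dyson_arith (R : realFieldType) (d y2d s12 s34 s1234 t P1 P2 P3 P4 P5 k v e : R) :
  t = y2d -> 9 * d <= y2d -> t <= 2 * s1234 + 2 * P5 ->
  s1234 <= 2 * s12 + 2 * s34 -> s12 <= 2 * P1 + 2 * P2 ->
  s34 <= 2 * P3 + 2 * P4 -> P1 <= k -> P2 <= v -> P3 <= 9^-1 * d ->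
  P4 <= 9^-1 * d -> P5 <= e -> 0 <= k -> 0 <= v -> 0 <= e ->
  d <= 2 * k + 2 * v + e.
Proof. lra. Qed.

Section dyson.
Context (R : rcfType) (V : finType) (p val : V -> R).
Hypotheses (p_ge0 : forall a, 0 <= p a) (p_sum1 : \sum_a p a = 1).
Context (n : nat) (c : 'I_n -> 'I_n -> nat) (s : seq nat).
Hypotheses (n_gt0 : (0 < n)%N) (cC : forall i j, c i j = c j i)
  (c_inj : forall i j k, c i j = c i k -> j = k)
  (cs : forall i j, c i j \in s) (us : uniq s).
Context (K y : R).
Hypotheses (valK : forall a, `|val a| <= K) (y_ge3 : 3 <= y).
Local Notation C := R[i].
Local Notation N := (n%:R : R).
Local Notation Ex := (Ex p val).
Local Notation ExM := (ExM p val).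
Local Notation patt := (patt R c).
Local Notation mult := (mult c).
Local Notation eta := (@eta R n c).

Definition linkmx (x : nat -> R) : 'M[R]_n :=
  (Num.sqrt N)^-1 *: \matrix_(i, j) x (c i j).

Definition resl x := res y (linkmx x).

Let h := (Num.sqrt N)^-1.
Let h_sqr : h ^+ 2 = N^-1. Proof. by rewrite exprVn sqr_sqrtr. Qed.
Let N0 : 0 < N. Proof. by rewrite ltr0n. Qed.
Let y0 : 0 < y. Proof. by apply: lt_le_trans y_ge3. Qed.
Let w_ge0 : 0 <= y ^- 2. Proof. by rewrite invr_ge0 exprn_ge0// ltW. Qed.
Let w_le : y ^- 2 <= 9^-1.
Proof.
rewrite lef_pV2 ?posrE ?exprn_gt0// [9](_ : _ = 3 ^+ 2); last by ring.
by rewrite ler_sqr ?nnegrE// ltW.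
Qed.

Lemma linkmx_tr x : (linkmx x)^T = linkmx x.
Proof. by apply/matrixP => i j; rewrite !mxE cC. Qed.

Lemma opb_resl x : opb (resl x) (y ^- 2).
Proof. by apply: opb_res => //; exact: linkmx_tr. Qed.

Lemma opb1_resl x : opb (resl x) 1.
Proof. by apply: opb_le (opb_resl x); apply: le_trans w_le _; lra. Qed.

Lemma opb1M (A B : 'M[C]_n) : opb A 1 -> opb B 1 -> opb (A *m B) 1.
Proof. by move=> A1 B1; rewrite -[1]mul1r; apply: opbM. Qed.

Lemma resl_tr x : (resl x)^T = resl x.
Proof. by apply: res_tr; exact: linkmx_tr. Qed.

Lemma resl_upd x m u v :
  resl (upd x m u) - resl (upd x m v) =
  (h * (v - u))%:C *: (resl (upd x m v) *m patt m *m resl (upd x m u)).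
Proof.
rewrite res_sub ?linkmx_tr//.
have -> : map_mx (real_complex R) (linkmx (upd x m v) - linkmx (upd x m u)) =
    (h * (v - u))%:C *: patt m.
  apply/matrixP => i j; rewrite !mxE /upd; case: (eqVneq (c i j) m) => _.
    by rewrite mulr1 -mulrBr.
  by rewrite subrr mulr0.
by rewrite -scalemxAr -scalemxAl.
Qed.

Let sqr_diff a b : (val b - val a) ^+ 2 <= 4 * K ^+ 2.
Proof.
have /andP[? ?] : - K <= val a <= K by rewrite -ler_norml.
have /andP[? ?] : - K <= val b <= K by rewrite -ler_norml.
nra.
Qed.

(** Influence of one variable on the trace: by cyclicity, the change is [h] times a sum of [mult m]
    bounded entries, divided by [N]. Summed over [m], these bounds are of order [energy / N ^ 3]. *)
Lemma nsq_ntr_resl_upd x m a b :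
  nsq (ntr (resl (upd x m (val a))) - ntr (resl (upd x m (val b)))) <=
  4 * K ^+ 2 * (N ^- 3 * (mult m)%:R ^+ 2).
Proof.
rewrite -ntrB resl_upd /ntr linearZ /= mulrA nsqM -rmorphM nsqR.
rewrite -mulmxA mxtrace_mulC -mulmxA.
have P : opb (resl (upd x m (val a)) *m resl (upd x m (val b))) (y ^- 2 * y ^- 2).
  by apply: opbM => //; exact: opb_resl.
have tle := nsq_tr_patt c m P.
have t0 : (mult m)%:R ^+ 2 * (y ^- 2 * y ^- 2) <= (mult m)%:R ^+ 2.
  by rewrite ler_piMr ?sqr_ge0//; have := w_ge0; have := w_le; nra.
rewrite [in leLHS]exprMn [in X in X <= _](exprMn _ h) h_sqr.
rewrite [leRHS](_ : _ = (N^-1 ^+ 2 * (N^-1 * (4 * K ^+ 2))) * (mult m)%:R ^+ 2); last first.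
  by rewrite -exprVn; ring.
apply: ler_pM; last exact: le_trans tle t0.
- by rewrite mulr_ge0 ?sqr_ge0// mulr_ge0 ?sqr_ge0// invr_ge0 ltW.
- exact: nsq_ge0.
- by rewrite ler_wpM2l ?sqr_ge0// ler_wpM2l ?invr_ge0 ?(ltW N0)// sqr_diff.
Qed.

Lemma hs_eta_resl_upd tau x m a b : 0 < tau ->
  hs (eta (resl (upd x m (val a))) - eta (resl (upd x m (val b)))) <=
  4 * K ^+ 2 * N ^- 3 * ((energy c)%:R / tau * (mult m)%:R ^+ 2 +
                         tau * (N * (mult m)%:R)).
Proof.
move=> tau0; rewrite -linearB resl_upd linearZ /= hsZ nsqR exprMn h_sqr.
set A := resl _; set B := resl _.
have H := @hs_eta_tau R n c cC c_inj (A *m patt m *m B)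
  ((mult m)%:R ^+ 2 * (y ^- 2 * y ^- 2)) tau tau0 _ _.
have M2 : 0 <= (mult m)%:R ^+ 2 :> R by rewrite sqr_ge0.
have M1 : 0 <= (mult m)%:R :> R by [].
have {}H : hs (eta (A *m patt m *m B)) <=
    N^-1 ^+ 2 * ((energy c)%:R / tau * (mult m)%:R ^+ 2 + tau * (N * (mult m)%:R)).
  apply: le_trans (H _ _) _.
  - by rewrite mulr_ge0// mulr_ge0.
  - by move=> i l; apply: nsq_cross_sandwich => //; exact: opb_resl.
  rewrite ler_wpM2l ?sqr_ge0// lerD//.
    rewrite ler_wpM2l ?divr_ge0 ?(ltW tau0)// ler_piMr//.
    by have := w_ge0; have := w_le; nra.
  rewrite ler_wpM2l ?(ltW tau0)// ler_wpM2l// ?(ltW N0)//.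
  have At : opb A^T (y ^- 2) by rewrite resl_tr; exact: opb_resl.
  have Bo : opb B (y ^- 2) by exact: opb_resl.
  apply: le_trans (hs_sandwich c m w_ge0 At Bo) _.
  by rewrite mulrA ler_piMl//; have := w_ge0; have := w_le; nra.
rewrite [leRHS](_ : _ = (N^-1 * (4 * K ^+ 2)) * (N^-1 ^+ 2 * ((energy c)%:R / tau * (mult m)%:R ^+ 2 +
                         tau * (N * (mult m)%:R)))); last by rewrite -exprVn; ring.
apply: ler_pM => //; last by rewrite ler_wpM2l ?sqr_diff// invr_ge0 ltW.
- by rewrite mulr_ge0 ?sqr_ge0// invr_ge0 ltW.
- exact: hs_ge0.
Qed.

(** Efron-Stein with [hs_eta_resl_upd]: the squares of the multiplicities add up to the energy, the
    multiplicities to [N ^ 2]. Any [tau] between [energy ^ 2 / N ^ 4] and [N], far from both, makes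
    this o(N). *)
Lemma Ex_eta_variance tau x0 : 0 < tau ->
  Ex s (fun x => hs (eta (resl x) - eta (ExM s resl x0))) x0 <=
  4 * K ^+ 2 * ((energy c)%:R ^+ 2 / (tau * N ^+ 3) + tau).
Proof.
move=> tau0; rewrite -(ExM_linear p val s eta).
apply: le_trans (ExM_variance p_ge0 p_sum1 x0 us
  (fun k x a b _ => hs_eta_resl_upd x k a b tau0)) _.
rewrite -mulr_sumr big_split /= -!mulr_sumr.
under eq_bigr do rewrite -natrX; rewrite -!natr_sum.
rewrite (sum_mult_sqr cs us) (sum_mult cs us) natrX; apply: le_of_eq.
by field; rewrite ?(gt_eqF tau0) ?(gt_eqF N0).
Qed.

Variable s2 : R.
Hypotheses (val_mean : \sum_a p a * val a = 0) (val_var : \sum_a p a * val a ^+ 2 = s2).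

(** The defect in Stein's formula for the variable [x m]: the derivative of the resolvent in [x m]
    is [- h] times [resl x *m patt m *m resl x], so the mean would vanish for a Gaussian
    variable. *)
Definition wdef m x : 'M[C]_n :=
  (x m)%:C *: resl x + (h * s2)%:C *: (resl x *m patt m *m resl x).

Lemma wdef_upd m x v (G0 := resl (upd x m 0)) (Gv := resl (upd x m v))
    (Z := G0 *m patt m *m (G0 *m patt m *m Gv))
    (Y := G0 *m patt m *m Gv *m patt m *m Gv) :
  wdef m (upd x m v) = v%:C *: G0
    + (h * (s2 - v ^+ 2))%:C *: (G0 *m patt m *m G0)
    + (h ^+ 2)%:C *: ((v ^+ 3)%:C *: Z - (s2 * v)%:C *: (Z + Y)).
Proof.
rewrite /wdef updE.
rewrite [s2 * v]mulrC !rmorphM rmorphB !rmorphXn; apply: resolvent_expansion.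
rewrite -rmorphM.
rewrite -[LHS](subrK G0) addrC; congr (_ + _).
by rewrite [LHS]resl_upd sub0r mulrN rmorphN scaleNr.
Qed.

Lemma wmean_expansion (f : V -> R) (X Y : 'M[C]_n) (T : V -> 'M[C]_n) :
  \sum_a p a * f a = 0 -> \sum_a p a * f a ^+ 2 = s2 ->
  \sum_a (p a)%:C *: ((f a)%:C *: X + (h * (s2 - f a ^+ 2))%:C *: Y + T a) =
  \sum_a (p a)%:C *: T a.
Proof.
move=> f0 f2.
have sumE (g : V -> R) (Z : 'M[C]_n) :
    \sum_a (p a)%:C *: ((g a)%:C *: Z) = (\sum_a p a * g a)%:C *: Z.
  by rewrite rmorph_sum scaler_suml; apply: eq_bigr => a _; rewrite scalerA -rmorphM.
under eq_bigr do rewrite !scalerDr.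
rewrite 2!big_split /= 2!sumE f0 scale0r add0r.
rewrite (_ : \sum_a _ * (h * _) = 0) ?scale0r ?add0r//.
under eq_bigr do rewrite mulrCA mulrBr.
by rewrite -mulr_sumr sumrB -mulr_suml p_sum1 mul1r f2 subrr mulr0.
Qed.

(** Squared norm of [v ^ 3 Z - s2 v (Z + Y)] for [|v| <= K] and words [Z], [Y] of norm at most 1: 2
    K^6 from the first term and 2 * 4 s2^2 K^2 from the second. *)
Let kappa := 2 * K ^+ 6 + 8 * (s2 ^+ 2 * K ^+ 2).

Lemma opb_avg_wdef m x : opb (avgM p val m (wdef m) x) (N ^- 2 * kappa).
Proof.
set G0 := resl (upd x m 0).
pose Gv a := resl (upd x m (val a)).
pose Z a := G0 *m patt m *m (G0 *m patt m *m Gv a).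
pose Y a := G0 *m patt m *m Gv a *m patt m *m Gv a.
have -> : avgM p val m (wdef m) x = \sum_a (p a)%:C *:
    ((h ^+ 2)%:C *: ((val a ^+ 3)%:C *: Z a - (s2 * val a)%:C *: (Z a + Y a))).
  rewrite -[RHS](wmean_expansion G0 (G0 *m patt m *m G0) _ val_mean val_var).
  by apply: eq_bigr => a _; rewrite wdef_upd.
apply: opb_wmean => // a.
rewrite (_ : N ^- 2 = nsq (h ^+ 2)%:C); last by rewrite nsqR h_sqr exprVn.
apply: opbZ.
have oG u : opb (resl u) 1 by exact: opb1_resl.
have oA : opb (patt m) 1 by exact: opb_patt.
have oGA u : opb (resl u *m patt m) 1 := opb1M (oG u) oA.
have oZ : opb (Z a) 1 := opb1M (oGA _) (opb1M (oGA _) (oG _)).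
have oY : opb (Y a) 1 := opb1M (opb1M (opb1M (oGA _) (oG _)) oA) (oG _).
have v2 : val a ^+ 2 <= K ^+ 2.
  by rewrite -real_normK ?num_real// ler_sqr ?nnegrE ?valK ?(le_trans _ (valK a)).
apply: opb_le (opbD (opbZ _ oZ) (opbN (opbZ _ (opbD oZ oY)))).
rewrite !nsqR mulr1 -exprM exprMn /kappa lerD//.
  rewrite ler_pM2l// (exprM _ 2 3) (exprM K 2 3) ler_pXn2r ?nnegrE ?sqr_ge0//.
by have := ler_wpM2l (sqr_ge0 s2) v2; lra.
Qed.

Definition selfE x0 : 'M[C]_n :=
  \sum_i \sum_j (h%:C *: delta_mx i j) *m ExM s (wdef (c i j)) x0.

Lemma sum_delta (B : 'I_n -> 'I_n -> 'M[C]_n) i l :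
  (\sum_i \sum_j (h%:C *: delta_mx i j) *m B i j) i l = \sum_j h%:C * B i j j l.
Proof.
rewrite summxE (bigD1 i)//= [X in _ + X]big1 ?addr0 => [|k ki].
  rewrite summxE; apply: eq_bigr => j _; rewrite -scalemxAl mxE; congr (_ * _).
  rewrite mxE (bigD1 j)//= big1 ?addr0 => [|k kj]; first by rewrite mxE !eqxx mul1r.
  by rewrite mxE (negbTE kj) andbF mul0r.
rewrite summxE big1// => j _; rewrite -scalemxAl mxE mxE big1 ?mulr0// => k' _.
by rewrite mxE (eq_sym i) (negbTE ki) mul0r.
Qed.

(** Row [i] of [selfE] is [h] times a sum of [n] rows; Cauchy-Schwarz cancels [h ^+ 2], and the
    [n ^ 2] rows involved each have squared norm at most [kappa / N ^ 2]. The bound stays constant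
    while [hs 1%:M] equals [n]. *)
Lemma hs_selfE x0 : hs (selfE x0) <= kappa.
Proof.
have B i j : opb (ExM s (wdef (c i j)) x0) (N ^- 2 * kappa).
  rewrite -(ExM_avg val p_sum1 (wdef (c i j)) x0 (cs i j)); apply: opb_ExM => // x.
  exact: opb_avg_wdef.
have H i l : nsq (selfE x0 i l) <= \sum_j nsq (ExM s (wdef (c i j)) x0 j l).
  rewrite sum_delta; apply: le_trans (nsq_sum _ _) _.
  rewrite cardT size_enum_ord mulr_sumr; apply: ler_sum => j _.
  by rewrite nsqM nsqR h_sqr mulrA mulfV ?mul1r// gt_eqF.
apply: (@le_trans _ _ (\sum_i \sum_j hs (row j (ExM s (wdef (c i j)) x0)))).
  apply: ler_sum => i _; apply: le_trans (ler_sum _ (fun l _ => H i l)) _.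
  rewrite exchange_big; apply: ler_sum => j _ /=; rewrite /hs big_ord1.
  by apply: ler_sum => l _; rewrite mxE.
apply: (@le_trans _ _ (\sum_(i < n) \sum_(j < n) N ^- 2 * kappa)).
  by do 2 (apply: ler_sum => ? _); exact: opb_row.
rewrite !sumr_const !card_ord -mulrnA -[_ *+ (n * n)]mulr_natr natrM; apply: le_of_eq.
by field; rewrite gt_eqF.
Qed.

(** The first halves of the [wdef (c i j)] rebuild the product of the link matrix with the
    resolvent, which is [1 + i y G]. In the second halves, the sum over [j] of the entries (j, k) of
    [G *m patt (c i j)] is [n] times the entry (i, k) of [eta G]. *)
Lemma dyson_pointwise x :
  1%:M + ((0 +i* y)%C) *: resl x + (s2%:C) *: (eta (resl x) *m resl x) =
  \sum_i \sum_j (h%:C *: delta_mx i j) *m wdef (c i j) x.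
Proof.
rewrite res_eq ?linkmx_tr//; apply/matrixP => i l; rewrite sum_delta.
rewrite [LHS]mxE [X in _ + X]mxE.
have -> : \sum_j h%:C * wdef (c i j) x j l = \sum_j (h * x (c i j))%:C * resl x j l
    + \sum_j h%:C * (h * s2)%:C * (resl x *m patt (c i j) *m resl x) j l.
  rewrite -big_split; apply: eq_bigr => j _ /=.
  by rewrite /wdef mxE [X in X + _]mxE [X in _ + X]mxE rmorphM; ring.
congr (_ + _); first by rewrite mxE; apply: eq_bigr => j _; rewrite !mxE.
rewrite mxE mulr_sumr.
under [RHS]eq_bigr do rewrite mxE mulr_sumr.
rewrite exchange_big; apply: eq_bigr => k _ /=.
rewrite [X in _ = X](_ : _ = s2%:C * ((h ^+ 2)%:C *
    \sum_j (resl x *m patt (c i j)) j k * resl x k l)); last first.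
  by rewrite !mulr_sumr; apply: eq_bigr => j _; rewrite !rmorphM/=; ring.
congr (_ * _); rewrite mxE -mulr_suml mulrA; congr (_ * _).
rewrite h_sqr fmorphV rmorph_nat; congr (_ * _).
apply: eq_bigr => j _; rewrite mxE; apply: eq_bigr => k' _.
by rewrite mxE mulrC (eq_sym (c i j)).
Qed.

(** Two errors remain: [selfE], from the non-Gaussian cumulants, and the covariance between [eta] of
    the resolvent and the resolvent itself. *)
Lemma dyson_eq x0 (M := ExM s resl x0) :
  1%:M + ((0 +i* y)%C) *: M + s2%:C *: (eta M *m M) =
  selfE x0 - s2%:C *: ExM s (fun x => (eta (resl x) - eta M) *m resl x) x0.
Proof.
pose L1 := [the {linear 'M[C]_n -> 'M[C]_n} of GRing.scale (0 +i* y)%C].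
pose L2 := [the {linear 'M[C]_n -> 'M[C]_n} of GRing.scale (s2%:C)].
have E1 : ExM s (fun x => (eta (resl x) - eta M) *m resl x) x0 =
    ExM s (fun x => eta (resl x) *m resl x) x0 - eta M *m M.
  rewrite /M -(ExM_linear p val s (mulmx (eta M))).
  rewrite -[X in _ = _ + X]scaleN1r.
  rewrite -(ExM_linear p val s [the {linear 'M[C]_n -> 'M[C]_n} of GRing.scale (-1 : C)]) -ExMD.
  by apply: ExM_ext => x; rewrite mulmxBl /= scaleN1r.
rewrite E1 scalerBr opprB addrCA addrC; congr (_ + _).
apply/eqP; rewrite eq_sym subr_eq; apply/eqP.
rewrite /M -(ExM_linear p val s L1) -(ExM_linear p val s L2).
rewrite -[X in _ = X + _ + _](ExM_cst val p_sum1 s _ x0) -!ExMD.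
transitivity (ExM s (fun x => \sum_i \sum_j (h%:C *: delta_mx i j) *m wdef (c i j) x) x0).
  rewrite ExM_sum; apply: eq_bigr => i _; rewrite ExM_sum; apply: eq_bigr => j _.
  by rewrite -(ExM_linear p val s (mulmx (h%:C *: delta_mx i j))).
by apply: ExM_ext => x; rewrite -dyson_pointwise.
Qed.

(** The scalar equation 1 + i y g + g^2 = 0 with g = i b is subtracted; contractivity of [eta] and
    smallness of [M] and [g] bound the linear terms. The last term is the price of comparing a
    variable of variance [s2] with the solution for variance 1. *)
Lemma dyson_hs x0 b tau (M := ExM s resl x0) : 0 < tau -> 0 <= b ->
  b ^+ 2 + y * b = 1 ->
  hs (M - ((0 +i* b)%C)%:M) <= 2 * kappa
    + 2 * (s2 ^+ 2 * (4 * K ^+ 2 * ((energy c)%:R ^+ 2 / (tau * N ^+ 3) + tau)))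
    + (s2 - 1) ^+ 2 * N.
Proof.
move=> tau0 b0 bE; set g := (0 +i* b)%C; set Dm := M - g%:M.
have oM1 : opb M 1 by apply: opb_ExM => // x; exact: opb1_resl.
have oM : opb M 9^-1.
  by apply: opb_ExM => // x; apply: opb_le (opb_resl x); exact: w_le.
have gE : 1 + (0 +i* y)%C * g + g * g = 0.
  by rewrite /g; apply/eqP; rewrite eq_complex /=; apply/andP; split; apply/eqP; nra.
have etaD : eta M = eta Dm + g%:M.
  by rewrite /Dm linearB /= -scalemx1 linearZ /= eta1 // scalemx1 subrK.
set Err := ExM s (fun x => (eta (resl x) - eta M) *m resl x) x0.
have hErr : hs Err <= 4 * K ^+ 2 * ((energy c)%:R ^+ 2 / (tau * N ^+ 3) + tau).
  apply: le_trans (hs_ExM val p_ge0 p_sum1 s _ x0) _.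
  apply: le_trans (Ex_eta_variance x0 tau0); apply: Ex_le => // x.
  by apply: le_trans (hs_mulr _ (opb1_resl x)) _; rewrite mul1r.
have key : (0 +i* y)%C *: Dm = selfE x0 + (- s2%:C) *: Err
    + ((-1) *: (eta Dm *m M) + (- g) *: Dm) + (1 - s2%:C) *: (eta M *m M).
  have := dyson_eq x0; rewrite -/M -/Err => E.
  have -> : selfE x0 = 1%:M + (0 +i* y)%C *: M + s2%:C *: (eta M *m M) + s2%:C *: Err.
    by rewrite E subrK.
  (* Linearization around the scalar solution: the difference of [eta M *m M] and g^2 is
     [eta Dm *m M + g *: Dm], with no quadratic remainder. *)
  have E2 : eta M *m M = eta Dm *m M + g *: Dm + (g * g)%:M.
    rewrite {1}etaD mulmxDl mul_scalar_mx -addrA; congr (_ + _).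
    by rewrite /Dm scalerBr scale_scalar_mx subrK.
  have E3 : (g * g)%:M = (- (1 + (0 +i* y)%C * g))%:M :> 'M[C]_n.
    by congr (_%:M); apply/eqP; rewrite -subr_eq0 opprK addrC gE.
  have E4 : (0 +i* y)%C *: M = (0 +i* y)%C *: Dm + ((0 +i* y)%C * g)%:M.
    by rewrite /Dm scalerBr scale_scalar_mx subrK.
  rewrite E4 scalerBl scale1r {2}E2 E3.
  move: (eta Dm *m M) (eta M *m M) (Err) (Dm) => A B F D'.
  apply/matrixP => i j; rewrite !mxE.
  by case: (i == j); rewrite ?mulr1n ?mulr0n; ring.
have := hsZ (0 +i* y)%C Dm; rewrite key.
have -> : nsq (0 +i* y)%C = y ^+ 2 by rewrite /nsq /= expr0n add0r.
move=> yD.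
(* From [y * b <= 1] and [y >= 3]. *)
have b3 : b <= 3^-1.
  by have := ler_wpM2r b0 y_ge3; have := sqr_ge0 b; lra.
have b2 : b ^+ 2 <= 9^-1 by nra.
have P1 := hs_selfE x0.
have P2 : hs ((- s2%:C) *: Err) <= s2 ^+ 2 * (4 * K ^+ 2 * ((energy c)%:R ^+ 2 / (tau * N ^+ 3) + tau)).
  by rewrite hsZ nsqN nsqR ler_wpM2l// sqr_ge0.
have P3 : hs ((-1) *: (eta Dm *m M)) <= 9^-1 * hs Dm.
  rewrite scaleN1r hsN; apply: le_trans (hs_mulr _ oM) _.
  by rewrite ler_wpM2l ?invr_ge0// hs_eta.
have P4 : hs ((- g) *: Dm) <= 9^-1 * hs Dm.
  by rewrite hsZ nsqN ler_wpM2r ?hs_ge0// /nsq /g /= expr0n add0r.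
have P5 : hs ((1 - s2%:C) *: (eta M *m M)) <= (s2 - 1) ^+ 2 * N.
  rewrite hsZ -(rmorph1 (real_complex R)) -rmorphB nsqR.
  rewrite -[leLHS]/(_ ^+ 2 * _) -(sqrrN (1 - s2)) opprB ler_wpM2l ?sqr_ge0//.
  apply: le_trans (hs_mulr _ oM1) _; rewrite mul1r.
  apply: le_trans (hs_eta cC c_inj M) _.
  by apply: le_trans (opb_hs oM1) _; rewrite mul1r.
have Q1 := hsD (selfE x0) ((- s2%:C) *: Err).
have Q2 := hsD ((-1) *: (eta Dm *m M)) ((- g) *: Dm).
have Q3 := hsD (selfE x0 + (- s2%:C) *: Err) ((-1) *: (eta Dm *m M) + (- g) *: Dm).
have Q4 := hsD (selfE x0 + (- s2%:C) *: Err + ((-1) *: (eta Dm *m M) + (- g) *: Dm))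
  ((1 - s2%:C) *: (eta M *m M)).
have y2 : 9 * hs Dm <= y ^+ 2 * hs Dm.
  rewrite ler_wpM2r ?hs_ge0// (_ : 9 = 3 ^+ 2); last by ring.
  by rewrite ler_sqr ?nnegrE// ltW.
have K0 : 0 <= kappa.
  apply: le_trans P1; exact: hs_ge0.
have V0 : 0 <= s2 ^+ 2 * (4 * K ^+ 2 * ((energy c)%:R ^+ 2 / (tau * N ^+ 3) + tau)).
  apply: le_trans P2; exact: hs_ge0.
have S0 : 0 <= (s2 - 1) ^+ 2 * N by apply: le_trans P5; exact: hs_ge0.
exact: (dyson_arith yD y2 Q4 Q3 Q1 Q2 P1 P2 P3 P4 P5 K0 V0 S0).
Qed.

Lemma dyson_trace x0 b tau : 0 < tau -> 0 <= b -> b ^+ 2 + y * b = 1 ->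
  nsq (ntr (ExM s resl x0) - (0 +i* b)%C) <=
  (4 * K ^+ 6 + 16 * s2 ^+ 2 * K ^+ 2) / N
    + 8 * s2 ^+ 2 * K ^+ 2 * ((energy c)%:R ^+ 2 / (tau * N ^+ 4) + tau / N)
    + (s2 - 1) ^+ 2.
Proof.
move=> tau0 b0 bE; rewrite -[(0 +i* b)%C](ntr_scalar n_gt0) -ntrB.
apply: le_trans (nsq_ntr n_gt0 _) _; rewrite mulrC ler_pdivrMr//.
apply: le_trans (dyson_hs x0 tau0 b0 bE) _; rewrite /kappa.
apply: le_of_eq.
by field; rewrite ?(gt_eqF tau0) ?(gt_eqF N0).
Qed.

(** [f] stands for the real or the imaginary part. The squared influences sum to order
    [energy / N ^ 3], that is N^(-1 + a): the variance bound is not summable in [N], its square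
    is. *)
Lemma resl_fourth_moment (f : C -> R) x0 :
  {morph f : z w / z - w} -> (forall z, (f z) ^+ 2 <= nsq z) ->
  Ex s (fun x => (f (ntr (resl x)) - Ex s (fun x => f (ntr (resl x))) x0) ^+ 4) x0
  <= 11 * (4 * K ^+ 2 * (energy c)%:R / N ^+ 3) ^+ 2.
Proof.
move=> fB fle; pose d k := Num.sqrt (4 * K ^+ 2 * (N ^- 3 * (mult k)%:R ^+ 2)).
have d2 k : d k ^+ 2 = 4 * K ^+ 2 * (N ^- 3 * (mult k)%:R ^+ 2).
  rewrite sqr_sqrtr//; apply: mulr_ge0; first by rewrite mulr_ge0 ?sqr_ge0.
  by rewrite mulr_ge0 ?sqr_ge0// invr_ge0 exprn_ge0.
have -> : 4 * K ^+ 2 * (energy c)%:R / N ^+ 3 = \sum_(k <- s) d k ^+ 2.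
  under eq_bigr do rewrite d2 -[(mult _)%:R ^+ 2]natrX.
  by rewrite -!mulr_sumr -natr_sum (sum_mult_sqr cs us); ring.
apply: Ex_fourth_moment => // [k|k x a b _]; first exact: sqrtr_ge0.
rewrite -sqrtr_sqr ler_wsqrtr// -fB.
exact: le_trans (fle _) (nsq_ntr_resl_upd _ _ _ _).
Qed.

End dyson.

(** * Multiplicative energy *)

Definition hlink n (i j : 'I_n) : nat := (i.+1 * j.+1)%N.

Lemma hlinkC n (i j : 'I_n) : hlink i j = hlink j i.
Proof. exact: mulnC. Qed.

Lemma hlink_inj n (i j k : 'I_n) : hlink i j = hlink i k -> j = k.
Proof. by move=> /eqP; rewrite eqn_pmul2l// eqSS => /eqP/val_inj. Qed.

Lemma hlink_iota n (i j : 'I_n) : hlink i j \in iota 1 (n ^ 2).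
Proof. by rewrite mem_iota add1n ltnS -mulnn /hlink leq_mul. Qed.

Section energy_bound.
Local Open Scope nat_scope.

(** With g the gcd of [i] and [k], the cofactors a and b are coprime and a j = b l, hence b divides
    [j]. *)
Lemma solution_param (i j k l : nat) : 0 < i -> 0 < j -> 0 < k -> 0 < l ->
  i * j = k * l -> exists a b g t,
  [/\ 0 < a, 0 < b, 0 < g & 0 < t] /\ [/\ i = g * a, j = t * b, k = g * b & l = t * a].
Proof.
move=> i0 j0 k0 l0 E.
have g0 : 0 < gcdn i k by rewrite gcdn_gt0 i0.
have [a ia] := dvdnP (dvdn_gcdl i k); have [b kb] := dvdnP (dvdn_gcdr i k).
set g := gcdn i k in ia kb g0.
have cab : coprime a b.
  rewrite /coprime -(eqn_pmul2r g0) mul1n muln_gcdl.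
  by rewrite -ia -kb eqxx.
have ajbl : a * j = b * l.
  by apply/eqP; rewrite -(eqn_pmul2l g0) !mulnA ![g * _]mulnC -ia -kb E.
have /dvdnP[t jt] : b %| j by rewrite -(@Gauss_dvdr _ a) 1?coprime_sym// ajbl dvdn_mulr.
have b0 : 0 < b by move: k0; rewrite kb muln_gt0 => /andP[].
exists a, b, g, t; split; split=> //.
- by move: i0; rewrite ia muln_gt0 => /andP[].
- by move: j0; rewrite jt muln_gt0 => /andP[].
- by rewrite mulnC.
- by rewrite mulnC.
- by apply/eqP; rewrite -(eqn_pmul2l b0) -ajbl jt mulnCA mulnA mulnC mulnA.
Qed.

Lemma sum_prod (I J : finType) (F : I * J -> nat) :
  \sum_p F p = \sum_i \sum_j F (i, j).
Proof. by rewrite pair_bigA; apply: eq_bigr => -[]. Qed.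

Lemma count_multiples n m : 0 < m -> \sum_(g < n) (g.+1 * m <= n) = n %/ m.
Proof.
move=> m0; rewrite -[RHS]card_ord -sum1_card.
have le : n %/ m <= n by exact: leq_div.
rewrite (big_ord_widen n (fun=> 1) le) [RHS]big_mkcond; apply: eq_bigr => g _.
by rewrite -leq_divRL//; case: ifP.
Qed.

(** The parametrization covers all solutions, so counting parameters suffices. For given a and b,
    each of g and t has at most n / max(a, b) choices; grouping by the maximum gives twice the sum
    over a of a (n / a)^2. *)
Lemma energy_le n : energy (@hlink n) <= 2 * n * \sum_(a < n) n %/ a.+1.
Proof.
case: n => [|n]; first by rewrite /energy !big_ord0.
set m := n.+1.
pose B := [set t : 'I_m * 'I_m * ('I_m * 'I_m) | [&& t.2.1.+1 * t.1.1.+1 <= m,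
  t.2.2.+1 * t.1.1.+1 <= m, t.2.1.+1 * t.1.2.+1 <= m & t.2.2.+1 * t.1.2.+1 <= m]].
pose S := [set t : 'I_m * 'I_m * ('I_m * 'I_m) |
  hlink t.1.1 t.2.1 == hlink t.2.2 t.1.2].
(* Ordinals start at 0 and stand for their successors, hence the shifts; [S] stores a solution as
   ((i, l), (j, k)). *)
pose f (t : 'I_m * 'I_m * ('I_m * 'I_m)) : 'I_m * 'I_m * ('I_m * 'I_m) :=
  let: ((a, b), (g, t)) := t in
  ((inord (g.+1 * a.+1).-1, inord (t.+1 * a.+1).-1),
   (inord (t.+1 * b.+1).-1, inord (g.+1 * b.+1).-1)).
have eE : energy (@hlink m) = #|S|.
  rewrite -sum1_card big_mkcond.
  rewrite !sum_prod; apply: eq_bigr => i _; apply: eq_bigr => l _.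
  rewrite /cnt sum_prod; apply: eq_bigr => j _; apply: eq_bigr => k _.
  by rewrite inE /=; case: eqP.
have SB : S \subset f @: B.
  apply/fintype.subsetP => -[[i l] [j k]]; rewrite inE /= => /eqP E.
  have [a [b [g [t [[a0 b0 g0 t0] [iE jE kE lE]]]]]] :=
    solution_param (ltn0Sn i) (ltn0Sn j) (ltn0Sn k) (ltn0Sn l) E.
  have le u v (w : 'I_m) : 0 < v -> w.+1 = v * u -> u <= m.
    by move=> v0 wE; rewrite (leq_trans _ (ltn_ord w))// wE leq_pmull.
  have ge u v (w : 'I_m) : 0 < u -> w.+1 = v * u -> v <= m.
    by move=> u0 wE; rewrite (leq_trans _ (ltn_ord w))// wE leq_pmulr.
  have am := le _ _ _ g0 iE; have bm := le _ _ _ g0 kE.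
  have gm := ge _ _ _ a0 iE; have tm := ge _ _ _ a0 lE.
  have P u : 0 < u -> u <= m -> (inord u.-1 : 'I_m).+1 = u.
    by move=> u0 um; rewrite inordK prednK.
  apply/imsetP; exists ((inord a.-1, inord b.-1), (inord g.-1, inord t.-1)).
    rewrite inE /= !P// -iE -jE -kE -lE.
    by apply/and4P; split; exact: ltn_ord.
  rewrite /f !P// -iE -jE -kE -lE /=.
  by congr ((_, _), (_, _)); apply: val_inj; rewrite /= inordK.
rewrite eE; apply: leq_trans (subset_leq_card SB) _.
apply: leq_trans (leq_imset_card _ _) _.
pose D (u : 'I_m) := \sum_(g < m) (g.+1 * u.+1 <= m).
have DE u : D u = m %/ u.+1 by exact: count_multiples.
(* For each (a, b) only the constraints from the larger of the two are kept; ties are counted twice,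
   which is harmless. *)
apply: (@leq_trans (\sum_(a < m) \sum_(b < m) ((b <= a) * (D a * D a) + (a <= b) * (D b * D b)))).
  rewrite -sum1_card big_mkcond.
  rewrite !sum_prod.
  apply: leq_sum => a _; apply: leq_sum => b _.
  have H (u : 'I_m) : \sum_gt (if ((gt : 'I_m * 'I_m).1.+1 * u.+1 <= m) && (gt.2.+1 * u.+1 <= m) then 1 else 0)
      = D u * D u.
    rewrite sum_prod /= [RHS]big_distrl; apply: eq_bigr => g _; rewrite big_distrr.
    by apply: eq_bigr => t _; case: (_ <= _); case: (_ <= _).
  case: (leqP b a) => ab.
    rewrite mul1n -(H a); apply: leq_trans (leq_addr _ _); apply: leq_sum => -[g t] _.
    by rewrite inE /=; do ?[case: (_ <= m) => //=].
  rewrite (ltnW ab) mul1n -(H b); apply: leq_trans (leq_addl _ _); apply: leq_sum => -[g t] _.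
  by rewrite inE /=; do ?[case: (_ <= m) => //=].
under eq_bigr do rewrite big_split /=.
rewrite big_split /= [X in _ + X]exchange_big /= addnn -mul2n -mulnA leq_mul2l /=.
rewrite big_distrr /=; apply: leq_sum => a _.
rewrite -big_distrl /= mulnA DE leq_mul2r; apply/orP; right.
apply: leq_trans (leq_divM m a.+1).
rewrite mulnC leq_mul2l; apply/orP; right.
rewrite -[leqRHS]card_ord -sum1_card (big_ord_widen m (fun=> 1))//.
by rewrite [leqRHS]big_mkcond; apply: leq_sum => b _; rewrite ltnS; case: ifP.
Qed.

End energy_bound.

Section energy_asymptotics.
Context (R : realType).

Lemma harmonic_sum_le_ln n : \sum_(a < n.+1) a.+1%:R^-1 <= 1 + ln n.+1%:R :> R.
Proof.
elim: n => [|n IH]; first by rewrite big_ord1 ln1 addr0 invr1.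
rewrite big_ord_recr /=.
suff H : n.+2%:R^-1 <= ln (n.+2%:R : R) - ln n.+1%:R.
  by apply: le_trans (lerD IH H) _; rewrite addrA addrAC addrK.
rewrite -ln_div ?posrE//.
(* After exponentiating and inverting, the inequality is exp(-u) >= 1 - u at u = 1 / (n + 2). *)
rewrite -[leLHS]expRK ler_ln ?posrE ?expR_gt0 ?divr_gt0//.
rewrite -[leLHS]invrK -expRN -[leRHS]invrK lef_pV2 ?posrE ?invr_gt0 ?divr_gt0 ?expR_gt0//.
apply: le_trans (expR_ge1Dx _); rewrite invf_div.
rewrite ler_pdivrMr// mulrDl mul1r mulNr mulVf ?pnatr_eq0//.
by rewrite [n.+2%:R](_ : _ = n.+1%:R + 1) ?natr1//; lra.
Qed.

Lemma ln_le_powR (x al : R) : 0 < x -> 0 < al -> ln x <= x `^ al / al.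
Proof.
move=> x0 al0; rewrite ler_pdivlMr// /powR gt_eqF// mulrC.
by have := expR_ge1Dx (al * ln x); lra.
Qed.

Lemma energy_powR (al : R) n : 0 < al ->
  (energy (@hlink n))%:R <= 2 * (1 + al^-1) * n%:R ^+ 2 * n%:R `^ al.
Proof.
move=> al0; case: n => [|n].
  rewrite (_ : energy _ = 0%N) ?expr0n /= ?mulr0 ?mul0r//.
  by rewrite /energy big_ord0.
have le1 : (energy (@hlink n.+1))%:R <=
    2 * n.+1%:R ^+ 2 * \sum_(a < n.+1) a.+1%:R^-1 :> R.
  apply: (@le_trans _ _ (2 * n.+1 * \sum_(a < n.+1) n.+1 %/ a.+1)%N%:R).
    by rewrite ler_nat energy_le.
  rewrite 2!natrM [leRHS](_ : _ = 2 * n.+1%:R * (n.+1%:R * \sum_(a < n.+1) a.+1%:R^-1)).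
    rewrite ler_wpM2l ?mulr_ge0//.
    rewrite natr_sum mulr_sumr; apply: ler_sum => a _.
    by rewrite ler_pdivlMr// -natrM ler_nat leq_divM.
  by move: (\sum_(a < _) _) => z; ring.
apply: le_trans le1 _.
rewrite [leRHS](_ : _ = 2 * n.+1%:R ^+ 2 * ((1 + al^-1) * n.+1%:R `^ al)); last by ring.
rewrite ler_wpM2l ?mulr_ge0 ?sqr_ge0//.
apply: le_trans (harmonic_sum_le_ln n) _.
have n1 : 1 <= n.+1%:R :> R by rewrite ler1n.
have p1 : 1 <= n.+1%:R `^ al by rewrite -[leLHS](powRr0 n.+1%:R) ler_powR// ltW.
rewrite mulrDl mul1r lerD// mulrC; exact: ln_le_powR.
Qed.

End energy_asymptotics.

(** * From Stieltjes transforms to weak convergence *)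

Local Open Scope classical_set_scope.

Section weierstrass.
Context (R : realType).

(** Only [s] is confined to the unit interval: in the Bernstein argument [t] is an empirical mean
    and may be any real. *)
Lemma uniform_continuity_unit (h : R -> R) (e : R) : continuous h -> 0 < e ->
  exists2 d, 0 < d & forall s t, 0 <= s <= 1 -> `|s - t| < d -> `|h s - h t| < e.
Proof.
move=> ch e0.
have := @segment_compact R 0 1.
rewrite compact_near_coveringP => /(_ R (0^'+) (fun d s => forall t, `|s - t| < d -> `|h s - h t| < e) _).
have [|] := pselect True => // _.
case.
  move=> s _; have /cvgrPdist_lt /(_ (e / 2)) := ch s.
  rewrite divr_gt0// => /(_ isT) /nbhs_ballP[r /= r0 hr].
  exists (ball s (r / 2), [set d | d < r / 2]) => /=.
    split; first by apply: nbhsx_ballx; rewrite divr_gt0.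
    by apply: nbhs_right_lt; rewrite divr_gt0.
  move=> [s' d] /= [s's dr] t s't.
  have H1 : `|h s - h s'| < e / 2 by apply: hr; apply: lt_trans s's _; rewrite ltr_pdivrMr// ltr_pMr//; lra.
  have H2 : `|h s - h t| < e / 2.
    apply: hr; rewrite /ball /= (le_lt_trans (ler_distD s' _ _))//.
    by move: s's; rewrite /ball /=; lra.
  rewrite (le_lt_trans (ler_distD (h s) _ _))// distrC; lra.
move=> d /= d0 H; exists (d / 2); first by rewrite divr_gt0.
move=> s t s01 st; apply: (H (d / 2)) => //=.
- by rewrite /ball /= sub0r normrN gtr0_norm ?divr_gt0// ltr_pdivrMr// ltr_pMr//; lra.
- by rewrite divr_gt0.
Qed.

Definition coin (t : R) (b : bool) : R := if b then t else 1 - t.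
Definition coin_val (b : bool) : R := b%:R.

Lemma coin_sum t : \sum_b coin t b = 1.
Proof. by rewrite big_bool /= addrC subrK. Qed.

Lemma coin_ge0 t b : 0 <= t <= 1 -> 0 <= coin t b.
Proof. by case: b => /andP[t0 t1] //=; rewrite subr_ge0. Qed.

(** Each averaging step replaces [F] by t F(1) + (1 - t) F(0), which keeps it polynomial in the bias
    [t]. *)
Lemma Ex_coin_poly s (F : (nat -> R) -> {poly R}) x : exists q : {poly R},
  forall t, Ex (coin t) coin_val s (fun y => (F y).[t]) x = q.[t].
Proof.
elim: s F => [|k s IH] F /=; first by exists (F x).
have [q qE] := IH (fun y => 'X * F (upd y k 1) + (1 - 'X) * F (upd y k 0)).
exists q => t; rewrite -qE; apply: Ex_ext => y.
by rewrite /avg big_bool /= /coin_val !hornerE.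
Qed.

Lemma Ex_coin_coord s (t : R) k x : k \in s ->
  Ex (coin t) coin_val s (fun y => y k) x = t.
Proof.
move=> ks; have c1 := coin_sum t.
rewrite -(Ex_avg coin_val c1 _ _ ks) -[RHS](Ex_cst coin_val c1 s t x).
by apply: Ex_ext => y; rewrite /avg big_bool /= /coin_val !updE mulr1 mulr0 addr0.
Qed.

(* Bernstein polynomials, seen as expectations over independent coin tosses *)
Lemma weierstrass (h : R -> R) (M e : R) : continuous h -> (forall t, `|h t| <= M) ->
  0 < e -> exists q : {poly R}, forall t, 0 <= t <= 1 -> `|h t - q.[t]| <= e.
Proof.
move=> ch hM e0; have [d d0 hd] := uniform_continuity_unit ch (divr_gt0 e0 (ltr0n _ 2)).
have M0 : 0 <= M by apply: le_trans (hM 0).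
(* Chebyshev in pointwise form: where the mean is at least [d] away from [t], the oscillation
   [2 * M] is at most [D] times the squared deviation. The variance is at most [1 / N], and [N]
   makes [D / N] smaller than [e / 2]. *)
pose D := 2 * M / d ^+ 2.
have D0 : 0 <= D by apply: divr_ge0; [exact: mulr_ge0|exact: sqr_ge0].
pose N := (Num.truncn (D / (e / 2))).+1.
have DN : D / (e / 2) < N%:R by rewrite /N truncnS_gt.
have N0 : 0 < N%:R :> R by rewrite ltr0n.
pose mean (x : nat -> R) : R := N%:R^-1 * \sum_(k <- iota 0 N) x k.
have [q qE] := Ex_coin_poly (iota 0 N) (fun y => (h (mean y))%:P) (fun=> 0).
exists q => t t01; rewrite -qE.
have c0 b : 0 <= coin t b := coin_ge0 b t01.
have c1 := coin_sum t.
rewrite (@Ex_ext R _ (coin t) coin_val _ _ (fun y => h (mean y))); last by move=> y; rewrite hornerC.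
pose E := Ex (coin t) coin_val (iota 0 N).
have Emean : E mean (fun=> 0) = t.
  rewrite /E /mean ExZ (Ex_sum coin_val c1) (eq_big_seq (fun=> t)) => [|k kN].
    rewrite big_const_seq count_predT size_iota iter_addr addr0 -[t *+ N]mulr_natl.
    by rewrite mulKf// gt_eqF.
  exact: Ex_coin_coord.
have V : E (fun y => (mean y - t) ^+ 2) (fun=> 0) <= N%:R^-1.
  have := @Ex_variance R _ (coin t) coin_val c0 c1 'I_1 (iota 0 N) (fun=> mean)
    (fun=> N%:R^-1 ^+ 2) (fun=> 0) (iota_uniq _ _).
  rewrite big_ord1 -/E Emean big_const_seq count_predT size_iota iter_addr addr0.
  move=> /(_ _)/le_trans; apply; last first.
    by rewrite -[_ *+ N]mulr_natl expr2 mulrA mulfV ?mul1r// gt_eqF.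
  move=> k x kN; rewrite big_ord1; apply: (vark_le c0 c1) => a b.
  rewrite /mean -mulrBr -sumrB exprMn ler_piMr ?sqr_ge0//.
  rewrite (bigD1_seq k) ?iota_uniq//= !updE big1 ?addr0 => [|l lk]; last first.
    by rewrite /upd (negbTE lk) subrr.
  by case: a; case: b; rewrite /coin_val /= ?subrr ?subr0 ?sub0r ?sqrrN ?expr1n ?expr0n ?ler01.
have key y : `|h t - h (mean y)| <= e / 2 + D * (mean y - t) ^+ 2.
  have [tm|tm] := ltP `|t - mean y| d.
    apply: le_trans (ltW (hd _ _ t01 tm)) _.
    by rewrite lerDl mulr_ge0// sqr_ge0.
  apply: (@le_trans _ _ (2 * M)).
    by apply: le_trans (ler_normB _ _) _; have := hM t; have := hM (mean y); lra.
  have d2 : d ^+ 2 <= (mean y - t) ^+ 2.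
    by rewrite -[leRHS]real_normK ?num_real// distrC ler_sqr ?nnegrE// ltW.
  have : 2 * M <= D * (mean y - t) ^+ 2.
    by rewrite /D mulrAC ler_pdivlMr ?exprn_gt0// ler_wpM2l// mulr_ge0.
  by move: e0; lra.
have Ekey : E (fun y => e / 2 + D * (mean y - t) ^+ 2) (fun=> 0) <= e.
  rewrite /E ExD (Ex_cst coin_val c1) ExZ -/E.
  have : D * E (fun y => (mean y - t) ^+ 2) (fun=> 0) <= e / 2; last by lra.
  apply: le_trans (ler_wpM2l D0 V) _.
  by rewrite ler_pdivrMr// mulrC -ler_pdivrMr ?divr_gt0// ltW.
rewrite -/E ler_norml; apply/andP; split.
  suff : E (fun y => h (mean y)) (fun=> 0) <= h t + e by lra.
  apply: (@le_trans _ _ (E (fun y => h t + (e / 2 + D * (mean y - t) ^+ 2)) (fun=> 0))).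
    by apply: Ex_le => // y; have := key y; rewrite ler_norml => /andP[]; lra.
  by rewrite /E ExD (Ex_cst coin_val c1) -/E lerD2l.
suff : h t - e <= E (fun y => h (mean y)) (fun=> 0) by lra.
have : E (fun y => h t) (fun=> 0) <= E (fun y => h (mean y) + (e / 2 + D * (mean y - t) ^+ 2)) (fun=> 0).
  by apply: Ex_le => // y; have := key y; rewrite ler_norml => /andP[]; lra.
rewrite /E (Ex_cst coin_val c1) ExD -/E; lra.
Qed.

End weierstrass.

Section means.
Context (R : realType).
Implicit Types (f g : R -> R) (L : (R -> R) -> R) (u v : nat -> R).

Definition tends u (l : R) := forall e, 0 < e -> exists n0, forall n, (n0 <= n)%N -> `|u n - l| <= e.

Definition bcont f := continuous f /\ exists M, forall x, `|f x| <= M.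

(** Common abstraction of the spectral averages and of integration against the semicircle law:
    normalized positive linear functionals on bounded continuous functions. *)
Definition is_mean L := [/\ L (fun=> 1) = 1,
  forall f g, bcont f -> bcont g -> L (fun x => f x + g x) = L f + L g,
  forall a f, bcont f -> L (fun x => a * f x) = a * L f &
  forall f, bcont f -> (forall x, 0 <= f x) -> 0 <= L f].

Lemma tendsD u v (a b : R) : tends u a -> tends v b -> tends (fun n => u n + v n) (a + b).
Proof.
move=> ua vb e e0; have e2 : 0 < e / 2 by rewrite divr_gt0.
have [n1 H1] := ua _ e2; have [n2 H2] := vb _ e2.
exists (maxn n1 n2) => n; rewrite geq_max => /andP[/H1 h1 /H2 h2].
rewrite opprD addrACA (le_trans (ler_normD _ _))//; lra.
Qed.

Lemma tendsZ u (a c : R) : tends u a -> tends (fun n => c * u n) (c * a).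
Proof.
move=> ua e e0; have c0 : 0 < `|c| + 1 by have := normr_ge0 c; lra.
have [n1 H1] := ua _ (divr_gt0 e0 c0).
exists n1 => n /H1 h; rewrite -mulrBr normrM.
apply: (@le_trans _ _ ((`|c| + 1) * `|u n - a|)).
  by rewrite ler_wpM2r// lerDl.
by rewrite mulrC -ler_pdivlMr.
Qed.

Lemma bcont_cst (a : R) : bcont (fun=> a).
Proof. by split; [move=> x; exact: cvg_cst|exists `|a|]. Qed.

Lemma bcontD f g : bcont f -> bcont g -> bcont (fun x => f x + g x).
Proof.
move=> [cf [M fM]] [cg [N gN]]; split; first by move=> x; apply: cvgD; [exact: cf|exact: cg].
by exists (M + N) => x; rewrite (le_trans (ler_normD _ _))// lerD.
Qed.

Lemma bcontM f g : bcont f -> bcont g -> bcont (fun x => f x * g x).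
Proof.
move=> [cf [M fM]] [cg [N gN]]; split; first by move=> x; apply: cvgM; [exact: cf|exact: cg].
by exists (M * N) => x; rewrite normrM ler_pM.
Qed.

Lemma bcontZ (a : R) f : bcont f -> bcont (fun x => a * f x).
Proof. by move=> bf; apply: bcontM => //; exact: bcont_cst. Qed.

Lemma bcontB f g : bcont f -> bcont g -> bcont (fun x => f x - g x).
Proof.
move=> bf bg; rewrite (_ : (fun x => _) = fun x => f x + -1 * g x).
  by apply: bcontD => //; exact: bcontZ.
by apply/funext => x; rewrite mulN1r.
Qed.

Lemma mean_cst L (a : R) : is_mean L -> L (fun=> a) = a.
Proof.
move=> [L1 _ LZ _]; have := LZ a _ (bcont_cst 1).
by rewrite L1 mulr1.
Qed.

Lemma meanB L f g : is_mean L -> bcont f -> bcont g ->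
  L (fun x => f x - g x) = L f - L g.
Proof.
move=> [_ LD LZ _] bf bg; rewrite -[- L g]mulN1r -LZ// -LD//; last exact: bcontZ.
by congr L; apply/funext => x; rewrite mulN1r.
Qed.

Lemma mean_le L f g : is_mean L -> bcont f -> bcont g ->
  (forall x, f x <= g x) -> L f <= L g.
Proof.
move=> mL bf bg fg; rewrite -subr_ge0 -meanB//; case: mL => _ _ _; apply.
  exact: bcontB.
by move=> x; rewrite subr_ge0.
Qed.

Lemma mean_dist L f g e : is_mean L -> bcont f -> bcont g ->
  (forall x, `|f x - g x| <= e) -> `|L f - L g| <= e.
Proof.
move=> mL bf bg fge; rewrite -meanB//.
have bB := bcontB bf bg.
have fge' x : - e <= f x - g x <= e by rewrite -ler_norml.
have H1 : L (fun=> - e) <= L (fun x => f x - g x).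
  by apply: mean_le => // [|x]; [exact: bcont_cst|case/andP: (fge' x)].
have H2 : L (fun x => f x - g x) <= L (fun=> e).
  by apply: mean_le => // [|x]; [exact: bcont_cst|case/andP: (fge' x)].
by rewrite ler_norml; rewrite !mean_cst// in H1 H2; rewrite H1.
Qed.

Lemma continuous_maxr f g : continuous f -> continuous g ->
  continuous (fun x => Num.max (f x) (g x)).
Proof. by move=> cf cg x; apply: (@continuous_max R R f g x (cf x) (cg x)). Qed.

Lemma continuous_minr f g : continuous f -> continuous g ->
  continuous (fun x => Num.min (f x) (g x)).
Proof. by move=> cf cg x; apply: (@continuous_min R R f g x (cf x) (cg x)). Qed.

Lemma den_gt0 (a x : R) : 0 < a -> 0 < x ^+ 2 + a.
Proof. by move=> a0; have := sqr_ge0 x; lra. Qed.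

Lemma inv_cont (a : R) : 0 < a -> continuous (fun x : R => (x ^+ 2 + a)^-1).
Proof.
move=> a0 x; apply: cvgV; first by rewrite gt_eqF// den_gt0.
by apply: cvgD; [exact: exprn_continuous|exact: cvg_cst].
Qed.

Section cauchy_kernel.
Context (a : R).
Hypothesis a_ge1 : 1 <= a.

Let den_ge1 (x : R) : 1 <= x ^+ 2 + a.
Proof. by rewrite (le_trans a_ge1)// lerDr sqr_ge0. Qed.

Let a_gt0 : 0 < a. Proof. exact: lt_le_trans a_ge1. Qed.

Lemma cauchy01 (x : R) : 0 <= (x ^+ 2 + a)^-1 <= 1.
Proof. by rewrite invr_ge0 invf_le1 ?den_gt0// den_ge1 ltW ?den_gt0. Qed.

Lemma bcont_cauchy : bcont (fun x : R => (x ^+ 2 + a)^-1).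
Proof.
split; first exact: inv_cont.
by exists 1 => x; have /andP[? ?] := cauchy01 x; rewrite ger0_norm.
Qed.

Lemma odd_cauchy_le1 (x : R) : `|x * (x ^+ 2 + a)^-1| <= 1.
Proof.
rewrite normrM (ger0_norm (x := _^-1)) ?invr_ge0 ?(ltW (den_gt0 x a_gt0))//.
rewrite ler_pdivrMr ?den_gt0// mul1r -(real_normK (num_real x)).
have := sqr_ge0 (`|x| - 1); have := normr_ge0 x; move: a_ge1 `|x| => q z.
by rewrite sqrrB1; lra.
Qed.

Lemma bcont_odd_cauchy : bcont (fun x : R => x * (x ^+ 2 + a)^-1).
Proof.
split; last by exists 1 => x; exact: odd_cauchy_le1.
by move=> x; apply: cvgM; [exact: cvg_id|exact: (bcont_cauchy.1 x)].
Qed.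

End cauchy_kernel.

Section convergence_class.
Variables (Ln : nat -> (R -> R) -> R) (L : (R -> R) -> R).
Hypotheses (mLn : forall n, is_mean (Ln n)) (mL : is_mean L).

(** The test functions along which convergence holds: a vector space containing the constants and
    closed under uniform limits. The goal is that it contains all of [bcont]. *)
Definition cclass f := bcont f /\ tends (fun n => Ln n f) (L f).

Lemma cclass_cst (a : R) : cclass (fun=> a).
Proof.
split; first exact: bcont_cst.
move=> e e0; exists 0%N => n _; rewrite !mean_cst// subrr normr0 ltW//.
Qed.

Lemma cclassD f g : cclass f -> cclass g -> cclass (fun x => f x + g x).
Proof.
move=> [bf tf] [bg tg]; split; first exact: bcontD.
case: (mL) => _ -> // _ _.
rewrite (_ : (fun n => _) = (fun n => Ln n f + Ln n g)); first exact: tendsD.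
by apply/funext => n; case: (mLn n) => _ -> // _ _.
Qed.

Lemma cclassZ (a : R) f : cclass f -> cclass (fun x => a * f x).
Proof.
move=> [bf tf]; split; first exact: bcontZ.
case: (mL) => _ _ -> // _.
rewrite (_ : (fun n => _) = (fun n => a * Ln n f)); first exact: tendsZ.
by apply/funext => n; case: (mLn n) => _ _ -> // _.
Qed.

Lemma cclassB f g : cclass f -> cclass g -> cclass (fun x => f x - g x).
Proof.
move=> bf bg; rewrite (_ : (fun x => _) = fun x => f x + -1 * g x).
  by apply: cclassD => //; exact: cclassZ.
by apply/funext => x; rewrite mulN1r.
Qed.

Lemma cclass_closed f : bcont f ->
  (forall e, 0 < e -> exists2 g, cclass g & forall x, `|f x - g x| <= e) -> cclass f.
Proof.
move=> bf fg; split => // e e0; have e3 : 0 < e / 3 by rewrite divr_gt0.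
have [g [bg tg] fge] := fg _ e3; have [n0 H] := tg _ e3.
exists n0 => n /H h.
have h1 := mean_dist (mLn n) bf bg fge; have h2 := mean_dist mL bf bg fge.
have -> : Ln n f - L f = (Ln n f - Ln n g) + (Ln n g - L g) - (L f - L g) by ring.
rewrite (le_trans (ler_normB _ _))// (le_trans (lerD (ler_normD _ _) (lexx _)))//; lra.
Qed.

(** With y = 3 + 1 / (k + 1), the real and imaginary parts of 1 / (x - i y) are [x] and y times this
    kernel. *)
Definition cauchy_k (k : nat) (x : R) : R := (x ^+ 2 + (3 + k.+1%:R^-1) ^+ 2)^-1.
Definition cauchy3 (x : R) : R := (x ^+ 2 + 9)^-1.

Let gap k : R := (3 + k.+1%:R^-1) ^+ 2 - 9.

Let gap_gt0 k : 0 < gap k.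
Proof.
rewrite /gap; have : 0 < k.+1%:R^-1 :> R by [].
by move: (k.+1%:R^-1) => z z0; nra.
Qed.

Let gap_le k : gap k <= 7 * k.+1%:R^-1.
Proof.
rewrite /gap; have : 0 < k.+1%:R^-1 :> R by [].
have : k.+1%:R^-1 <= 1 :> R by rewrite invf_le1// ler1n.
by move: (k.+1%:R^-1) => z z1 z0; nra.
Qed.

Let cauchy3_01 x : 0 <= cauchy3 x <= 1 := cauchy01 (ler1n R 9) x.
Let bcont_cauchy3 : bcont cauchy3 := bcont_cauchy (ler1n R 9).
Let x_cauchy3_le1 x : `|x * cauchy3 x| <= 1 := odd_cauchy_le1 (ler1n R 9) x.

Let yk2_gt0 k : 0 < (3 + k.+1%:R^-1 : R) ^+ 2.
Proof. by rewrite exprn_gt0// addr_gt0. Qed.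

Let cauchy_k01 k x : 0 <= cauchy_k k x <= 1.
Proof. by apply: cauchy01; rewrite exprn_ege1// (@le_trans _ _ 3) ?ler1n ?lerDl. Qed.

Let cauchyB k x : cauchy3 x - cauchy_k k x = gap k * (cauchy3 x * cauchy_k k x).
Proof.
rewrite /cauchy3 /cauchy_k /gap.
have := den_gt0 x (yk2_gt0 k); have := den_gt0 x (ltr0n R 9).
move: ((3 + k.+1%:R^-1) ^+ 2) => b h1 h2.
by field; rewrite ?(gt_eqF h1) ?(gt_eqF h2).
Qed.

(* [phi * cauchy3] is the uniform limit of the [phi * cauchy_k k], and the
   resolvent identity [cauchyB] turns this into powers of [cauchy3]. *)
Lemma cclass_step (phi : R -> R) :
  continuous phi -> (forall x, `|phi x * cauchy3 x| <= 1) ->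
  (forall k, cclass (fun x => phi x * cauchy_k k x)) ->
  cclass (fun x => phi x * cauchy3 x) /\
  forall k, cclass (fun x => phi x * cauchy3 x * cauchy_k k x).
Proof.
move=> cphi phi1 Hk.
have bc : bcont (fun x => phi x * cauchy3 x).
  split; last by exists 1.
  by move=> x; apply: cvgM; [exact: cphi|exact: (proj1 bcont_cauchy3)].
have c3 : cclass (fun x => phi x * cauchy3 x).
  apply: cclass_closed => // e e0.
  pose k := Num.truncn (7 / e).
  exists (fun x => phi x * cauchy_k k x) => // x.
  rewrite -mulrBr cauchyB mulrCA normrM gtr0_norm// mulrA normrM.
  have kk := cauchy_k01 k x; rewrite (ger0_norm (x := cauchy_k k x)); last by case/andP: kk.
  apply: (@le_trans _ _ (gap k * (1 * 1))).
    by rewrite ler_wpM2l ?(ltW (gap_gt0 k))// ler_pM//; case/andP: kk.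
  rewrite !mulr1; apply: le_trans (gap_le k) _.
  rewrite ler_pdivrMr// mulrC -ler_pdivrMr//; apply: ltW; exact: truncnS_gt.
split=> // k; rewrite (_ : (fun x => _) =
    fun x => (gap k)^-1 * (phi x * cauchy3 x - phi x * cauchy_k k x)).
  by apply: cclassZ; exact: cclassB.
apply/funext => x; rewrite -mulrBr cauchyB (mulrCA (phi x)) mulKf ?gt_eqF//.
by rewrite mulrA.
Qed.

(** The step is iterated with [phi * cauchy3] in place of [phi], which satisfies the same
    assumptions; difference quotients at accumulating poles thus produce all powers of the limit
    kernel. *)
Lemma cclass_pow (phi : R -> R) m :
  continuous phi -> (forall x, `|phi x * cauchy3 x| <= 1) ->
  (forall k, cclass (fun x => phi x * cauchy_k k x)) ->
  cclass (fun x => phi x * cauchy3 x ^+ m.+1).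
Proof.
elim: m phi => [|m IH] phi cphi phi1 Hk; have [H1 H2] := cclass_step cphi phi1 Hk => //.
rewrite (_ : (fun x => _) = fun x => phi x * cauchy3 x * cauchy3 x ^+ m.+1).
  apply: IH => // [x|x].
    by apply: cvgM; [exact: cphi|exact: (proj1 bcont_cauchy3)].
  rewrite normrM -[leRHS]mulr1; apply: ler_pM => //.
  by have /andP[a b] := cauchy3_01 x; rewrite ger0_norm.
by apply/funext => x; rewrite exprS mulrA.
Qed.

Hypotheses (Hc : forall k, cclass (cauchy_k k))
           (Hs : forall k, cclass (fun x => x * cauchy_k k x)).

Lemma cclass_pow_even i : cclass (fun x => cauchy3 x ^+ i).
Proof.
case: i => [|i].
  by rewrite (_ : (fun x => _) = fun=> 1) //; exact: cclass_cst.
rewrite (_ : (fun x => _) = fun x => 1 * cauchy3 x ^+ i.+1); last first.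
  by apply/funext => x; rewrite mul1r.
apply: (@cclass_pow (fun=> 1)) => [x|x|k]; first exact: cvg_cst.
  by rewrite mul1r; have /andP[a b] := cauchy3_01 x; rewrite ger0_norm.
by rewrite (_ : (fun x => _) = cauchy_k k)//; apply/funext => x; rewrite mul1r.
Qed.

Lemma cclass_pow_odd i : cclass (fun x => x * cauchy3 x * cauchy3 x ^+ i).
Proof.
rewrite (_ : (fun x => _) = fun x => x * cauchy3 x ^+ i.+1); last first.
  by apply/funext => x; rewrite exprS mulrA.
by apply: (@cclass_pow id) => // x; exact: cvg_id.
Qed.

Lemma cclass_sum n (F : nat -> R -> R) (a : nat -> R) : (forall i, cclass (F i)) ->
  cclass (fun x => \sum_(i < n) a i * F i x).
Proof.
move=> HF; elim: n => [|n IH].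
  rewrite (_ : (fun x => _) = fun=> 0); first exact: cclass_cst.
  by apply/funext => x; rewrite big_ord0.
rewrite (_ : (fun x => _) = fun x => \sum_(i < n) a i * F i x + a n * F n x).
  by apply: cclassD => //; exact: cclassZ.
by apply/funext => x; rewrite big_ord_recr.
Qed.

Lemma cclass_comp_even (h : R -> R) : bcont h -> cclass (fun x => h (cauchy3 x)).
Proof.
move=> [ch [M hM]]; apply: cclass_closed.
  split; last by exists M => x.
  by move=> x; apply: (@continuous_comp _ _ _ cauchy3 h); [exact: (proj1 bcont_cauchy3)|exact: ch].
move=> e e0; have [q qe] := weierstrass ch hM e0.
exists (fun x => q.[cauchy3 x]) => [|x]; last exact: qe.
rewrite (_ : (fun x => _) = fun x => \sum_(i < size q) q`_i * cauchy3 x ^+ i).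
  exact: (cclass_sum (size q) (fun i => q`_i) cclass_pow_even).
by apply/funext => x; rewrite horner_coef.
Qed.

Lemma cclass_comp_odd (h : R -> R) : bcont h ->
  cclass (fun x => x * cauchy3 x * h (cauchy3 x)).
Proof.
move=> [ch [M hM]]; apply: cclass_closed.
  apply: bcontM; first by split; [move=> x; apply: cvgM; [exact: cvg_id|exact: (proj1 bcont_cauchy3)]|exists 1].
  split; last by exists M => x.
  by move=> x; apply: (@continuous_comp _ _ _ cauchy3 h); [exact: (proj1 bcont_cauchy3)|exact: ch].
move=> e e0; have [q qe] := weierstrass ch hM e0.
exists (fun x => x * cauchy3 x * q.[cauchy3 x]) => [|x]; last first.
  rewrite -mulrBr normrM -[e]mul1r; apply: ler_pM => //; exact: qe.
rewrite (_ : (fun x => _) = fun x => \sum_(i < size q) q`_i * (x * cauchy3 x * cauchy3 x ^+ i)).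
  exact: (cclass_sum (size q) (fun i => q`_i) cclass_pow_odd).
apply/funext => x; rewrite horner_coef mulr_sumr.
by apply: eq_bigr => i _; rewrite mulrCA.
Qed.

(** [cauchy3] is an injective function of |x|, with inverse sqrt(1 / t - 9). Cutting [t] off below
    at [tau = cauchy3 A0] makes the inverse continuous on the whole line, and [f] vanishes where the
    cutoff acts. *)
Lemma even_factor (f : R -> R) (A0 : R) : 0 < A0 -> bcont f ->
  (forall x, f (- x) = f x) -> (forall x, A0 <= `|x| -> f x = 0) ->
  exists2 h, bcont h & forall x, f x = h (cauchy3 x).
Proof.
move=> A00 [cf [M fM]] fe fA.
pose tau : R := (A0 ^+ 2 + 9)^-1.
have tau0 : 0 < tau by rewrite invr_gt0 den_gt0.
pose k (t : R) : R := Num.sqrt ((Num.max t tau)^-1 - 9).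
have m0 t : 0 < Num.max t tau by rewrite lt_max tau0 orbT.
exists (fun t => f (k t)).
  split; last by exists M.
  move=> t; apply: (@continuous_comp _ _ _ k f); last exact: cf.
  apply: (@continuous_comp _ _ _ (fun t => (Num.max t tau)^-1 - 9) Num.sqrt); last exact: sqrt_continuous.
  apply: cvgB; last exact: cvg_cst.
  apply: cvgV; first by rewrite gt_eqF.
  by apply: (@continuous_maxr id (fun=> tau)) => ?; [exact: cvg_id|exact: cvg_cst].
move=> x; have [xA|xA] := leP A0 `|x|.
  rewrite fA// (_ : k (cauchy3 x) = A0) ?fA ?ger0_norm ?lexx ?(ltW A00)//.
  rewrite /k max_r ?invrK ?addrK ?sqrtr_sqr ?ger0_norm ?(ltW A00)//.
  rewrite lef_pV2 ?posrE ?den_gt0// lerD2r -[leRHS]real_normK ?num_real//.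
  by rewrite ler_sqr ?nnegrE// ltW.
rewrite (_ : k (cauchy3 x) = `|x|).
  by case: (ler0P x) => // _; rewrite fe.
rewrite /k max_l ?invrK ?addrK ?sqrtr_sqr//.
rewrite lef_pV2 ?posrE ?den_gt0// lerD2r -[leLHS]real_normK ?num_real//.
by rewrite ler_sqr ?nnegrE// ltW.
Qed.

Lemma cclass_even (f : R -> R) (A0 : R) : 0 < A0 -> bcont f ->
  (forall x, f (- x) = f x) -> (forall x, A0 <= `|x| -> f x = 0) -> cclass f.
Proof.
move=> A00 bf fe fA; have [h bh fh] := even_factor A00 bf fe fA.
by rewrite (_ : f = fun x => h (cauchy3 x)); [exact: cclass_comp_even|apply/funext].
Qed.

(** An odd [f] should be [x * cauchy3 x] times an even function, but f(x) / x may be unbounded at 0.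
    With 1 / x replaced by x / (x^2 + d), the product is f(x) x^2 / (x^2 + d), uniformly close to
    [f] because [f 0 = 0]. *)
Lemma cclass_odd (f : R -> R) (A0 : R) : 0 < A0 -> bcont f ->
  (forall x, f (- x) = - f x) -> (forall x, A0 <= `|x| -> f x = 0) -> cclass f.
Proof.
move=> A00 bf fo fA; apply: cclass_closed => // e e0.
have f0 : f 0 = 0 by have := fo 0; rewrite oppr0; lra.
have [cf [M fM]] := bf.
have M0 : 0 <= M by apply: le_trans (fM 0).
have [r r0 fr] : exists2 r, 0 < r & forall x, `|x| < r -> `|f x| <= e.
  have /cvgrPdist_le /(_ e e0) /nbhs_ballP[r /= r0 hr] := cf 0.
  exists r => // x xr; have := hr x; rewrite /ball /= sub0r normrN f0 sub0r normrN.
  exact.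
(* Outside |x| < r the error is at most M d / r^2, here e M / (M + 1); inside it is at most |f|,
   hence at most [e]. *)
pose d : R := e * r ^+ 2 / (M + 1).
have d0 : 0 < d by rewrite divr_gt0 ?mulr_gt0 ?exprn_gt0//; lra.
pose q x : R := f x * x * (x ^+ 2 + 9) / (x ^+ 2 + d).
have [h bh qh] : exists2 h, bcont h & forall x, q x = h (cauchy3 x).
  apply: (even_factor A00).
  - split.
      move=> x; apply: cvgM; last exact: inv_cont.
      apply: cvgM; first by apply: cvgM; [exact: cf|exact: cvg_id].
      by apply: cvgD; [exact: exprn_continuous|exact: cvg_cst].
    exists (M * A0 * (A0 ^+ 2 + 9) / d) => x.
    have [xA|xA] := leP A0 `|x|.
      rewrite /q fA// !mul0r normr0 !mulr_ge0 ?invr_ge0 ?(ltW d0) ?(ltW A00)//.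
      exact: ltW (den_gt0 _ _).
    have x2 : x ^+ 2 <= A0 ^+ 2.
      by rewrite -[leLHS]real_normK ?num_real// ler_sqr ?nnegrE// ltW.
    rewrite /q !normrM normfV (ger0_norm (ltW (den_gt0 x d0))).
    rewrite (ger0_norm (ltW (den_gt0 x (ltr0n R 9)))).
    apply: ler_pM; rewrite ?mulr_ge0 ?invr_ge0 ?(ltW (den_gt0 _ _))//.
      apply: ler_pM; rewrite ?mulr_ge0 ?(ltW (den_gt0 _ _))//; last by rewrite lerD2r.
      by apply: ler_pM => //; exact: ltW.
    by rewrite lef_pV2 ?posrE ?den_gt0// lerDr sqr_ge0.
  - by move=> x; rewrite /q fo sqrrN mulrNN.
  - by move=> x xA; rewrite /q fA// !mul0r.
exists (fun x => x * cauchy3 x * h (cauchy3 x)); first exact: cclass_comp_odd.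
move=> x; rewrite -qh.
have -> : f x - x * cauchy3 x * q x = f x * (d / (x ^+ 2 + d)).
  rewrite /cauchy3 /q; have := den_gt0 x d0; have := den_gt0 x (ltr0n R 9).
  by move=> h1 h2; field; rewrite ?(gt_eqF h1) ?(gt_eqF h2).
have dd : 0 <= d / (x ^+ 2 + d) <= 1.
  rewrite divr_ge0 ?(ltW d0) ?(ltW (den_gt0 _ _))//= ler_pdivrMr ?den_gt0//.
  by rewrite mul1r lerDr sqr_ge0.
rewrite normrM (ger0_norm (x := d / _)); last by case/andP: dd.
have [xr|xr] := ltP `|x| r.
  by rewrite -[e]mulr1; apply: ler_pM => //; [case/andP: dd|exact: fr|case/andP: dd].
have r2 : r ^+ 2 <= x ^+ 2.
  by rewrite -[leRHS]real_normK ?num_real// ler_sqr ?nnegrE// ltW.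
have rr : 0 < r ^+ 2 by rewrite exprn_gt0.
apply: (@le_trans _ _ (M * (d / r ^+ 2))).
  apply: ler_pM => //; first by case/andP: dd.
  by rewrite ler_pM2l// lef_pV2 ?posrE ?den_gt0//; move: d0 r2; lra.
have M1 : 0 < M + 1 by lra.
have -> : M * (d / r ^+ 2) = e * (M / (M + 1)).
  by rewrite /d; field; rewrite ?(gt_eqF M1) ?(gt_eqF r0).
by rewrite ler_piMr ?(ltW e0)// ler_pdivrMr// mul1r lerDl.
Qed.

Hypothesis Lsupp : forall f, bcont f -> (forall x, `|x| <= 2 -> f x = 0) -> L f = 0.

(** Tightness is obtained from convergence itself: [1 - chi], a constant minus a compactly supported
    function, lies in the class and has limit mean 0, so the means of [M * (1 - chi x)], which
    dominates the part of [f] cut off, tend to 0. *)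
Theorem cclass_bcont f : bcont f -> cclass f.
Proof.
move=> bf; have [cf [M fM]] := bf.
have M0 : 0 <= M by apply: le_trans (fM 0).
have compact g : bcont g -> (forall x, 3 <= `|x| -> g x = 0) -> cclass g.
  move=> bg g3; have [cg [Mg gM]] := bg.
  have bgN : bcont (fun x => g (- x)).
    split; last by exists Mg.
    by move=> x; apply: (@continuous_comp _ _ _ -%R g); [exact: opp_continuous|exact: cg].
  rewrite (_ : g = fun x => 2^-1 * (g x + g (- x)) + 2^-1 * (g x - g (- x))).
    apply: cclassD.
      apply: (@cclass_even _ 3) => //; first by apply: bcontZ; exact: bcontD.
        by move=> x; rewrite opprK [g (- x) + _]addrC.
      by move=> x x3; rewrite !g3 ?normrN// addr0 mulr0.
    apply: (@cclass_odd _ 3) => //; first by apply: bcontZ; exact: bcontB.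
      by move=> x; rewrite opprK; ring.
    by move=> x x3; rewrite !g3 ?normrN// subr0 mulr0.
  by apply/funext => x; field.
pose chi (x : R) : R := Num.max 0 (Num.min 1 (3 - `|x|)).
have chi01 x : 0 <= chi x <= 1.
  by rewrite /chi le_max (lexx (0 : R)) /= ge_max ler01 ge_min (lexx (1 : R)).
have bchi : bcont chi.
  split; last by exists 1 => x; have /andP[a b] := chi01 x; rewrite ger0_norm.
  apply: continuous_maxr; first by move=> x; exact: cvg_cst.
  apply: continuous_minr; first by move=> x; exact: cvg_cst.
  by move=> x; apply: cvgB; [exact: cvg_cst|exact: norm_continuous].
have chi3 x : 3 <= `|x| -> chi x = 0.
  by move=> x3; rewrite /chi max_l// ge_min; apply/orP; right; lra.
have chi2 x : `|x| <= 2 -> chi x = 1.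
  by move=> x2; rewrite /chi min_l ?max_r//; lra.
have bfc := bcontM bf bchi.
have c1 : cclass (fun x => f x * chi x).
  by apply: compact => // x x3; rewrite chi3// mulr0.
have c2 : cclass (fun x => M * (1 - chi x)).
  apply: cclassZ; apply: cclassB; first exact: cclass_cst.
  exact: compact.
have Lf : L f = L (fun x => f x * chi x).
  apply/eqP; rewrite -subr_eq0 -meanB//; apply/eqP; apply: Lsupp; first exact: bcontB.
  by move=> x x2; rewrite chi2// mulr1 subrr.
have L2 : L (fun x => M * (1 - chi x)) = 0.
  apply: Lsupp; first exact: (proj1 c2).
  by move=> x x2; rewrite chi2// subrr mulr0.
split => // e e0; have e2 : 0 < e / 2 by rewrite divr_gt0.
have [n1 H1] := (proj2 c1) _ e2; have [n2 H2] := (proj2 c2) _ e2.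
exists (maxn n1 n2) => n; rewrite geq_max => /andP[/H1 h1 /H2].
rewrite L2 subr0 => h2; rewrite Lf.
have B1 : Ln n f - Ln n (fun x => f x * chi x) <= Ln n (fun x => M * (1 - chi x)).
  rewrite -meanB//; apply: mean_le => //; [exact: bcontB|exact: (proj1 c2)|].
  move=> x; have := fM x; have := chi01 x; rewrite ler_norml => /andP[? ?] /andP[? ?].
  by nra.
have B2 : - Ln n (fun x => M * (1 - chi x)) <= Ln n f - Ln n (fun x => f x * chi x).
  have <- : Ln n (fun x => -1 * (M * (1 - chi x))) = - Ln n (fun x => M * (1 - chi x)).
    by case: (mLn n) => _ _ LZ _; rewrite (LZ _ _ (proj1 c2)) mulN1r.
  rewrite -meanB//.
  apply: mean_le => //; [by apply: bcontZ; exact: (proj1 c2)|exact: bcontB|].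
  move=> x; have := fM x; have := chi01 x; rewrite ler_norml => /andP[? ?] /andP[? ?].
  by nra.
move: h1 h2 B1 B2; rewrite !ler_norml => /andP[? ?] /andP[? ?] ? ?.
by apply/andP; split; lra.
Qed.

End convergence_class.
End means.

(** * Spectral and semicircular means *)

Section spectrum.
Context (R : realType) (n : nat).
Local Notation C := R[i].
Implicit Types A : 'M[R]_n.

Lemma symmetric_spectral A : A^T = A -> exists (P : 'M[C]_n) (d : 'I_n -> R),
  P \in unitmx /\
  map_mx (real_complex R) A = invmx P *m diag_mx (\row_i (d i)%:C) *m P.
Proof.
move=> symA; pose AC := map_mx (real_complex R) A.
have hA : AC \is hermsymmx.
  apply: realsym_hermsym; last first.
    by apply/mxOverP => i j; rewrite mxE complex_real.
  apply/is_hermitianmxP; rewrite expr0 scale1r; apply/matrixP => i j.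
  by rewrite !mxE -[in LHS]symA mxE.
have rD := hermitian_spectral_diag_real hA.
have /orthomx_spectralP AE := hermitian_normalmx hA.
exists (spectralmx AC), (fun i => Re (spectral_diag AC 0 i)).
split; first exact: spectral_unit.
have -> : \row_i (Re (spectral_diag AC 0 i))%:C = spectral_diag AC.
  by apply/rowP => i; rewrite mxE RRe_real//; have /mxOverP := rD; apply.
exact: AE.
Qed.

Lemma perm_eigenvalues A (P : 'M[C]_n) (d : 'I_n -> R) : A^T = A -> P \in unitmx ->
  map_mx (real_complex R) A = invmx P *m diag_mx (\row_i (d i)%:C) *m P ->
  perm_eq (eigenvalues A) [seq d i | i <- enum 'I_n].
Proof.
move=> symA uP AE; have [_ cA] := eigenvaluesP symA.
apply: prod_XsubC_eq; rewrite -cA; apply: (map_poly_inj (real_complex R)).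
rewrite map_char_poly AE char_poly_conj// char_poly_trig ?diag_mx_is_trig//.
rewrite rmorph_prod big_map big_enum /=; apply: eq_bigr => i _.
by rewrite rmorphB/= map_polyX map_polyC/= !mxE eqxx.
Qed.

Definition spec_mean A (f : R -> R) : R :=
  n%:R^-1 * \sum_(j < n) f (eigenvalues A)`_j.

Lemma spec_meanE A (P : 'M[C]_n) (d : 'I_n -> R) f : A^T = A -> P \in unitmx ->
  map_mx (real_complex R) A = invmx P *m diag_mx (\row_i (d i)%:C) *m P ->
  spec_mean A f = n%:R^-1 * \sum_i f (d i).
Proof.
move=> symA uP AE; congr (_ * _).
transitivity (\sum_(a <- eigenvalues A) f a).
  by rewrite (big_nth 0) size_eigenvalues// big_mkord.
by rewrite (perm_big _ (perm_eigenvalues symA uP AE)) big_map big_enum.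
Qed.

Lemma ntr_res_eigen A (P : 'M[C]_n) (d : 'I_n -> R) (y : R) : 0 < y -> P \in unitmx ->
  map_mx (real_complex R) A = invmx P *m diag_mx (\row_i (d i)%:C) *m P ->
  ntr (res y A) = (n%:R^-1)%:C * \sum_i ((d i)%:C - (0 +i* y)%C)^-1.
Proof.
move=> y0 uP AE; rewrite /ntr; congr (_ * _).
have nz i : (d i)%:C - (0 +i* y)%C != 0.
  by rewrite eq_complex /= negb_and sub0r oppr_eq0 (gt_eqF y0) orbT.
pose D := diag_mx (\row_i ((d i)%:C - (0 +i* y)%C)).
pose Di := diag_mx (\row_i ((d i)%:C - (0 +i* y)%C)^-1).
have shE : shift_i y A = invmx P *m D *m P.
  rewrite /shift_i AE.
  have -> : ((0 +i* y)%C)%:M = invmx P *m ((0 +i* y)%C)%:M *m P :> 'M[C]_n.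
    by rewrite -mulmxA mul_scalar_mx -scalemxAr mulVmx// scalemx1.
  have -> : D = diag_mx (\row_i (d i)%:C) - ((0 +i* y)%C)%:M.
    apply/matrixP => i j.
    by rewrite !mxE; case: eqP; rewrite ?mulr1n ?mulr0n// subr0.
  by rewrite mulmxBr mulmxBl.
have DDi : D *m Di = 1%:M.
  rewrite mulmx_diag; apply/matrixP => i j; rewrite !mxE.
  by case: eqP => // _; rewrite mulfV// mulr1n.
have resE : res y A = invmx P *m Di *m P.
  have I1 : shift_i y A *m (invmx P *m Di *m P) = 1%:M.
    by rewrite shE -!mulmxA (mulmxA P) mulmxV// mul1mx (mulmxA D) DDi mul1mx mulVmx.
  have uS : shift_i y A \in unitmx by have [] := mulmx1_unit I1.
  by rewrite -[RHS](mulKmx uS) I1 mulmx1.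
rewrite resE -mulmxA mxtrace_mulC -mulmxA mulmxV// mulmx1 /Di mxtrace_diag.
by apply: eq_bigr => i _; rewrite mxE.
Qed.

(** 1 / (x - i y) = (x + i y) / (x^2 + y^2), averaged over the spectrum. *)
Lemma ntr_res_spec A (y : R) : A^T = A -> 0 < y ->
  Re (ntr (res y A)) = spec_mean A (fun x => x / (x ^+ 2 + y ^+ 2)) /\
  Im (ntr (res y A)) = spec_mean A (fun x => y / (x ^+ 2 + y ^+ 2)).
Proof.
move=> symA y0; have [P [d [uP AE]]] := symmetric_spectral symA.
rewrite (ntr_res_eigen y0 uP AE) ReZ ImZ Re_sum Im_sum.
rewrite !(spec_meanE _ symA uP AE); split; congr (_ * _); apply: eq_bigr => i _ /=.
  by rewrite sub0r sqrrN subr0.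
by rewrite sub0r sqrrN subr0 mulNr opprK.
Qed.

Lemma integral_spectral_measure A (f : R -> R) : measurable_fun setT f ->
  (\int[spectral_measure A]_x (f x)%:E = (spec_mean A f)%:E)%E.
Proof.
move=> mf.
have pos (g : R -> R) : measurable_fun setT g -> (forall x, 0 <= g x) ->
    (\int[spectral_measure A]_x (g x)%:E = (spec_mean A g)%:E)%E.
  move=> mg g0; have mg' : measurable_fun [set: R] (EFin \o g) by exact/measurable_EFinP.
  rewrite /spectral_measure ge0_integral_mscale//; last by move=> x _; rewrite lee_fin.
  rewrite ge0_integral_measure_sum//; last by move=> x _; rewrite lee_fin.
  rewrite (eq_bigr (fun j : 'I_n => (g (eigenvalues A)`_j)%:E)); last first.
    by move=> j _; rewrite integral_dirac// diracT mul1e.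
  by rewrite sumEFin.
rewrite integralE.
have -> : ((fun x => (f x)%:E)^\+ = fun x => (Num.max (f x) 0)%:E)%E.
  by apply/funext => x; rewrite funeposE EFin_max.
have -> : ((fun x => (f x)%:E)^\- = fun x => (Num.max (- f x) 0)%:E)%E.
  by apply/funext => x; rewrite funenegE EFin_max.
rewrite !pos; last 4 first.
- exact: measurable_funrneg.
- by move=> x; rewrite le_max lexx orbT.
- exact: measurable_funrpos.
- by move=> x; rewrite le_max lexx orbT.
rewrite -EFinB; congr (_%:E); rewrite /spec_mean -mulrBr -sumrB; congr (_ * _).
apply: eq_bigr => j _; move: (f _) => t.
by case: (lerP t 0) => t0; case: (lerP (- t) 0) => t1; lra.
Qed.

Lemma spec_mean_is_mean A : (0 < n)%N -> is_mean (spec_mean A).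
Proof.
move=> n0; split.
- by rewrite /spec_mean sumr_const card_ord mulVf// pnatr_eq0 -lt0n.
- by move=> f g _ _; rewrite /spec_mean big_split mulrDr.
- by move=> a f _; rewrite /spec_mean -mulr_sumr mulrCA.
- by move=> f _ f0; rewrite /spec_mean mulr_ge0// ?invr_ge0// sumr_ge0.
Qed.

End spectrum.

Section probability_mean.
Context (R : realType) (P : probability R R).

Definition prob_mean (f : R -> R) : R := fine (\int[P]_x (f x)%:E)%E.

Lemma bcont_measurable (f : R -> R) : bcont f -> measurable_fun [set: R] f.
Proof. by move=> [cf _]; exact: continuous_measurable_fun. Qed.

Lemma bcont_integrable (f : R -> R) : bcont f -> P.-integrable setT (EFin \o f).
Proof.
move=> bf; apply: measurable_bounded_integrable => //.
- by apply: le_lt_trans (probability_le1 P measurableT) _; rewrite ltry.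
- exact: bcont_measurable.
- case: bf => _ [M fM]; exists M; split; first exact: num_real.
  by move=> N MN x _ /=; apply: le_trans (fM x) (ltW MN).
Qed.

Lemma prob_meanE (f : R -> R) : bcont f ->
  (\int[P]_x (f x)%:E)%E = (prob_mean f)%:E.
Proof.
move=> bf; rewrite /prob_mean fineK//.
exact: integrable_fin_num (bcont_integrable bf).
Qed.

Lemma prob_mean_is_mean : is_mean prob_mean.
Proof.
split.
- by rewrite /prob_mean integral_cst// mul1e [X in fine X](@probability_setT _ _ _ P).
- move=> f g bf bg; apply: EFin_inj.
  rewrite EFinD -!prob_meanE//; last exact: bcontD.
  by rewrite -integralD_EFin//; [exact: bcont_integrable|exact: bcont_integrable].
- move=> a f bf; apply: EFin_inj; rewrite EFinM -!prob_meanE//; last exact: bcontZ.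
  by rewrite -integralZl//; exact: bcont_integrable.
- by move=> f _ f0; rewrite /prob_mean fine_ge0// integral_ge0// => x _; rewrite lee_fin.
Qed.

End probability_mean.

Section antiderivative.
Context (R : realType) (c : R).
Hypothesis c0 : 0 < c.

Let D (t : R) : R := cos t ^+ 2 + c * sin t ^+ 2.
Let W (t : R) : R := cos t ^+ 2 + c ^+ 2 * sin t ^+ 2.
(** [q t] is the tangent of atan(c tan t) - t, rewritten without the poles of tan at the
    endpoints. *)
Let q (t : R) : R := (c - 1) * (sin t * cos t) / D t.

Let pos_comb (e t : R) : 0 < e -> 0 < cos t ^+ 2 + e * sin t ^+ 2.
Proof.
have := cos2Dsin2 t; have := sqr_ge0 (sin t); have := sqr_ge0 (cos t).
by move: (cos t ^+ 2) (sin t ^+ 2) => a b a0 b0 ab e0; nra.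
Qed.

Let D0 t : 0 < D t. Proof. exact: pos_comb. Qed.
Let W0 t : 0 < W t. Proof. by apply: pos_comb; rewrite exprn_gt0. Qed.

Let dD (t : R) : is_derive t 1 D (2 * (c - 1) * (sin t * cos t)).
Proof.
have -> : D = (fun t => cos t * cos t + c * (sin t * sin t)).
  by apply/funext => u; rewrite /D !expr2.
have -> : 2 * (c - 1) * (sin t * cos t) =
    (cos t *: - sin t + cos t *: - sin t) + c *: (sin t *: cos t + sin t *: cos t).
  by rewrite /GRing.scale/=; ring.
exact: is_deriveD.
Qed.

Let dq (t : R) : is_derive t 1 q ((c - 1) * (cos t ^+ 2 - c * sin t ^+ 2) / D t ^+ 2).
Proof.
have dN : is_derive t 1 (fun t => (c - 1) * (sin t * cos t))
    ((c - 1) *: (sin t *: - sin t + cos t *: cos t)).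
  exact: is_deriveZ.
have dV : is_derive t 1 (fun t => (D t)^-1) (- (D t) ^- 2 *: (2 * (c - 1) * (sin t * cos t))).
  have Dt0 : D t != 0 by rewrite gt_eqF.
  exact: is_deriveV.
have dM := is_deriveM dN dV.
apply: is_derive_eq dM _.
have := cos2Dsin2 t; have := D0 t; rewrite /GRing.scale /=.
rewrite /D; move: (cos t) (sin t) => k s Dp ks.
have -> : k ^+ 2 - c * s ^+ 2 = (k ^+ 2 + s ^+ 2) * (k ^+ 2 - c * s ^+ 2) by rewrite ks mul1r.
by field; rewrite gt_eqF.
Qed.

(* [(c - 1) t + c atan q] is a smooth version of [c atan (c tan t) - t]. *)
Lemma is_derive_semicircle_primitive (t : R) :
  is_derive t 1 (fun t => (c - 1) * t + c * atan (q t))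
    ((c ^+ 2 - 1) * cos t ^+ 2 / (cos t ^+ 2 + c ^+ 2 * sin t ^+ 2)).
Proof.
have dA : is_derive t 1 (atan \o q)
    ((1 + q t ^+ 2)^-1 * ((c - 1) * (cos t ^+ 2 - c * sin t ^+ 2) / D t ^+ 2)).
  exact: is_derive1_comp.
have dS : is_derive t 1 (fun t => (c - 1) * t + c * (atan \o q) t)
    ((c - 1) *: 1 + c *: ((1 + q t ^+ 2)^-1 * ((c - 1) * (cos t ^+ 2 - c * sin t ^+ 2) / D t ^+ 2))).
  exact: is_deriveD.
apply: is_derive_eq dS _.
have qW : 1 + q t ^+ 2 = W t / D t ^+ 2.
  have Dt := D0 t; rewrite /q /W.
  have ks := cos2Dsin2 t.
  have -> : cos t ^+ 2 + c ^+ 2 * sin t ^+ 2 =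
    (cos t ^+ 2 + sin t ^+ 2) * (cos t ^+ 2 + c ^+ 2 * sin t ^+ 2) by rewrite ks mul1r.
  move: Dt; rewrite /D; move: (cos t) (sin t) => k s Dt.
  by field; rewrite gt_eqF.
rewrite qW; have := D0 t; have := W0 t; rewrite /GRing.scale /= /W /D.
move: (cos t) (sin t) => k s Wt Dt.
by field; rewrite exprMn ?(gt_eqF Wt) ?(gt_eqF Dt).
Qed.

End antiderivative.

Section semicircle_integrals.
Context (R : realType).
Local Notation mu := (@lebesgue_measure R).
Local Notation sc := (@semicircle R).
Local Notation pdf := (@semicircle_pdf R).
Local Notation h := (fun x : R => Num.sqrt (4 - x ^+ 2)).

Let sc_indic (E : set R) : measurable E ->
  (\int[sc]_x (\1_E x)%:E = \int[mu]_x ((\1_E x)%:E * (pdf x)%:E))%E.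
Proof.
move=> mE; rewrite integral_indic//= setIT /semicircle integral_mkcond.
apply: eq_integral => x _; rewrite patchE indicE.
by case: (x \in E); rewrite ?mul1e ?mul0e.
Qed.

Import HBNNSimple.

Let mpdf : measurable_fun [set: R] (EFin \o pdf).
Proof. by apply/measurable_EFinP; exact: measurable_semicircle_pdf. Qed.

Let sc_nnsfun (f : {nnsfun R >-> R}) :
  (\int[sc]_x (f x)%:E = \int[mu]_x ((f x)%:E * (pdf x)%:E))%E.
Proof.
under [LHS]eq_integral do rewrite fimfunE -fsumEFin//.
rewrite [LHS]ge0_integral_fsum//; last 2 first.
  - by move=> r; exact/measurable_EFinP/measurableT_comp.
  - by move=> n x _; rewrite EFinM nnfun_muleindic_ge0.
under [RHS]eq_integral.
  move=> x xD; rewrite fimfunE -fsumEFin// muleC ge0_mule_fsumr; last first.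
    by move=> r; rewrite EFinM nnfun_muleindic_ge0.
  over.
rewrite [RHS]ge0_integral_fsum//; last 2 first.
  - move=> r; apply: emeasurable_funM; first exact: mpdf.
    apply/measurable_EFinP; apply: measurable_funM; first exact: measurable_cst.
    apply: measurable_indic; exact: (measurable_sfunP f (measurable_set1 r)).
  - move=> n x _; rewrite EFinM mule_ge0//; last by rewrite nnfun_muleindic_ge0.
    by rewrite lee_fin semicircle_pdf_ge0.
apply: eq_fsbigr => r _; rewrite integralZl_indic_nnsfun//= sc_indic//.
have [r0|r0] := leP 0 r; last first.
  rewrite preimage_nnfun0//.
  rewrite indic0 integral0_eq ?mule0; last by move=> x _; rewrite /= mul0e.
  by rewrite integral0_eq// => x _; rewrite /= mulr0 mule0.
rewrite -ge0_integralZl//.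
- by apply: eq_integral => x _; rewrite -!EFinM; congr (_%:E); ring.
- apply: emeasurable_funM; last exact: mpdf.
  apply/measurable_EFinP; apply: measurable_indic; exact: (measurable_sfunP f (measurable_set1 r)).
- by move=> x _; rewrite mule_ge0// lee_fin semicircle_pdf_ge0.
Qed.

(** The density formula, passing from indicators to simple functions and then to [f] by monotone
    convergence. *)
Lemma integral_semicircle (f : R -> R) : measurable_fun [set: R] f ->
  (forall x, 0 <= f x) ->
  (\int[sc]_x (f x)%:E = \int[mu]_x ((f x)%:E * (pdf x)%:E))%E.
Proof.
move=> mf f0; have mf' : measurable_fun [set: R] (EFin \o f) by exact/measurable_EFinP.
pose f_ := nnsfun_approx measurableT mf'.
have cf x : (f_ n x)%:E @[n --> \oo] --> (f x)%:E.
  by apply: (cvg_nnsfun_approx measurableT mf') => // y _; rewrite lee_fin.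
have nd x : {homo (fun n => f_ n x) : m n / (m <= n)%N >-> m <= n}.
  by move=> m n mn; exact/lefP/nd_nnsfun_approx.
transitivity (limn (fun n => \int[sc]_x (f_ n x)%:E))%E.
  rewrite -monotone_convergence//=.
  - by apply: eq_integral => x _; apply/esym/cvg_lim => //; exact: cf.
  - by move=> n; exact/measurable_EFinP/measurable_funTS.
  - by move=> n x _; rewrite lee_fin.
  - by move=> x _ m n mn; rewrite lee_fin; exact: nd.
transitivity (limn (fun n => \int[mu]_x ((f_ n x)%:E * (pdf x)%:E)))%E.
  by congr (limn _); apply/funext => n; exact: sc_nnsfun.
rewrite -monotone_convergence//=.
- apply: eq_integral => x _; apply/cvg_lim => //.
  by apply: (cvgeM _ (cf x) (cvg_cst _)).
- move=> n; apply: emeasurable_funM; last exact: mpdf.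
  apply/measurable_EFinP; exact: (measurable_funPT (f_ n)).
- by move=> n x _; rewrite mule_ge0// lee_fin// semicircle_pdf_ge0.
- move=> x _ m n mn; rewrite -!EFinM lee_fin ler_wpM2r ?semicircle_pdf_ge0//.
  exact: nd.
Qed.

Lemma integral_semicircle_segment (f : R -> R) : measurable_fun [set: R] f ->
  (forall x, 0 <= f x) ->
  (\int[sc]_x (f x)%:E =
   \int[mu]_(x in `[(-2)%R, 2%R]) (f x * (h x / (2 * pi)))%:E)%E.
Proof.
move=> mf f0; rewrite integral_semicircle// [RHS]integral_mkcond.
apply: eq_integral => x _; rewrite patchE /semicircle_pdf indicE.
by case: ifPn => xI; rewrite ?mul0r ?mule0// mul1r -EFinM.
Qed.

Let ch : continuous h.
Proof.
move=> x; apply: (@continuous_comp _ _ _ (fun x : R => 4 - x ^+ 2)).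
  by apply: cvgB; [exact: cvg_cst | exact: exprn_continuous].
exact: sqrt_continuous.
Qed.

(** The reflection x -> -x exchanges the means of [1 + f] and [1 - f]; both functions are
    nonnegative, as the density formula requires. *)
Lemma sc_mean_odd (f : R -> R) : bcont f -> (forall x, `|f x| <= 1) ->
  (forall x, f (- x) = - f x) -> prob_mean sc f = 0.
Proof.
move=> bf f1 fo; have msc := prob_mean_is_mean sc.
have bp : bcont (fun x => 1 + f x) by apply: bcontD => //; exact: bcont_cst.
have bm : bcont (fun x => 1 - f x) by apply: bcontB => //; exact: bcont_cst.
have E : prob_mean sc (fun x => 1 + f x) = prob_mean sc (fun x => 1 - f x).
  apply: EFin_inj; rewrite -!prob_meanE// !integral_semicircle_segment; last 4 first.
  - exact: bcont_measurable.
  - by move=> x; have := f1 x; rewrite ler_norml => /andP[]; lra.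
  - exact: bcont_measurable.
  - by move=> x; have := f1 x; rewrite ler_norml => /andP[]; lra.
  have := @integration_by_substitution_oppr R
    (fun x => (1 + f x) * (h x / (2 * pi))) (-2) 2.
  rewrite opprK => ->.
  - by apply: eq_integral => x _ /=; rewrite fo sqrrN.
  - by lra.
  - apply: continuous_subspaceT => x; apply: cvgM; first by case: bp => c _; exact: c.
    by apply: cvgM; [exact: ch|exact: cvg_cst].
case: (msc) => _ LD _ _.
have : prob_mean sc (fun=> 1) + prob_mean sc f = prob_mean sc (fun=> 1) - prob_mean sc f.
  by rewrite -LD ?E ?meanB//; exact: bcont_cst.
by move=> /addrI/eqP; rewrite -subr_eq0 opprK -mulr2n mulrn_eq0 => /eqP.
Qed.

Lemma sc_mean_support (f : R -> R) : bcont f -> (forall x, `|x| <= 2 -> f x = 0) ->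
  prob_mean sc f = 0.
Proof.
move=> bf f2; have msc := prob_mean_is_mean sc.
have [cf [M fM]] := bf.
have ba : bcont (fun x => `|f x|).
  split; first by move=> x; apply: cvg_norm; exact: cf.
  by exists M => x; rewrite normr_id.
have A0 : prob_mean sc (fun x => `|f x|) = 0.
  apply: EFin_inj; rewrite -prob_meanE// integral_semicircle_segment//; last exact: bcont_measurable.
  rewrite integral0_eq// => x; rewrite /= in_itv /= -ler_norml => xI.
  by rewrite f2// normr0 mul0r.
have le1 : prob_mean sc f <= 0.
  by rewrite -[leRHS]A0; apply: mean_le => // x; exact: ler_norm.
have ge1 : - prob_mean sc (fun x => `|f x|) <= prob_mean sc f.
  case: (msc) => _ _ LZ _; rewrite -[leLHS]mulN1r -LZ//.
  apply: mean_le => //; first exact: bcontZ.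
  by move=> x; rewrite mulN1r lerNl -normrN ler_norm.
by apply/le_anti; rewrite le1 -[leLHS]oppr0 -[X in - X]A0 ge1.
Qed.

(** The substitution x = 2 sin t turns the integrand into the derivative computed in the previous
    section. Times [y], this is the imaginary part of the semicircular Stieltjes transform at i
    y. *)
Lemma sc_mean_cauchy (y : R) : 0 < y ->
  prob_mean sc (fun x => (x ^+ 2 + y ^+ 2)^-1) =
  (Num.sqrt (y ^+ 2 + 4) - y) / (2 * y).
Proof.
move=> y0; have y20 : 0 < y ^+ 2 by rewrite exprn_gt0.
have den x : 0 < x ^+ 2 + y ^+ 2 :> R by have := sqr_ge0 x; lra.
(* Chosen so that 4 sin^2 + y^2 = y^2 (cos^2 + c^2 sin^2). *)
pose c : R := Num.sqrt (y ^+ 2 + 4) / y.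
have s0 : 0 < Num.sqrt (y ^+ 2 + 4) by rewrite sqrtr_gt0; lra.
have c0 : 0 < c by rewrite divr_gt0.
have c2 : c ^+ 2 * y ^+ 2 = y ^+ 2 + 4.
  by rewrite -exprMn divfK ?gt_eqF// sqr_sqrtr//; lra.
have cE : c = Num.sqrt (y ^+ 2 + 4) / y by [].
clearbody c.
have cinv x : continuous (fun x : R => (x ^+ 2 + y ^+ 2)^-1).
  move=> {}x; apply: cvgV; first by rewrite gt_eqF.
  by apply: cvgD; [exact: exprn_continuous|exact: cvg_cst].
have bf : bcont (fun x : R => (x ^+ 2 + y ^+ 2)^-1).
  split; first exact: cinv.
  exists (y ^+ 2)^-1 => x; rewrite ger0_norm ?invr_ge0 ?(ltW (den x))//.
  by rewrite lef_pV2 ?posrE// lerDr sqr_ge0.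
apply: EFin_inj; rewrite -prob_meanE// integral_semicircle_segment; last 2 first.
- exact: bcont_measurable.
- by move=> x; rewrite invr_ge0 ltW.
pose G (x : R) := (x ^+ 2 + y ^+ 2)^-1 * (h x / (2 * pi)).
pose F (t : R) := 2 * sin t.
have dF (x : R) : is_derive x 1 F (2 * cos x).
  have -> : 2 * cos x = 2 *: cos x by [].
  exact: is_deriveZ.
have F'E : (derive1 F) = (fun t => 2 * cos t).
  by apply/funext => t; rewrite derive1E derive_val.
have F2 : F (pi / 2) = 2 by rewrite /F sin_pihalf mulr1.
have FN2 : F (- (pi / 2)) = -2 by rewrite /F sinN sin_pihalf mulrN1.
have cF : continuous F.
  by move=> x; apply: cvgM; [exact: cvg_cst | exact: continuous_sin].
have cF' : continuous (derive1 F).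
  by rewrite F'E => x; apply: cvgM; [exact: cvg_cst | exact: continuous_cos].
have pi20 : - (pi / 2) < pi / 2 :> R.
  by have := pi_gt0 R; set p := (pi : R) => p0; lra.
transitivity (\int[mu]_(x in `[F (- (pi / 2))%R, F (pi / 2)%R]) (G x)%:E)%E.
  by rewrite F2 FN2.
rewrite integration_by_substitution_increasing; last 7 first.
- exact: ltW.
- by move=> u v uI vI uv; rewrite ltr_pM2l// ltr_sin.
- by move=> x _; exact: cF'.
- by apply/cvg_ex; exists ((derive1 F) (- (pi / 2))); apply: cvg_at_right_filter; exact: cF'.
- by apply/cvg_ex; exists ((derive1 F) (pi / 2)); apply: cvg_at_left_filter; exact: cF'.
- split.
  + by move=> x _; exact: ex_derive.
  + by apply: cvg_at_right_filter; exact: cF.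
  + by apply: cvg_at_left_filter; exact: cF.
- apply: continuous_subspaceT => x; apply: cvgM; first exact: cinv.
  by apply: cvgM; [exact: ch|exact: cvg_cst].
pose q (t : R) : R := (c - 1) * (sin t * cos t) / (cos t ^+ 2 + c * sin t ^+ 2).
pose K (t : R) : R := (2 * pi)^-1 * ((c - 1) * t + c * atan (q t)).
pose g (t : R) : R := (2 * pi)^-1 *
  ((c ^+ 2 - 1) * cos t ^+ 2 / (cos t ^+ 2 + c ^+ 2 * sin t ^+ 2)).
have dK (t : R) : is_derive t 1 K (g t).
  have dA := is_derive_semicircle_primitive c0 t.
  exact: is_deriveZ.
have W0 (t : R) : 0 < cos t ^+ 2 + c ^+ 2 * sin t ^+ 2.
  have : 0 < c ^+ 2 by rewrite exprn_gt0.
  have := cos2Dsin2 t; have := sqr_ge0 (sin t); have := sqr_ge0 (cos t).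
  by move: (cos t ^+ 2) (sin t ^+ 2) (c ^+ 2) => a b e a0 b0 ab e0; nra.
have cg : continuous g.
  have ccos (t : R) : (fun t : R => cos t ^+ 2) x @[x --> t] --> cos t ^+ 2.
    apply: (@continuous_comp _ _ _ _ (fun y : R => y ^+ 2)).
      exact: continuous_cos.
    exact: exprn_continuous.
  have csin (t : R) : (fun t : R => sin t ^+ 2) x @[x --> t] --> sin t ^+ 2.
    apply: (@continuous_comp _ _ _ _ (fun y : R => y ^+ 2)).
      exact: continuous_sin.
    exact: exprn_continuous.
  move=> t; apply: cvgM; first exact: cvg_cst.
  apply: cvgM; first by apply: cvgM; [exact: cvg_cst|exact: ccos].
  apply: cvgV; first by rewrite gt_eqF.
  by apply: cvgD; [exact: ccos|apply: cvgM; [exact: cvg_cst|exact: csin]].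
have cK : continuous K.
  by move=> x; apply: differentiable_continuous; apply/derivable1_diffP; exact: ex_derive.
have pi0 : (pi : R) != 0 by rewrite gt_eqF// pi_gt0.
transitivity (\int[mu]_(x in `[(- (pi / 2))%R, (pi / 2)%R]) (g x)%:E)%E.
  apply: eq_integral => t; rewrite inE/= in_itv/= => tI; congr (_ %:E).
  rewrite F'E -[LHS]/((F t ^+ 2 + y ^+ 2)^-1 * (Num.sqrt (4 - F t ^+ 2) / (2 * pi)) * (2 * cos t)).
  have -> : 4 - F t ^+ 2 = (2 * cos t) ^+ 2.
    by rewrite /F !exprMn cos2sin2; ring.
  rewrite sqrtr_sqr ger0_norm ?mulr_ge0 ?cos_ge0_pihalf//.
  have -> : F t ^+ 2 + y ^+ 2 = y ^+ 2 * (cos t ^+ 2 + c ^+ 2 * sin t ^+ 2).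
    rewrite mulrDr mulrA [y ^+ 2 * c ^+ 2]mulrC c2 /F exprMn.
    by rewrite cos2sin2; ring.
  have -> : g t = (2 * pi)^-1 * (c ^+ 2 * y ^+ 2 - y ^+ 2) * cos t ^+ 2 /
      (y ^+ 2 * (cos t ^+ 2 + c ^+ 2 * sin t ^+ 2)).
    rewrite /g; have := W0 t; move: (cos t ^+ 2) (sin t ^+ 2) => a b ab.
    by move: (pi : R) pi0 => pp pp0; field; rewrite ?(gt_eqF ab) ?(gt_eqF y0) ?pp0.
  have := W0 t; rewrite c2; move: (_ + c ^+ 2 * _) => w w0.
  by move: (pi : R) pi0 => pp pp0; field; rewrite ?(gt_eqF w0) ?(gt_eqF y0) ?pp0.
rewrite (@continuous_FTC2 _ g K)//; last 3 first.
- exact: continuous_subspaceT.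
- split.
  + by move=> x _; exact: ex_derive.
  + by apply: cvg_at_right_filter; exact: cK.
  + by apply: cvg_at_left_filter; exact: cK.
- by move=> x _; rewrite derive1E derive_val.
(* The arctangent drops out at both endpoints, where the cosine vanishes, leaving (c - 1) / 2. *)
have qE (t : R) : cos t = 0 -> q t = 0 by move=> ct; rewrite /q ct !mulr0 mul0r.
rewrite /K !qE ?cosN ?cos_pihalf// atan0 !mulr0 !addr0 -EFinB; congr (_ %:E).
rewrite cE.
by move: (pi : R) pi0 => pp pp0; field; rewrite ?pp0 ?(gt_eqF y0).
Qed.

End semicircle_integrals.

(** * Discretization of independent copies *)

Section finite_model.
Context (R : realType) (d : measure_display) (T : measurableType d) (P : probability T R).
Context (d0 : measure_display) (T0 : measurableType d0) (P0 : probability T0 R).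
Context (X : {RV P0 >-> R}) (X_ : nat -> {RV P >-> R}).
Hypothesis copies : forall k : nat, (0 < k)%N -> same_distribution (X_ k) X.
Hypothesis indep : mutually_independent [set k : nat | (0 < k)%N] X_.
Context (V : finType) (cls : R -> V) (val : V -> R).
Hypothesis mcls : forall a, measurable (cls @^-1` [set a]).

Definition law (a : V) : R := fine (P0 (X @^-1` (cls @^-1` [set a]))).

Lemma lawE a : (law a)%:E = P0 (X @^-1` (cls @^-1` [set a])).
Proof.
rewrite /law fineK//; apply: fin_num_measure.
by rewrite -[X in measurable X]setTI; exact: measurable_funP.
Qed.

Lemma law_ge0 a : 0 <= law a. Proof. by rewrite /law fine_ge0. Qed.

Lemma measurable_RV_preim dd (TT : measurableType dd) (PP : probability TT R)
  (Y : {RV PP >-> R}) (B : set R) : measurable B -> measurable (Y @^-1` B).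
Proof. by move=> mB; rewrite -[X in measurable X]setTI; exact: measurable_funP. Qed.

Lemma fin_partition dd (TT : measurableType dd) (PP : probability TT R)
    (A : set TT) (F : V -> set TT) :
  (forall a, measurable (F a)) -> (forall a b w, F a w -> F b w -> a = b) ->
  (forall w, A w <-> exists a, F a w) ->
  measurable A /\ PP A = (\sum_a PP (F a))%E.
Proof.
move=> mF dF AF.
have AE : A = \bigcup_(a in [set: V]) F a.
  apply/seteqP; split => w; first by move=> /AF[a Fa]; exists a.
  by move=> [a _ Fa]; apply/AF; exists a.
split; first by rewrite AE; apply: fin_bigcup_measurable => //; exact: finite_finset.
rewrite AE measure_fin_bigcup//; last 2 first.
- exact: finite_finset.
- by move=> a b _ _ [w [Fa Fb]]; exact: dF Fa Fb.
rewrite [RHS](fsbig_seq _ _ (index_enum_uniq V)); congr (\big[_/_]_(_ \in _) _).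
by apply/seteqP; split=> a //= _; rewrite mem_index_enum.
Qed.

Lemma law_sum : \sum_a law a = 1.
Proof.
apply: EFin_inj; rewrite -sumEFin.
under eq_bigr do rewrite lawE.
have [] := @fin_partition _ _ P0 setT (fun a => X @^-1` (cls @^-1` [set a])).
- by move=> a; exact: measurable_RV_preim.
- by move=> a b w /= -> ->.
- by move=> w; split => // _; exists (cls (X w)).
by move=> _ <-; rewrite probability_setT.
Qed.

Definition cyl (J : {fset nat}) (B : nat -> set R) : set T :=
  \bigcap_(j in [set` J]) X_ j @^-1` B j.

Definition sampled (s : seq nat) (x0 : nat -> R) (w : T) : nat -> R :=
  fun k => if k \in s then val (cls (X_ k w)) else x0 k.

Lemma cyl_measurable J B : (forall j, measurable (B j)) -> measurable (cyl J B).
Proof.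
move=> mB; apply: fin_bigcap_measurable; first exact: finite_fset.
by move=> j _; exact: measurable_RV_preim.
Qed.

Lemma cyl_prob (J : {fset nat}) B : (forall j, j \in J -> (0 < j)%N) ->
  (forall j, measurable (B j)) ->
  P (cyl J B) = (\prod_(j <- J) P (X_ j @^-1` B j))%E.
Proof. by move=> J0 mB; apply: indep. Qed.

(** The bridge from independence to the finite expectation [Ex]. Integrating out [k] partitions the
    event by the class of [X_ k], adding one constraint to the cylinder; the statement therefore
    carries an arbitrary cylinder on indices outside [s]. *)
Lemma sampled_law s (b : (nat -> R) -> bool) (J : {fset nat}) B x0 :
  uniq s -> (forall k, k \in s -> (0 < k)%N) ->
  (forall j, j \in J -> (0 < j)%N && (j \notin s)) -> (forall j, measurable (B j)) ->
  measurable (cyl J B `&` [set w | b (sampled s x0 w)]) /\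
  P (cyl J B `&` [set w | b (sampled s x0 w)]) =
  (fine (P (cyl J B)) * Ex law val s (fun x => (b x)%:R) x0)%:E.
Proof.
elim: s b J B => [|k s IH] b J B /=.
  move=> _ _ J0 mB; have mC := cyl_measurable J mB.
  have -> : [set w | b (sampled [::] x0 w)] = if b x0 then setT else set0.
    apply/seteqP; split => w /=.
      by rewrite (_ : sampled _ _ _ = x0)// => ->.
    by case: ifP => // bx _; rewrite (_ : sampled _ _ _ = x0).
  case: (b x0); rewrite ?setIT ?setI0; split => //.
    by rewrite mulr1 fineK// fin_num_measure.
  by rewrite mulr0 measure0.
move=> /andP[ks us] s0 J0 mB.
have k0 : (0 < k)%N by apply: s0; rewrite mem_head.
have kJ : k \notin J by apply/negP => /J0; rewrite mem_head andbF.
pose Ba a j := if j == k then cls @^-1` [set a] else B j.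
have mBa a j : measurable (Ba a j) by rewrite /Ba; case: ifP.
have Jp j : j \in J -> (0 < j)%N by move=> /J0/andP[].
pose bb a (x : nat -> R) := b (upd x k (val a)).
have cE a : cyl (k |` J)%fset (Ba a) = X_ k @^-1` (cls @^-1` [set a]) `&` cyl J B.
  apply/seteqP; split => w.
    move=> H; split.
      by have := H k; rewrite /Ba eqxx; apply; rewrite /= fset1U1.
    move=> j /= jJ; have := H j; rewrite /Ba.
    case: eqP => [jk|_]; first by rewrite -jk jJ in kJ.
    by apply; rewrite /= fset1Ur.
  move=> [Hk HJ] j /=; rewrite in_fset1U => /predU1P[->|jJ].
    by rewrite /Ba eqxx.
  by rewrite /Ba; case: eqP => [->//|_]; exact: HJ.
have cP a : fine (P (cyl (k |` J)%fset (Ba a))) = law a * fine (P (cyl J B)).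
  rewrite cyl_prob//; last by move=> j; rewrite in_fset1U => /predU1P[->//|/Jp].
  rewrite big_fsetU1//= {1}/Ba eqxx cyl_prob//.
  have -> : P (X_ k @^-1` (cls @^-1` [set a])) = (law a)%:E.
    by rewrite lawE; exact: copies.
  rewrite (eq_big_seq (fun j => P (X_ j @^-1` B j))); last first.
    by move=> j jJ; rewrite /Ba; case: eqP => // jk; rewrite -jk jJ in kJ.
  rewrite -cyl_prob// -[P (cyl J B)]fineK ?fin_num_measure//; last exact: cyl_measurable.
have IHa a := IH (bb a) (k |` J)%fset (Ba a) us.
have s0' l : l \in s -> (0 < l)%N by move=> ls; apply: s0; rewrite in_cons ls orbT.
have J0' j : j \in (k |` J)%fset -> (0 < j)%N && (j \notin s).
  rewrite in_fset1U => /predU1P[->|/J0/andP[-> ]]; first by rewrite k0.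
  by rewrite in_cons negb_or => /andP[].
pose F a := cyl (k |` J)%fset (Ba a) `&` [set w | bb a (sampled s x0 w)].
have updE w : upd (sampled s x0 w) k (val (cls (X_ k w))) = sampled (k :: s) x0 w.
  apply/funext => j; rewrite /upd /sampled in_cons.
  by case: eqP => [->|].
have [] := @fin_partition _ _ P (cyl J B `&` [set w | b (sampled (k :: s) x0 w)]) F.
- by move=> a; have [] := IHa a s0' (J0' ) (mBa a).
- move=> a a' w [+ _] [+ _]; rewrite !cE => -[/= -> _] [/= -> _] //.
- move=> w; split.
    move=> [wC wb]; exists (cls (X_ k w)); split; first by rewrite cE.
    by rewrite /= /bb updE.
  by move=> [a []]; rewrite cE => -[/= ka wC] wb; split => //=; rewrite -updE ka.
move=> mA PA; split => //; rewrite PA.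
rewrite (eq_bigr (fun a => (fine (P (cyl J B)) * (law a * Ex law val s (fun x => (bb a x)%:R) x0))%:E)).
  rewrite sumEFin -mulr_sumr; congr (_ * _)%:E.
  rewrite /avg (Ex_sum val law_sum); apply: eq_bigr => a _.
  by rewrite ExZ.
move=> a _; have [_ ->] := IHa a s0' J0' (mBa a).
by rewrite cP -mulrA mulrCA.
Qed.

Lemma sampled_prob s (b : (nat -> R) -> bool) x0 :
  uniq s -> (forall k, k \in s -> (0 < k)%N) ->
  measurable [set w | b (sampled s x0 w)] /\
  P [set w | b (sampled s x0 w)] = (Ex law val s (fun x => (b x)%:R) x0)%:E.
Proof.
move=> us s0.
have c0 : cyl fset0 (fun=> setT) = setT.
  by apply/seteqP; split => // w _ j /=; rewrite in_fset0.
have [] := @sampled_law s b fset0 (fun=> setT) x0 us s0 _ _ => //.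
rewrite c0 setTI probability_setT /= mul1r => mb Pb; by split.
Qed.

(** Markov's inequality in the form used below: moment bounds computed in the finite model become
    bounds on probabilities of events of the original space. *)
Lemma sampled_markov s (b : (nat -> R) -> bool) (Phi : (nat -> R) -> R) x0 :
  uniq s -> (forall k, k \in s -> (0 < k)%N) ->
  (forall x, (b x)%:R <= Phi x) ->
  (P [set w | b (sampled s x0 w)] <= (Ex law val s Phi x0)%:E)%E.
Proof.
move=> us s0 bPhi; have [_ ->] := sampled_prob b x0 us s0.
by rewrite lee_fin; apply: Ex_le => //; exact: law_ge0.
Qed.

Lemma law_expectation (f : V -> R) :
  (\int[P0]_w (f (cls (X w)))%:E)%E = (\sum_a law a * f a)%:E.
Proof.
pose A a := X @^-1` (cls @^-1` [set a]).
have mA a : measurable (A a) by exact: measurable_RV_preim.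
transitivity (\int[P0]_w \sum_a ((f a)%:E * (\1_(A a) w)%:E))%E.
  apply: eq_integral => w _; rewrite (bigD1 (cls (X w)))//= big1 => [|a ne].
    by rewrite adde0 indicE mem_set// mule1.
  rewrite indicE memNset ?mule0// => /= e.
  by rewrite e eqxx in ne.
rewrite integral_sum//; last first.
  by move=> a; apply: integrableZl => //; exact: integrable_indic.
rewrite -sumEFin; apply: eq_bigr => a _.
rewrite integralZl//; last exact: integrable_indic.
by rewrite integral_indic// setIT EFinM muleC lawE.
Qed.

End finite_model.

Section borel_cantelli.
Context (R : realType) (d : measure_display) (T : measurableType d) (P : probability T R).

Lemma ae_eventually (B : nat -> set T) (u : nat -> R) (S : R) :
  (forall n, measurable (B n)) -> (forall n, (P (B n) <= (u n)%:E)%E) ->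
  (forall N, \sum_(n < N) u n <= S) ->
  {ae P, forall w, exists n0, forall n, (n0 <= n)%N -> ~ B n w}.
Proof.
move=> mB PB uS; exists (lim_sup_set B); split.
- apply: bigcap_measurable => // k _.
  by apply: bigcup_measurable => j _; exact: mB.
- apply: lim_sup_set_cvg0 => //.
  apply: (@le_lt_trans _ _ S%:E); last exact: ltry.
  apply: lime_le; first by apply: is_cvg_nneseries => n _ _; exact: measure_ge0.
  apply: nearW => N; rewrite big_mkord.
  apply: (@le_trans _ _ (\sum_(n < N) (u n)%:E)%E).
    by apply: lee_sum => n _; exact: PB.
  by rewrite sumEFin lee_fin.
- move=> w /= H n0 _; apply: contrapT => Hn; apply: H; exists n0 => n n0n Bn.
  by apply: Hn; exists n.
Qed.

End borel_cantelli.

(** * Truncation at K and rounding to a grid of mesh dl *)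

Section grid.
Context (R : realType) (K dl : R).
Hypotheses (K_gt0 : 0 < K) (dl_gt0 : 0 < dl).

Definition grid_size : nat := Num.truncn (2 * K / dl).

(* [None] collects the values beyond [K], which are replaced by [0]. *)
Definition grid_cls (x : R) : option 'I_grid_size.+1 :=
  if `|x| <= K then Some (inord (Num.truncn ((x + K) / dl))) else None.

Definition grid_val (a : option 'I_grid_size.+1) : R :=
  if a is Some i then (i : nat)%:R * dl - K else 0.

Lemma grid_val_le a : `|grid_val a| <= K.
Proof.
case: a => [i|] /=; last by rewrite normr0 ltW.
have : (i : nat)%:R * dl <= 2 * K.
  rewrite -ler_pdivlMr//; apply: (@le_trans _ _ grid_size%:R).
    by rewrite ler_nat -ltnS.
  by rewrite truncn_le divr_ge0 ?mulr_ge0 ?ltW.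
have : 0 <= (i : nat)%:R * dl by rewrite mulr_ge0// ltW.
move: (_ * dl) => z z0 zK; rewrite ler_norml; apply/andP; split; lra.
Qed.

Lemma grid_truncn x : `|x| <= K ->
  grid_cls x = Some (inord (Num.truncn ((x + K) / dl))) /\
  (Num.truncn ((x + K) / dl) < grid_size.+1)%N /\
  (Num.truncn ((x + K) / dl))%:R <= (x + K) / dl < (Num.truncn ((x + K) / dl)).+1%:R.
Proof.
move=> xK; split; first by rewrite /grid_cls xK.
have xK0 : 0 <= (x + K) / dl.
  by apply: divr_ge0; [move: xK; rewrite ler_norml => /andP[]; lra|exact: ltW].
split; last exact: truncn_itv.
rewrite ltnS; apply: le_truncn; rewrite ler_pM2r ?invr_gt0//.
by move: xK; rewrite ler_norml => /andP[_]; lra.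
Qed.

Lemma grid_val_near x : `|x| <= K -> `|x - grid_val (grid_cls x)| <= dl.
Proof.
move=> /grid_truncn[-> [tn]]; rewrite /grid_val inordK// => /andP[].
move: (Num.truncn _) => t; rewrite ler_pdivlMr// ltr_pdivrMr// -natr1 mulrDl mul1r.
move: (_%:R * dl) => z z1 z2; rewrite ler_norml; apply/andP; split; lra.
Qed.

Lemma grid_val_far x : K < `|x| -> grid_val (grid_cls x) = 0.
Proof. by rewrite ltNge /grid_cls => /negbTE ->. Qed.

Lemma grid_cls_measurable a : measurable (grid_cls @^-1` [set a]).
Proof.
case: a => [i|]; last first.
  have -> : grid_cls @^-1` [set None] = ~` `[- K, K].
    apply/seteqP; split => x /=; rewrite /grid_cls in_itv/= -ler_norml.
      by case: ifP.
    by move/negP/negbTE ->.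
  exact: measurableC.
have -> : grid_cls @^-1` [set Some i] =
    `[- K, K] `&` `[(i : nat)%:R * dl - K, (i : nat).+1%:R * dl - K[.
  apply/seteqP; split => x /=; rewrite !in_itv/= -ler_norml.
    rewrite {1}/grid_cls; case: ifP => // xK [iE].
    have [_ [tn /andP[t1 t2]]] := grid_truncn xK.
    have iE' : Num.truncn ((x + K) / dl) = i by rewrite -iE inordK.
    move: t1 t2; rewrite iE' ler_pdivlMr// ltr_pdivrMr// => t1 t2.
    by split => //; rewrite lerBlDr t1 ltrBrDr t2.
  move=> [xK /andP[t1 t2]]; have [-> _] := grid_truncn xK.
  congr Some; apply: val_inj; rewrite /=.
  have -> : Num.truncn ((x + K) / dl) = i.
    by apply: truncn_def; rewrite ler_pdivlMr// ltr_pdivrMr// -lerBlDr t1 -ltrBrDr.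
  by rewrite inordK.
exact: measurableI.
Qed.

End grid.

Section finite_valued.
Context (R : realType) (V : finType) (cls : R -> V).
Hypothesis mcls : forall a, measurable (cls @^-1` [set a]).

Lemma finite_valued_measurable (f : V -> R) :
  measurable_fun [set: R] (fun x => f (cls x)).
Proof.
have -> : (fun x => f (cls x)) = (fun x => \sum_a f a * \1_(cls @^-1` [set a]) x).
  apply/funext => x; rewrite (bigD1 (cls x))//= big1 => [|a ne].
    by rewrite addr0 indicE mem_set// mulr1.
  by rewrite indicE memNset ?mulr0// => /= e; rewrite e eqxx in ne.
by apply: measurable_sum => a; apply: measurable_funM.
Qed.

End finite_valued.

(** * Moments of X and of its discretization *)

Section moments.
Context (R : realType) (d0 : measure_display) (T0 : measurableType d0).
Context (P0 : probability T0 R) (X : {RV P0 >-> R}) (eps : R).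
Hypotheses (eps_gt0 : 0 < eps)
  (momX : ('E_P0[fun w => (`|X w| `^ (2 + eps))%R] < +oo)%E).

Definition abs_moment : R := fine ('E_P0[fun w => (`|X w| `^ (2 + eps))%R])%E.

Definition abs_pow (x : R) : R := `|x| `^ (2 + eps).

Definition expect (f : R -> R) : \bar R := (\int[P0]_w (f (X w))%:E)%E.

Lemma expect_measurable (f : R -> R) : measurable_fun [set: R] f ->
  measurable_fun [set: T0] (fun w => (f (X w))%:E).
Proof. by move=> mf; apply/measurable_EFinP; apply: measurableT_comp. Qed.

Lemma expect_le (f g : R -> R) : measurable_fun [set: R] f -> measurable_fun [set: R] g ->
  (forall x, 0 <= f x) -> (forall x, f x <= g x) -> (expect f <= expect g)%E.
Proof.
move=> mf mg f0 fg; apply: ge0_le_integral => //.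
- by move=> w _; rewrite lee_fin.
- exact: expect_measurable.
- exact: expect_measurable.
- by move=> w _; rewrite lee_fin.
Qed.

Lemma expect_D (f g : R -> R) : measurable_fun [set: R] f -> measurable_fun [set: R] g ->
  (forall x, 0 <= f x) -> (forall x, 0 <= g x) ->
  expect (fun x => f x + g x) = (expect f + expect g)%E.
Proof.
move=> mf mg f0 g0; rewrite /expect -ge0_integralD//.
- by move=> w _; rewrite lee_fin.
- exact: expect_measurable.
- by move=> w _; rewrite lee_fin.
- exact: expect_measurable.
Qed.

Lemma expect_Z (c : R) (f : R -> R) : measurable_fun [set: R] f -> 0 <= c ->
  (forall x, 0 <= f x) -> expect (fun x => c * f x) = (c%:E * expect f)%E.
Proof.
move=> mf c0 f0; rewrite /expect -ge0_integralZl_EFin//.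
  by move=> w _; rewrite lee_fin.
exact: expect_measurable.
Qed.

Lemma expect_cst (c : R) : expect (fun=> c) = c%:E.
Proof. by rewrite /expect integral_cst// [X in (_ * X)%E](@probability_setT _ _ _ P0) mule1. Qed.

Lemma abs_pow_ge0 x : 0 <= abs_pow x. Proof. exact: powR_ge0. Qed.

Lemma abs_pow_measurable : measurable_fun [set: R] abs_pow.
Proof.
apply: (@measurableT_comp _ _ _ _ _ _ (fun x : R => x `^ (2 + eps))).
  exact: measurable_powR.
exact: normr_measurable.
Qed.

Lemma expect_abs_pow : expect abs_pow = abs_moment%:E.
Proof.
rewrite /abs_moment fineK; first by rewrite unlock.
rewrite ge0_fin_numE// unlock.
by apply: integral_ge0 => w _; rewrite lee_fin powR_ge0.
Qed.

Lemma abs_moment_ge0 : 0 <= abs_moment.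
Proof.
by rewrite -lee_fin -expect_abs_pow; apply: integral_ge0 => w _; rewrite lee_fin abs_pow_ge0.
Qed.

Lemma sqr_le_abs_pow (K x : R) : 0 < K -> K <= `|x| -> x ^+ 2 <= K `^ (- eps) * abs_pow x.
Proof.
move=> K0 Kx; have x0 : 0 < `|x| by apply: lt_le_trans Kx.
rewrite /abs_pow powRD ?(gt_eqF x0) ?implybT// powR_mulrn ?normr_ge0// real_normK ?num_real//.
rewrite mulrCA ler_peMr ?sqr_ge0// powRN mulrC ler_pdivlMr ?powR_gt0// mul1r.
by apply: ge0_ler_powR => //; rewrite ?nnegrE ?ltW.
Qed.

Lemma sqr_le_1_abs_pow x : x ^+ 2 <= 1 + abs_pow x.
Proof.
have [x1|x1] := leP 1 `|x|.
  apply: le_trans (sqr_le_abs_pow ltr01 x1) _.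
  by rewrite powR1 mul1r lerDr.
rewrite -real_normK ?num_real//; apply: (@le_trans _ _ 1); last by rewrite lerDl abs_pow_ge0.
by rewrite expr_le1// ltW.
Qed.

Lemma X_sqr_integrable : P0.-integrable setT (EFin \o (fun w => X w ^+ 2)).
Proof.
apply/integrableP; split.
  apply: (@expect_measurable (fun x => x ^+ 2)); exact: measurable_funX.
have /= := @expect_le (fun x => x ^+ 2) (fun x => 1 + abs_pow x).
rewrite expect_D//; last exact: abs_pow_ge0; last exact: abs_pow_measurable.
rewrite expect_cst expect_abs_pow => H; apply: le_lt_trans (ltry (1 + abs_moment)).
rewrite EFinD; apply: le_trans (H _ _ _ _) => //.
- apply: le_of_eq; apply: eq_integral => w _ /=.
  by rewrite ger0_norm ?sqr_ge0.
- by apply: measurable_funD => //; exact: abs_pow_measurable.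
- by move=> x; exact: sqr_ge0.
- exact: sqr_le_1_abs_pow.
Qed.

Lemma X_integrable : P0.-integrable setT (EFin \o X).
Proof.
apply: (@le_integrable _ _ _ _ _ _ _ (fun w => (1 + X w ^+ 2)%:E)) => //.
- exact/measurable_EFinP.
- move=> w _ /=; rewrite lee_fin [leRHS]ger0_norm ?addr_ge0 ?sqr_ge0//.
  rewrite -[X in _ + X]real_normK ?num_real//.
  move: (normr_ge0 (X w)); move: `|X w| => z z0; have := sqr_ge0 (z - 1).
  by rewrite expr2; nra.
- under eq_fun do rewrite EFinD.
  apply: integrableD => //; last exact: X_sqr_integrable.
  apply/integrableP; split; first exact: measurable_cst.
  by rewrite integral_cst// [X in (_ * X)%E](@probability_setT _ _ _ P0) mule1 ltry.
Qed.

Hypothesis varX : 'V_P0[X] = 1%E.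

Lemma second_moment_shift (m : R) :
  expect (fun x => (x - m) ^+ 2) = (1 + (fine 'E_P0[X] - m) ^+ 2)%:E.
Proof.
have iX := X_integrable; have iX2 := X_sqr_integrable.
set mu := fine _.
have EX : (\int[P0]_w (X w)%:E = mu%:E)%E.
  by rewrite /mu unlock fineK// integrable_fin_num.
have icst (c : R) : P0.-integrable setT (EFin \o (fun=> c)).
  apply/integrableP; split; first exact: measurable_cst.
  by rewrite integral_cst// [X in (_ * X)%E](@probability_setT _ _ _ P0) mule1 ltry.
have key (a : R) : expect (fun x => (x - a) ^+ 2) =
    (\int[P0]_w (X w ^+ 2)%:E + (a ^+ 2 - 2 * a * mu)%:E)%E.
  have -> : (a ^+ 2 - 2 * a * mu)%:E = (\int[P0]_w (a ^+ 2 + (- (2 * a)) * X w)%:E)%E.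
    under eq_integral do rewrite EFinD.
    rewrite integralD//=; [|exact: icst|]; last first.
      by under eq_fun do rewrite EFinM; exact: integrableZl.
    rewrite [X in (X + _)%E](expect_cst (a ^+ 2)).
    under eq_integral do rewrite EFinM.
    by rewrite integralZl// EX -EFinM -EFinD mulNr.
  rewrite -integralD//=; last first.
    under eq_fun do rewrite EFinD.
    apply: integrableD => //; first exact: icst.
    by under eq_fun do rewrite EFinM; exact: integrableZl.
  by apply: eq_integral => w _; rewrite -EFinD; congr _%:E; ring.
have : expect (fun x => (x - mu) ^+ 2) = 1%E.
  rewrite -varX /variance covariance.unlock -/mu [in RHS]unlock.
  by apply: eq_integral => w _; rewrite expr2.
rewrite !key -[(\int[P0]_w _)%E]fineK; last exact: (integrable_fin_num _ iX2).
move: (fine _) => u; rewrite -!EFinD => -[uE]; congr _%:E.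
have -> : u = 1 - (mu ^+ 2 - 2 * mu * mu) by apply/eqP; rewrite eq_sym subr_eq eq_sym; apply/eqP.
ring.
Qed.

End moments.

Section grid_moments.
Context (R : realType) (d0 : measure_display) (T0 : measurableType d0).
Context (P0 : probability T0 R) (X : {RV P0 >-> R}) (eps : R).
Hypotheses (eps_gt0 : 0 < eps)
  (momX : ('E_P0[fun w => (`|X w| `^ (2 + eps))%R] < +oo)%E)
  (varX : 'V_P0[X] = 1%E).
Context (K dl : R).
Hypotheses (K_gt0 : 0 < K) (dl_gt0 : 0 < dl).
Local Notation phi := (fun x : R => grid_val (grid_cls K dl x)).
Local Notation M := (abs_moment X eps).

Definition grid_law (a : option 'I_(grid_size K dl).+1) : R :=
  law X (@grid_cls R K dl) a.

Definition grid_mean : R := \sum_a grid_law a * grid_val a.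

Definition grid_var : R := \sum_a grid_law a * (grid_val a - grid_mean) ^+ 2.

Lemma grid_law_ge0 a : 0 <= grid_law a. Proof. exact: law_ge0. Qed.

Lemma grid_law_sum : \sum_a grid_law a = 1.
Proof. by apply: law_sum; exact: grid_cls_measurable. Qed.

Lemma expect_grid (f : R -> R) :
  expect X (fun x => f (phi x)) = (\sum_a grid_law a * f (grid_val a))%:E.
Proof.
exact: (law_expectation X (grid_cls_measurable (K := K) dl_gt0) (fun a => f (grid_val a))).
Qed.

Lemma grid_measurable (f : R -> R) : measurable_fun [set: R] (fun x => f (phi x)).
Proof.
exact: (finite_valued_measurable (grid_cls_measurable (K := K) dl_gt0) (fun a => f (grid_val a))).
Qed.

Lemma grid_sqr_error x : (x - phi x) ^+ 2 <= dl ^+ 2 + K `^ (- eps) * abs_pow eps x.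
Proof.
have [xK|Kx] := leP `|x| K.
  apply: le_trans (_ : dl ^+ 2 <= _); last by rewrite lerDl mulr_ge0 ?powR_ge0.
  rewrite -real_normK ?num_real// ler_sqr ?nnegrE ?normr_ge0 ?(ltW dl_gt0)//.
  exact: grid_val_near.
rewrite grid_val_far// subr0; apply: le_trans (sqr_le_abs_pow eps_gt0 K_gt0 (ltW Kx)) _.
by rewrite lerDr sqr_ge0.
Qed.

Definition grid_err : R := dl ^+ 2 + K `^ (- eps) * M.

Lemma expect_grid_error : (expect X (fun x => (x - phi x) ^+ 2)%R <= grid_err%:E)%E.
Proof.
have mpw := @abs_pow_measurable R eps.
apply: (@le_trans _ _ (expect X (fun x => dl ^+ 2 + K `^ (- eps) * abs_pow eps x))).
  apply: expect_le => //.
  - by apply: measurable_funX; apply: measurable_funB => //; exact: (grid_measurable id).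
  - by apply: measurable_funD => //; exact: measurable_funM.
  - by move=> x; exact: sqr_ge0.
  - exact: grid_sqr_error.
rewrite expect_D//; last 3 first.
- exact: measurable_funM.
- by move=> _; exact: sqr_ge0.
- by move=> x; rewrite mulr_ge0 ?powR_ge0.
rewrite expect_cst expect_Z ?powR_ge0//; last by move=> x; exact: abs_pow_ge0.
by rewrite expect_abs_pow.
Qed.

(** Young's inequality with a free weight, so that two second moments can be compared up to a factor
    close to 1. *)
Lemma sqr_split (t a b : R) : 0 < t ->
  a ^+ 2 <= (1 + t) * b ^+ 2 + (1 + t^-1) * (a - b) ^+ 2.
Proof.
move=> t0; rewrite -subr_ge0.
have -> : (1 + t) * b ^+ 2 + (1 + t^-1) * (a - b) ^+ 2 - a ^+ 2 =
    t * (b - t^-1 * (a - b)) ^+ 2 by field; rewrite gt_eqF.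
by rewrite mulr_ge0 ?sqr_ge0// ltW.
Qed.

Lemma expect_sqr_split (t : R) (f g : R -> R) (u e : R) : 0 < t ->
  measurable_fun [set: R] f -> measurable_fun [set: R] g ->
  expect X (fun x => g x ^+ 2) = u%:E ->
  (expect X (fun x => (f x - g x) ^+ 2)%R <= e%:E)%E ->
  (expect X (fun x => f x ^+ 2)%R <= ((1 + t) * u + (1 + t^-1) * e)%:E)%E.
Proof.
move=> t0 mf mg gu fge.
have mfg : measurable_fun [set: R] (fun x => (f x - g x) ^+ 2).
  by apply: measurable_funX; exact: measurable_funB.
have mg2 : measurable_fun [set: R] (fun x => g x ^+ 2) by exact: measurable_funX.
have ti0 : 0 < t^-1 by rewrite invr_gt0.
apply: (@le_trans _ _ (expect X (fun x => (1 + t) * g x ^+ 2 + (1 + t^-1) * (f x - g x) ^+ 2))).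
  apply: expect_le.
  - exact: measurable_funX.
  - by apply: measurable_funD; exact: measurable_funM.
  - by move=> x; exact: sqr_ge0.
  - by move=> x; exact: sqr_split.
rewrite expect_D//.
- rewrite expect_Z//; last 2 first.
  + by rewrite addr_ge0// ltW.
  + by move=> x; exact: sqr_ge0.
  rewrite expect_Z//; last 2 first.
  + by rewrite addr_ge0// ltW.
  + by move=> x; exact: sqr_ge0.
  rewrite gu [leRHS]EFinD !EFinM leeD2l//; apply: lee_wpmul2l => //.
  by rewrite lee_fin addr_ge0// ltW.
- exact: measurable_funM.
- exact: measurable_funM.
- by move=> x; rewrite mulr_ge0 ?sqr_ge0// addr_ge0// ltW.
- by move=> x; rewrite mulr_ge0 ?sqr_ge0// addr_ge0// ltW.
Qed.

(** The weighted splitting is used in both directions, centered each time at the mean of one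
    variable: about its own mean the second moment is the variance, and about any other point it is
    at least the variance. *)
Lemma grid_var_near (t : R) : 0 < t -> t <= 1 -> grid_err <= t ^+ 2 ->
  `|grid_var - 1| <= 3 * t.
Proof.
move=> t0 t1 et; set mu := fine 'E_P0[X].
have mphi (m : R) : measurable_fun [set: R] (fun x => phi x - m).
  exact: (grid_measurable (fun y => y - m)).
have mid (m : R) : measurable_fun [set: R] (fun x : R => x - m).
  exact: measurable_funB.
have IXgrid m : expect X (fun x => (phi x - m) ^+ 2) =
    (\sum_a grid_law a * (grid_val a - m) ^+ 2)%:E.
  exact: (expect_grid (fun y => (y - m) ^+ 2)).
have err m : (expect X (fun x => ((phi x - m) - (x - m)) ^+ 2)%R <= grid_err%:E)%E.
  rewrite (_ : (fun x => _) = (fun x => (x - phi x) ^+ 2)); first exact: expect_grid_error.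
  by apply/funext => x; ring.
have err' m : (expect X (fun x => ((x - m) - (phi x - m)) ^+ 2)%R <= grid_err%:E)%E.
  rewrite (_ : (fun x => _) = (fun x => (x - phi x) ^+ 2)); first exact: expect_grid_error.
  by apply/funext => x; ring.
have := expect_sqr_split t0 (mphi mu) (mid mu)
  (second_moment_shift eps_gt0 momX varX mu) (err mu).
have := expect_sqr_split t0 (mid grid_mean) (mphi grid_mean) (IXgrid grid_mean) (err' grid_mean).
rewrite (second_moment_shift eps_gt0 momX varX) IXgrid subrr expr0n/= addr0 !lee_fin -/grid_var.
have vle : grid_var <= \sum_a grid_law a * (grid_val a - mu) ^+ 2.
  by rewrite (wmean_var grid_law_sum) lerDr sqr_ge0.
have te : (1 + t^-1) * grid_err <= t ^+ 2 + t.
  apply: le_trans (_ : (1 + t^-1) * t ^+ 2 <= _); last first.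
    by rewrite mulrDl mul1r expr2 mulrA mulVf ?mul1r// gt_eqF.
  by rewrite ler_wpM2l// addr_ge0// invr_ge0 ltW.
have v0 : 0 <= grid_var.
  by apply: sumr_ge0 => a _; rewrite mulr_ge0 ?sqr_ge0// grid_law_ge0.
have := sqr_ge0 (fine 'E_P0[X] - grid_mean).
move: vle te v0; move: (_ * grid_err) grid_var (\sum_a _) ((_ - _) ^+ 2) => e v s q.
move=> vs te v0 q0 H1 H2; have t2 : t ^+ 2 <= t by rewrite expr2 ler_piMr// ltW.
have tv : (1 + t) * v <= v + t * v by rewrite mulrDl mul1r.
rewrite ler_norml; apply/andP; split; last by lra.
by nra.
Qed.

End grid_moments.

(** * A law of large numbers for tail averages *)

Section link_average.
Context (R : rcfType) (V : finType) (p val : V -> R).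
Hypotheses (p_ge0 : forall a, 0 <= p a) (p_sum1 : \sum_a p a = 1).
Context (n : nat) (c : 'I_n -> 'I_n -> nat) (s : seq nat).
Hypotheses (n_gt0 : (0 < n)%N) (cs : forall i j, c i j \in s) (us : uniq s).
Context (Y : R -> R).
Local Notation N := (n%:R : R).

Definition linkavg (x : nat -> R) : R := N ^- 2 * \sum_i \sum_j Y (x (c i j)).

Let EY := \sum_a p a * Y (val a).

Let N0 : 0 < N. Proof. by rewrite ltr0n. Qed.

Lemma Ex_linkavg x0 : Ex p val s linkavg x0 = EY.
Proof.
rewrite /linkavg ExZ (Ex_sum val p_sum1).
under eq_bigr => i _.
  rewrite (Ex_sum val p_sum1).
  under eq_bigr => j _.
    rewrite -(Ex_avg val p_sum1 _ _ (cs i j)).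
    rewrite (@Ex_ext _ _ _ _ _ _ (fun=> EY)); last first.
      by move=> x; rewrite /avg; apply: eq_bigr => a _; rewrite updE.
    rewrite (Ex_cst val p_sum1).
    over.
  over.
rewrite /= !sumr_const card_ord -mulrnA -[EY *+ _]mulr_natl natrM.
by field; rewrite gt_eqF.
Qed.

Lemma linkavg_upd k x : exists F0, forall v,
  linkavg (upd x k v) = F0 + N ^- 2 * (mult c k)%:R * Y v.
Proof.
exists (N ^- 2 * \sum_i \sum_j (c i j != k)%:R * Y (x (c i j))) => v.
rewrite -mulrA -mulrDr /mult natr_sum mulr_suml -big_split /=; congr (_ * _).
apply: eq_bigr => i _; rewrite natr_sum mulr_suml -big_split /=.
apply: eq_bigr => j _; rewrite /upd; case: eqP => _ /=.
  by rewrite mul0r add0r mul1r.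
by rewrite mul1r mul0r addr0.
Qed.

Lemma vark_linkavg k x :
  vark p val k linkavg x <=
  (N ^- 2 * (mult c k)%:R) ^+ 2 * (4 * \sum_a p a * Y (val a) ^+ 2).
Proof.
have [F0 FE] := linkavg_upd k x.
set E2 := \sum_a p a * _; set w2 := _ ^+ 2.
have w0 : 0 <= w2 by exact: sqr_ge0.
have E2E : 2 * w2 * E2 = \sum_a p a * (2 * w2 * Y (val a) ^+ 2).
  by rewrite /E2 mulr_sumr; apply: eq_bigr => a _; ring.
apply: le_trans (_ : \sum_a p a * (w2 * (2 * Y (val a) ^+ 2 + 2 * E2)) <= _); last first.
  apply: le_of_eq.
  transitivity (2 * w2 * E2 + \sum_a p a * (2 * w2 * E2)).
    by rewrite [X in _ = X + _]E2E -big_split /=; apply: eq_bigr => a _; ring.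
  by rewrite wmean_cst//; ring.
apply: wmean_le => // a.
apply: le_trans (_ : \sum_b p b * (w2 * (2 * Y (val a) ^+ 2 + 2 * Y (val b) ^+ 2)) <= _); last first.
  apply: le_of_eq.
  transitivity ((\sum_b p b * (2 * w2 * Y (val a) ^+ 2)) + 2 * w2 * E2).
    by rewrite E2E -big_split /=; apply: eq_bigr => b _; ring.
  by rewrite wmean_cst//; ring.
apply: wmean_le => // b; rewrite !FE (_ : _ - _ = N ^- 2 * (mult c k)%:R * (Y (val a) - Y (val b))); last by ring.
rewrite exprMn ler_wpM2l//.
move: (Y _) (Y _) => u v; rewrite -subr_ge0.
by rewrite (_ : _ - _ = (u + v) ^+ 2) ?sqr_ge0//; ring.
Qed.

(** The average is affine in each [Y (x k)] with slope [mult c k / N ^ 2]; Efron-Stein sums the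
    squared slopes to [energy / N ^ 4]. *)
Lemma variance_linkavg x0 :
  Ex p val s (fun x => (linkavg x - EY) ^+ 2) x0 <=
  (energy c)%:R / N ^+ 4 * (4 * \sum_a p a * Y (val a) ^+ 2).
Proof.
have := @Ex_variance _ _ p val p_ge0 p_sum1 'I_1 s (fun=> linkavg)
  (fun k => (N ^- 2 * (mult c k)%:R) ^+ 2 * (4 * \sum_a p a * Y (val a) ^+ 2)) x0 us.
rewrite big_ord1 Ex_linkavg => H; apply: le_trans (H _) _.
  by move=> k x _; rewrite big_ord1; exact: vark_linkavg.
rewrite -mulr_suml; under eq_bigr do rewrite exprMn -[(mult _ _)%:R ^+ 2]natrX.
rewrite -mulr_sumr -natr_sum (sum_mult_sqr cs us) exprVn -exprM.
by rewrite [N ^- _ * _]mulrC.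
Qed.

End link_average.

Definition tail_sq (R : realType) (K0 v : R) : R := v ^+ 2 * (K0 < `|v|)%R%:R.

Definition tail_avg (R : realType) (K0 : R) n (x : nat -> R) : R :=
  linkavg (@hlink n) (tail_sq K0) x.

(* Dominates [tail_sq K0] after a perturbation of size at most [1]. *)
Definition tail_major (R : realType) (K0 v : R) : R :=
  4 * v ^+ 2 * (K0 - 1 <= `|v|)%R%:R.

Section tail_major.
Context (R : realType) (K0 : R).
Hypothesis K0_ge4 : 4 <= K0.

Lemma tail_major_ge0 v : 0 <= tail_major K0 v.
Proof. by rewrite mulr_ge0// mulr_ge0// sqr_ge0. Qed.

(** [4 <= K0] forces |v| > 3 when |x| > K0, hence |x| <= 1 + |v| <= 2 |v|; this is the factor 4 in
    [tail_major]. *)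
Lemma tail_sq_le_major x v : `|x - v| <= 1 -> tail_sq K0 x <= tail_major K0 v.
Proof.
move=> xv; rewrite /tail_sq; case: ltP => [Kx|_]; last by rewrite mulr0 tail_major_ge0.
have xle : `|x| <= 1 + `|v|.
  by rewrite -[x](subrK v); apply: le_trans (ler_normD _ _) _; rewrite lerD2r.
have -> : tail_major K0 v = 4 * v ^+ 2.
  by rewrite /tail_major (_ : _ <= _) ?mulr1//; move: Kx xle; lra.
rewrite mulr1 -(real_normK (num_real x)) -(real_normK (num_real v)).
have := normr_ge0 x; move: `|x| `|v| Kx xle => a b Ka ab a0.
rewrite -subr_ge0 (_ : _ - _ = (2 * b - a) * (2 * b + a)); last by ring.
by apply: mulr_ge0; move: K0_ge4 Ka ab a0; lra.
Qed.

(** On the support, |x| >= K0 - 2 >= 2, so 2 |v| <= 2 + 2 |x| <= 3 |x|: this is where 9 and [K0 - 2]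
    come from. *)
Lemma tail_major_le (eps x v : R) : 0 < eps -> `|x - v| <= 1 ->
  tail_major K0 v <= 9 * (K0 - 2) `^ (- eps) * abs_pow eps x.
Proof.
move=> eps0 xv; rewrite /tail_major; case: (leP (K0 - 1) `|v|) => [Kv|_]; last first.
  by rewrite mulr0 !mulr_ge0 ?powR_ge0.
have vle : `|v| <= 1 + `|x|.
  rewrite -[v](subrK x); apply: le_trans (ler_normD _ _) _.
  by rewrite lerD2r distrC.
have Kx : K0 - 2 <= `|x| by move: Kv vle; lra.
have K20 : 0 < K0 - 2 by move: K0_ge4; lra.
have := sqr_le_abs_pow eps0 K20 Kx; rewrite mulr1 -mulrA.
move: (_ * abs_pow eps x) => q; rewrite -(real_normK (num_real x)) -(real_normK (num_real v)).
have := normr_ge0 v; move: `|x| `|v| Kx Kv vle => a b Ka Kb ba b0 aq.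
apply: le_trans (_ : 9 * a ^+ 2 <= _); last by rewrite ler_pM2l.
rewrite -subr_ge0 (_ : _ - _ = (3 * a - 2 * b) * (3 * a + 2 * b)); last by ring.
by apply: mulr_ge0; move: K0_ge4 Ka Kb ba b0; lra.
Qed.

Lemma tail_major_sqr (B v : R) : `|v| <= B ->
  tail_major K0 v ^+ 2 <= 4 * B ^+ 2 * tail_major K0 v.
Proof.
move=> vB; rewrite expr2 ler_wpM2r ?tail_major_ge0//.
apply: le_trans (_ : 4 * v ^+ 2 * 1 <= _).
  rewrite /tail_major; apply: ler_wpM2l; first by rewrite mulr_ge0// sqr_ge0.
  by rewrite lern1; case: (_ <= _)%R.
rewrite mulr1 ler_pM2l// -(real_normK (num_real v)) ler_sqr ?nnegrE//.
exact: le_trans vB.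
Qed.

End tail_major.

Section tail_moments.
Context (R : realType) (d0 : measure_display) (T0 : measurableType d0).
Context (P0 : probability T0 R) (X : {RV P0 >-> R}) (eps : R).
Hypotheses (eps_gt0 : 0 < eps)
  (momX : ('E_P0[fun w => (`|X w| `^ (2 + eps))%R] < +oo)%E).
Local Notation M := (abs_moment X eps).

Definition tail_bound (K0 : R) : R := 9 * (K0 - 2) `^ (- eps) * M.

Lemma tail_bound_ge0 K0 : 0 <= tail_bound K0.
Proof. by rewrite !mulr_ge0 ?powR_ge0// abs_moment_ge0. Qed.

(** The bound does not depend on the truncation level [B], which later grows with the size of the
    matrix. *)
Lemma tail_major_mean (K0 B : R) : 4 <= K0 -> 0 < B ->
  \sum_a grid_law X a * tail_major K0 (grid_val (K := B) (dl := 1) a) <= tail_bound K0.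
Proof.
move=> K04 B0; rewrite -lee_fin -(expect_grid X B ltr01 (tail_major K0)).
have c0 : 0 <= 9 * (K0 - 2) `^ (- eps) by rewrite mulr_ge0 ?powR_ge0.
have mpw := @abs_pow_measurable R eps.
apply: (@le_trans _ _ (expect X (fun x => 9 * (K0 - 2) `^ (- eps) * abs_pow eps x))).
  apply: expect_le.
  - exact: grid_measurable.
  - exact: measurable_funM.
  - by move=> x; exact: tail_major_ge0.
  - move=> x; have [xB|Bx] := leP `|x| B.
      by apply: tail_major_le => //; exact: grid_val_near.
    rewrite grid_val_far// /tail_major expr0n mulr0 mul0r.
    by rewrite mulr_ge0 ?powR_ge0.
by rewrite expect_Z ?expect_abs_pow//; move=> x; exact: abs_pow_ge0.
Qed.

Lemma measurable_far (B : R) : measurable [set x : R | B < `|x|].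
Proof.
have -> : [set x : R | B < `|x|] = ~` `[- B, B].
  apply/seteqP; split => x /=; rewrite in_itv/= -ler_norml ltNge.
    by move/negP.
  by move/negP.
exact: measurableC.
Qed.

Lemma far_prob (B : R) : 0 < B ->
  (P0 (X @^-1` [set x | (B < `|x|)%R]) <= (B `^ (- (2 + eps)) * M)%:E)%E.
Proof.
move=> B0; have mpw := @abs_pow_measurable R eps.
have -> : P0 (X @^-1` [set x | (B < `|x|)%R]) = expect X (\1_[set x | B < `|x|]).
  rewrite /expect (_ : (fun w => _) = (fun w => (\1_(X @^-1` [set x | (B < `|x|)%R]) w)%:E)).
    by rewrite integral_indic ?setIT//; apply: measurable_RV_preim; exact: measurable_far.
  by apply/funext.
apply: (@le_trans _ _ (expect X (fun x => B `^ (- (2 + eps)) * abs_pow eps x))).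
  apply: expect_le.
  - by apply: measurable_indic; exact: measurable_far.
  - exact: measurable_funM.
  - by [].
  - move=> x; rewrite indicE; have [Bx|xB] := ltP B `|x|; last first.
      by rewrite memNset ?mulr_ge0 ?powR_ge0//= ltNge xB.
    rewrite mem_set// powRN mulrC ler_pdivlMr ?powR_gt0// mul1r.
    apply: ge0_ler_powR; rewrite ?nnegrE//; last exact: ltW.
    + by rewrite addr_ge0// ltW.
    + exact: ltW.
by rewrite expect_Z ?powR_ge0 ?expect_abs_pow//; move=> x; exact: abs_pow_ge0.
Qed.

End tail_moments.

Section geometric.
Context (R : realType).

Lemma dyadic_powR (c : R) k : (2 ^ k)%:R `^ c = (2 `^ c) ^+ k.
Proof.
by rewrite natrX -powR_mulrn// -powRrM mulrC powRrM powR_mulrn// powR_ge0.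
Qed.

Lemma powR2_lt1 (c : R) : 0 < c -> 2 `^ (- c) < 1.
Proof.
move=> c0; rewrite powRN invf_lt1 ?powR_gt0// -[ltLHS](_ : 1 `^ c = 1); last by rewrite powR1.
by apply: gt0_ltr_powR => //; rewrite ?nnegrE// ltr1n.
Qed.

Lemma geometric_partial (A q : R) n : 0 <= A -> 0 <= q < 1 ->
  \sum_(k < n) A * q ^+ k <= A / (1 - q).
Proof.
move=> A0 /andP[q0 q1]; rewrite -mulr_sumr ler_wpM2l//.
rewrite -[leRHS]mul1r ler_pdivlMr ?subr_gt0// mulrC -opprB mulNr -subrX1 opprB.
by rewrite gerBl exprn_ge0.
Qed.

End geometric.

Section tail_avg_monotone.
Context (R : realType).

Lemma sum_ord_mono (F : nat -> R) (n m : nat) : (forall i, 0 <= F i) -> (n <= m)%N ->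
  \sum_(i < n) F i <= \sum_(i < m) F i.
Proof.
move=> F0 nm; rewrite (big_ord_widen m F nm) big_mkcond /=.
by apply: ler_sum => i _; case: ifP.
Qed.

Lemma tail_sq_ge0 (K0 v : R) : 0 <= tail_sq K0 v.
Proof. by rewrite mulr_ge0// sqr_ge0. Qed.

(** The unnormalized sums increase with the size, and the normalizations differ by a factor at most
    4. *)
Lemma tail_avg_dyadic (K0 : R) n m (x : nat -> R) : (0 < n)%N -> (n <= m)%N ->
  (m <= 2 * n)%N -> tail_avg K0 n x <= 4 * tail_avg K0 m x.
Proof.
move=> n0 nm mn; rewrite /tail_avg /linkavg mulrA; apply: ler_pM.
- by rewrite invr_ge0 sqr_ge0.
- by apply: sumr_ge0 => i _; apply: sumr_ge0 => j _; exact: tail_sq_ge0.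
- have N0 : 0 < n%:R :> R by rewrite ltr0n.
  have M0 : 0 < m%:R :> R by rewrite ltr0n (leq_trans n0).
  rewrite ler_pdivlMr ?exprn_gt0// mulrC ler_pdivrMr ?exprn_gt0//.
  have -> : 4 * n%:R ^+ 2 = (2 * n%:R) ^+ 2 :> R by rewrite exprMn; congr (_ * _); ring.
  by rewrite ler_sqr ?nnegrE ?mulr_ge0// -natrM ler_nat.
- apply: (@le_trans _ _ (\sum_(i < n) \sum_(j < m) tail_sq K0 (x (i.+1 * j.+1)%N))).
    apply: ler_sum => i _.
    apply: (@sum_ord_mono (fun j => tail_sq K0 (x (i.+1 * j.+1)%N))) => // j.
    exact: tail_sq_ge0.
  apply: (@sum_ord_mono (fun i => \sum_(j < m) tail_sq K0 (x (i.+1 * j.+1)%N))) => // i.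
  by apply: sumr_ge0 => j _; exact: tail_sq_ge0.
Qed.

End tail_avg_monotone.

Section tail_lln.
Context (R : realType) (d : measure_display) (T : measurableType d) (P : probability T R).
Context (d0 : measure_display) (T0 : measurableType d0) (P0 : probability T0 R).
Context (X : {RV P0 >-> R}) (X_ : nat -> {RV P >-> R}) (eps : R).
Hypothesis copies : forall k : nat, (0 < k)%N -> same_distribution (X_ k) X.
Hypothesis indep : mutually_independent [set k : nat | (0 < k)%N] X_.
Hypotheses (eps_gt0 : 0 < eps)
  (momX : ('E_P0[fun w => (`|X w| `^ (2 + eps))%R] < +oo)%E).
Context (K0 e : R).
Hypotheses (K0_ge4 : 4 <= K0) (e_gt0 : 0 < e).
Local Notation M := (abs_moment X eps).
Local Notation rho := (tail_bound X eps K0).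

(** Truncation at n^th, n = 2^k. Since th (2 + eps) = 2 + eps / 2, the union bound over n^2
    variables leaves n^(- eps / 2). Since th = 1 - al, the variance bound, of order n^(2 + al) n^(2
    th) / n^4, leaves n^(- al). Both are summable along powers of two only in general. *)
Let th : R := (2 + eps / 2) / (2 + eps).
Let al : R := eps / 2 / (2 + eps).
Let B (k : nat) : R := (2 ^ k)%:R `^ th.
Let s (k : nat) := iota 1 ((2 ^ k) ^ 2).

Let eps2 : 0 < 2 + eps. Proof. by rewrite addr_gt0. Qed.

Let al0 : 0 < al. Proof. by rewrite !divr_gt0. Qed.

Let thE : th = 1 - al.
Proof. by rewrite /th /al; field; rewrite gt_eqF. Qed.

Let B0 k : 0 < B k. Proof. by rewrite powR_gt0// ltr0n expn_gt0. Qed.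

Definition far_event k : set T :=
  \big[setU/set0]_(i < (2 ^ k) ^ 2) (X_ i.+1 @^-1` [set x | B k < `|x|]).

Lemma far_event_measurable k : measurable (far_event k).
Proof.
apply: bigsetU_measurable => i _; apply: measurable_RV_preim.
exact: measurable_far.
Qed.

Lemma far_event_prob k :
  (P (far_event k) <= (M * (2 `^ (- (eps / 2))) ^+ k)%:E)%E.
Proof.
apply: le_trans (@Boole_inequality _ _ _ P
    (fun i => X_ i.+1 @^-1` [set x | B k < `|x|]) ((2 ^ k) ^ 2) _) _.
  by move=> i _; apply: measurable_RV_preim; exact: measurable_far.
apply: (@le_trans _ _ (\sum_(i < (2 ^ k) ^ 2) (B k `^ (- (2 + eps)) * M)%:E)%E).
  apply: lee_sum => i _.
  rewrite [leLHS](_ : _ = P0 (X @^-1` [set x | (B k < `|x|)%R])).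
    exact: far_prob.
  by apply: (copies (ltn0Sn i)); exact: measurable_far.
rewrite sumEFin lee_fin sumr_const card_ord -[_ *+ ((2 ^ k) ^ 2)%N]mulr_natl (natrX _ (2 ^ k) 2) -dyadic_powR.
have N0 : 0 < (2 ^ k)%:R :> R by rewrite ltr0n expn_gt0.
rewrite -(powR_mulrn _ (ltW N0)) /B -powRrM mulrA -powRD ?(gt_eqF N0) ?implybT//.
rewrite mulrC; apply: le_of_eq; congr (_ * _ `^ _).
by rewrite /th; field; rewrite gt_eqF.
Qed.

Let cls k := @grid_cls R (B k) 1.
Let vl k := @grid_val R (B k) 1.
Let Z k (w : T) := sampled X_ (cls k) (@vl k) (s k) (fun=> 0) w.

(** Stated for a sample rounded to mesh 1, so that it lives in the finite model; [tail_major]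
    absorbs the rounding. *)
Definition dev_event k : set T :=
  [set w | rho + e < linkavg (@hlink (2 ^ k)) (tail_major K0) (Z k w)].

Let us k : uniq (s k). Proof. exact: iota_uniq. Qed.

Let s0 k l : l \in s k -> (0 < l)%N. Proof. by rewrite mem_iota => /andP[]. Qed.

Lemma dev_event_measurable k : measurable (dev_event k).
Proof.
by have [] := sampled_prob copies indep (@vl k)
  (grid_cls_measurable (K := B k) ltr01)
  (fun x => rho + e < linkavg (@hlink (2 ^ k)) (tail_major K0) x)
  (fun=> 0) (us k) (@s0 k).
Qed.

Lemma dev_event_prob k :
  (P (dev_event k) <=
   (e ^- 2 * (32 * (1 + al^-1) * rho) * (2 `^ (- al)) ^+ k)%:E)%E.
Proof.
have N0 : 0 < (2 ^ k)%:R :> R by rewrite ltr0n expn_gt0.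
have n0 : (0 < 2 ^ k)%N by rewrite expn_gt0.
set EY := \sum_a grid_law X a * tail_major K0 (@vl k a).
have EYrho : EY <= rho by exact: tail_major_mean.
have Mk := sampled_markov copies indep (@vl k)
  (grid_cls_measurable (K := B k) ltr01)
  (b := fun x => rho + e < linkavg (@hlink (2 ^ k)) (tail_major K0) x)
  (Phi := fun x => e ^- 2 * (linkavg (@hlink (2 ^ k)) (tail_major K0) x - EY) ^+ 2)
  (fun=> 0) (us k) (@s0 k).
apply: le_trans (Mk _) _.
  move=> x; case: ltP => [lx|_]; last first.
    by rewrite mulr_ge0 ?sqr_ge0// invr_ge0 sqr_ge0.
  rewrite mulrC ler_pdivlMr ?exprn_gt0// mul1r ler_sqr ?nnegrE ?(ltW e_gt0)//.
    by move: lx EYrho; lra.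
  by move: lx EYrho e_gt0; lra.
rewrite lee_fin ExZ -mulrA -mulrA; apply: ler_wpM2l; first by rewrite invr_ge0 sqr_ge0.
have := @variance_linkavg _ _ _ (@vl k) (@grid_law_ge0 _ _ _ _ X (B k) 1)
  (grid_law_sum X (B k) ltr01) _ (@hlink (2 ^ k)) (s k) n0
  (@hlink_iota _) (us k) (tail_major K0) (fun=> 0).
move=> H; apply: le_trans H _.
(* The truncation enters here: the second moment of the bounded [tail_major] is at most 4 B^2 times
   its mean. *)
have Y2 : \sum_a grid_law X a * tail_major K0 (@vl k a) ^+ 2 <= 4 * B k ^+ 2 * rho.
  apply: (@le_trans _ _ (4 * B k ^+ 2 * EY)); last first.
    by rewrite ler_wpM2l// mulr_ge0// sqr_ge0.
  rewrite mulr_sumr; apply: ler_sum => a _; rewrite [leRHS]mulrCA.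
  apply: ler_wpM2l; first exact: grid_law_ge0.
  by apply: tail_major_sqr => //; exact: grid_val_le.
have En := energy_powR (2 ^ k) al0.
have rho0 : 0 <= rho by exact: tail_bound_ge0.
apply: le_trans (_ : (2 * (1 + al^-1) * (2 ^ k)%:R ^+ 2 * (2 ^ k)%:R `^ al) /
   (2 ^ k)%:R ^+ 4 * (4 * (4 * B k ^+ 2 * rho)) <= _).
  apply: ler_pM.
  - by rewrite divr_ge0// exprn_ge0.
  - by rewrite mulr_ge0// sumr_ge0// => a _; rewrite mulr_ge0 ?sqr_ge0// grid_law_ge0.
  - by rewrite ler_wpM2r// invr_ge0 exprn_ge0.
  - by rewrite ler_wpM2l.
have E : (2 ^ k)%:R ^+ 2 * (2 ^ k)%:R `^ al / (2 ^ k)%:R ^+ 4 * B k ^+ 2 =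
    (2 `^ (- al)) ^+ k.
  rewrite -dyadic_powR /B -!(powR_mulrn _ (powR_ge0 _ _)) -!(powR_mulrn _ (ltW N0)).
  rewrite -powRrM -powRN -!powRD ?(gt_eqF N0) ?implybT//; congr (_ `^ _).
  by rewrite thE; ring.
rewrite -E; apply: le_of_eq.
by field; rewrite gt_eqF// gt_eqF.
Qed.

(** Off [far_event] every entry is within 1 of its rounded value, so the tail average is dominated
    by the average of [tail_major]. *)
Lemma good_dyadic k w : ~ far_event k w -> ~ dev_event k w ->
  tail_avg K0 (2 ^ k) (fun l => X_ l w) <= rho + e.
Proof.
move=> nf /negP; rewrite -leNgt; apply: le_trans.
apply: ler_wpM2l; first by rewrite invr_ge0 sqr_ge0.
apply: ler_sum => i _; apply: ler_sum => j _; apply: tail_sq_le_major => //.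
rewrite /Z /sampled hlink_iota; apply: grid_val_near => //.
rewrite leNgt; apply/negP => Bx; apply: nf; rewrite /far_event.
rewrite -(bigcup_mkord _ (fun i => X_ i.+1 @^-1` [set x | B k < `|x|])).
have := hlink_iota i j; rewrite mem_iota add1n.
by case: (hlink i j) Bx => // l Bx ln; exists l.
Qed.

Lemma dyadic_tail : {ae P, forall w, exists k0, forall k, (k0 <= k)%N ->
  tail_avg K0 (2 ^ k) (fun l => X_ l w) <= rho + e}.
Proof.
have e20 : 0 < eps / 2 by rewrite divr_gt0.
have A1 := ae_eventually far_event_measurable far_event_prob
  (fun n => geometric_partial n (abs_moment_ge0 momX)
     (introT andP (conj (powR_ge0 _ _) (powR2_lt1 e20)))).
have c0 : 0 <= e ^- 2 * (32 * (1 + al^-1) * rho).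
  rewrite mulr_ge0 ?invr_ge0 ?sqr_ge0// mulr_ge0 ?tail_bound_ge0// mulr_ge0//.
  by rewrite addr_ge0// invr_ge0 ltW.
have A2 := ae_eventually dev_event_measurable dev_event_prob
  (fun n => geometric_partial n c0
     (introT andP (conj (powR_ge0 _ _) (powR2_lt1 al0)))).
apply: filterS2 A1 A2 => w [k1 H1] [k2 H2]; exists (maxn k1 k2) => k.
rewrite geq_max => /andP[k1k k2k].
by apply: good_dyadic; [exact: H1|exact: H2].
Qed.

Lemma tail_law_large_numbers : {ae P, forall w, exists n0, forall n, (n0 <= n)%N ->
  tail_avg K0 n (fun l => X_ l w) <= 4 * (rho + e)}.
Proof.
apply: filterS dyadic_tail => w [k0 Hk]; exists (2 ^ k0).+1 => n nk0.
have n1 : (1 < n)%N by rewrite (leq_trans _ nk0)// ltnS expn_gt0.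
(* The next power of two above [n] is at most [2 * n], and monotonicity fills the gap. *)
have /andP[kn nk] := up_log_bounds (ltnSn 1) n1; set k := up_log 2 n in kn nk.
have k_gt0 : (0 < k)%N by rewrite up_log_gt0.
have kk0 : (k0 <= k)%N.
  by rewrite -(leq_exp2l _ _ (ltnSn 1)) (leq_trans _ nk)// ltnW.
have kn2 : (2 ^ k <= 2 * n)%N by rewrite -(prednK k_gt0) expnS leq_mul// ltnW.
apply: le_trans (_ : 4 * tail_avg K0 (2 ^ k) (fun l => X_ l w) <= _); last first.
  by rewrite ler_pM2l// Hk.
by apply: tail_avg_dyadic => //; rewrite ltnW.
Qed.

End tail_lln.

(** * Almost sure convergence of the resolvent traces *)

Section trace_expectation.
Context (R : rcfType) (V : finType) (p val : V -> R).
Hypotheses (p_ge0 : forall a, 0 <= p a) (p_sum1 : \sum_a p a = 1).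

Lemma Re_ntr n (A : 'M[R[i]]_n) : complex.Re (ntr A) = n%:R^-1 * \sum_i complex.Re (A i i).
Proof. by rewrite /ntr ReZ Re_sum. Qed.

Lemma Im_ntr n (A : 'M[R[i]]_n) : complex.Im (ntr A) = n%:R^-1 * \sum_i complex.Im (A i i).
Proof. by rewrite /ntr ImZ Im_sum. Qed.

Lemma Re_ntr_ExM n s (F : (nat -> R) -> 'M[R[i]]_n) x :
  complex.Re (ntr (ExM p val s F x)) = Ex p val s (fun y => complex.Re (ntr (F y))) x.
Proof.
rewrite Re_ntr (@Ex_ext _ _ _ _ _ _ (fun y => n%:R^-1 * \sum_i complex.Re (F y i i))).
  rewrite ExZ (Ex_sum val p_sum1); congr (_ * _); apply: eq_bigr => i _; exact: Re_ExM.
by move=> y; exact: Re_ntr.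
Qed.

Lemma Im_ntr_ExM n s (F : (nat -> R) -> 'M[R[i]]_n) x :
  complex.Im (ntr (ExM p val s F x)) = Ex p val s (fun y => complex.Im (ntr (F y))) x.
Proof.
rewrite Im_ntr (@Ex_ext _ _ _ _ _ _ (fun y => n%:R^-1 * \sum_i complex.Im (F y i i))).
  rewrite ExZ (Ex_sum val p_sum1); congr (_ * _); apply: eq_bigr => i _; exact: Im_ExM.
by move=> y; exact: Im_ntr.
Qed.

End trace_expectation.

Lemma sqrt_pow3_partial (R : realType) N :
  \sum_(n < N) (Num.sqrt n.+1%:R : R) ^- 3 <= 3.
Proof.
case: N => [|N]; first by rewrite big_ord0.
(* Strengthened so that the induction telescopes: n^(-3/2) is compared with the increments of -2
   n^(-1/2). *)
suff H : \sum_(n < N.+1) (Num.sqrt n.+1%:R : R) ^- 3 <= 3 - 2 / Num.sqrt N.+1%:R.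
  by apply: le_trans H _; rewrite gerBl divr_ge0 ?sqrtr_ge0.
elim: N => [|N IH].
  by rewrite big_ord1 sqrtr1 expr1n invr1; lra.
rewrite big_ord_recr /=; apply: le_trans (lerD IH (lexx _)) _.
set a := Num.sqrt N.+1%:R : R; set b := Num.sqrt N.+2%:R : R.
have a0 : 0 < a by rewrite sqrtr_gt0 ltr0n.
have ab : a <= b by rewrite ler_sqrt ?ler_nat.
have b0 : 0 < b by apply: lt_le_trans ab.
have ba : b ^+ 2 = a ^+ 2 + 1 by rewrite !sqr_sqrtr// natr1.
clearbody a b; rewrite -subr_ge0.
have -> : 3 - 2 / b - (3 - 2 / a + b ^- 3) = (2 * b ^+ 2 * (b - a) - a) / (a * b ^+ 3).
  by field; rewrite !gt_eqF.
apply: divr_ge0; last by rewrite mulr_ge0 ?exprn_ge0// ltW.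
have e1 : (b - a) * (b + a) = 1 by rewrite -subr_sqr ba; ring.
rewrite subr_ge0 -(ler_pM2r (_ : 0 < b + a)); last by rewrite addr_gt0.
rewrite -[_ * (b - a) * _]mulrA e1 mulr1; nra.
Qed.

Lemma ReB (R : rcfType) (z w : R[i]) : complex.Re (z - w) = complex.Re z - complex.Re w.
Proof. by case: z w => [a b] []. Qed.

Lemma ImB (R : rcfType) (z w : R[i]) : complex.Im (z - w) = complex.Im z - complex.Im w.
Proof. by case: z w => [a b] []. Qed.

Section concentration.
Context (R : realType) (d : measure_display) (T : measurableType d) (P : probability T R).
Context (d0 : measure_display) (T0 : measurableType d0) (P0 : probability T0 R).
Context (X : {RV P0 >-> R}) (X_ : nat -> {RV P >-> R}).
Hypothesis copies : forall k : nat, (0 < k)%N -> same_distribution (X_ k) X.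
Hypothesis indep : mutually_independent [set k : nat | (0 < k)%N] X_.
Context (V : finType) (cls : R -> V) (val : V -> R).
Hypothesis mcls : forall a, measurable (cls @^-1` [set a]).
Context (K y e : R).
Hypotheses (valK : forall a, `|val a| <= K) (y_ge3 : 3 <= y) (e_gt0 : 0 < e).
Local Notation C := R[i].
Local Notation p := (law X cls).

Definition sample_link n (w : T) : nat -> R :=
  sampled X_ cls val (iota 1 (n ^ 2)) (fun=> 0) w.

Let G n (x : nat -> R) : C := ntr (resl (@hlink n) y x).

Let p0 := law_ge0 X cls.
Let p1 : \sum_a p a = 1 := law_sum X mcls.

(** Markov's inequality at order four and Borel-Cantelli. The energy bound with exponent 1/4 gives
    probabilities of order n^(-3/2), with no need for subsequences. *)
Lemma trace_fluctuation (f : C -> R) :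
  {morph f : z w / z - w} -> (forall z, (f z) ^+ 2 <= nsq z) ->
  {ae P, forall w, exists n0, forall n, (n0 <= n)%N ->
    `|f (G n.+1 (sample_link n.+1 w)) -
      Ex p val (iota 1 (n.+1 ^ 2)) (fun x => f (G n.+1 x)) (fun=> 0)| <= e}.
Proof.
move=> fB fle.
pose mu n := Ex p val (iota 1 (n.+1 ^ 2)) (fun x => f (G n.+1 x)) (fun=> 0).
pose b n (x : nat -> R) := e < `|f (G n.+1 x) - mu n|.
pose bad n := [set w | b n (sample_link n.+1 w)].
have s0 n l : l \in iota 1 (n.+1 ^ 2) -> (0 < l)%N by rewrite mem_iota => /andP[].
have us n : uniq (iota 1 (n.+1 ^ 2)) by exact: iota_uniq.
have mbad n : measurable (bad n).
  by have [] := sampled_prob copies indep val mcls (b n) (fun=> 0) (us n) (@s0 n).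
(* 40 = 4 * 10: the energy is at most 10 n^(9/4), from 2 (1 + 4) in [energy_powR]. *)
pose c := e ^- 4 * (11 * (40 * K ^+ 2) ^+ 2).
have Pbad n : (P (bad n) <= (c * (Num.sqrt n.+1%:R) ^- 3)%:E)%E.
  apply: le_trans (sampled_markov copies indep val mcls (b := b n)
    (Phi := fun x => e ^- 4 * (f (G n.+1 x) - mu n) ^+ 4) (fun=> 0) (us n) (@s0 n) _) _.
    move=> x; rewrite /b; case: ltP => [lx|_]; last first.
      by rewrite mulr_ge0// ?invr_ge0 (exprM _ 2 2) sqr_ge0.
    rewrite mulrC ler_pdivlMr ?exprn_gt0// mul1r.
    rewrite (exprM _ 2 2) (exprM _ 2 2) ler_sqr ?nnegrE ?sqr_ge0//.
    by rewrite -[leRHS]real_normK ?num_real// ler_sqr ?nnegrE ?normr_ge0 ?ltW.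
  rewrite lee_fin ExZ /c -mulrA ler_wpM2l//; first by rewrite invr_ge0 exprn_ge0 ?ltW.
  have N0 : 0 < n.+1%:R :> R by rewrite ltr0n.
  have := resl_fourth_moment p0 p1 (ltn0Sn n) (@hlinkC _) (@hlink_iota _) (us n) valK
    y_ge3 (fun=> 0) fB fle.
  move=> H; apply: le_trans H _; rewrite -[leRHS]mulrA ler_pM2l//.
  have q0 : 0 < 4^-1 :> R by rewrite invr_gt0.
  set q := Num.sqrt n.+1%:R.
  have qq : q = n.+1%:R `^ (4^-1) * n.+1%:R `^ (4^-1).
    rewrite /q -powR12_sqrt ?ltW// -powRD ?(gt_eqF N0) ?implybT//; congr (_ `^ _).
    by lra.
  have qN : n.+1%:R = q ^+ 2 by rewrite sqr_sqrtr// ltW.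
  have q_gt0 : 0 < q by rewrite sqrtr_gt0.
  have En : (energy (@hlink n.+1))%:R <= 10 * n.+1%:R ^+ 2 * n.+1%:R `^ (4^-1) :> R.
    apply: le_trans (energy_powR n.+1 q0) _.
    by rewrite invrK (_ : 2 * (1 + 4) = 10 :> R)//; ring.
  apply: le_trans (_ : (4 * K ^+ 2 * (10 * n.+1%:R ^+ 2 * n.+1%:R `^ (4^-1)) /
     n.+1%:R ^+ 3) ^+ 2 <= _).
    rewrite ler_sqr ?nnegrE; last 2 first.
    - by rewrite divr_ge0 ?exprn_ge0// mulr_ge0// mulr_ge0// sqr_ge0.
    - rewrite divr_ge0 ?exprn_ge0//; apply: mulr_ge0; first by rewrite mulr_ge0// sqr_ge0.
      by rewrite mulr_ge0 ?powR_ge0// mulr_ge0// sqr_ge0.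
    rewrite ler_wpM2r ?invr_ge0 ?exprn_ge0// ler_wpM2l//.
    by rewrite mulr_ge0// sqr_ge0.
  move: qq; rewrite -[in X in _ <= X](_ : (40 * K ^+ 2) ^+ 2 * (q / q ^+ 4) = (40 * K ^+ 2) ^+ 2 * q ^- 3).
    move: (n.+1%:R `^ _) => r qq.
    rewrite {1}qq; apply: le_of_eq; rewrite qN.
    by field; rewrite gt_eqF.
  by congr (_ * _); field; rewrite gt_eqF.
have c0 : 0 <= c.
  apply: mulr_ge0; first by rewrite invr_ge0 exprn_ge0// ltW.
  by rewrite mulr_ge0// sqr_ge0.
have sumb N : \sum_(n < N) c * (Num.sqrt n.+1%:R) ^- 3 <= c * 3.
  by rewrite -mulr_sumr ler_wpM2l// sqrt_pow3_partial.
apply: filterS (ae_eventually mbad Pbad sumb) => w [n0 H]; exists n0 => n /H.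
by rewrite /bad /b /= leNgt => /negP.
Qed.

Lemma trace_concentration :
  {ae P, forall w, exists n0, forall n, (n0 <= n)%N ->
    nsq (G n.+1 (sample_link n.+1 w) -
      ntr (ExM p val (iota 1 (n.+1 ^ 2)) (resl (@hlink n.+1) y) (fun=> 0))) <= 2 * e ^+ 2}.
Proof.
have fR := @trace_fluctuation (@complex.Re R) (@ReB R).
have fI := @trace_fluctuation (@complex.Im R) (@ImB R).
apply: filterS2 (fR _) (fI _).
- move=> w [n1 H1] [n2 H2]; exists (maxn n1 n2) => n.
  rewrite geq_max => /andP[/H1 + /H2]; rewrite -Re_ntr_ExM// -Im_ntr_ExM// => h1 h2.
  rewrite /nsq ReB ImB mulr2n mulrDl mul1r; apply: lerD.
    by rewrite -real_normK ?num_real// ler_sqr ?nnegrE ?normr_ge0// ltW.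
  by rewrite -real_normK ?num_real// ler_sqr ?nnegrE ?normr_ge0// ltW.
- by move=> z; rewrite /nsq lerDl sqr_ge0.
- by move=> z; rewrite /nsq lerDr sqr_ge0.
Qed.

End concentration.

Section resolvent_comparison.
Context (R : realType) (n : nat) (c : 'I_n -> 'I_n -> nat) (y : R).
Hypotheses (n_gt0 : (0 < n)%N) (cC : forall i j, c i j = c j i) (y_ge1 : 1 <= y).

Lemma linkmx_shift (x : nat -> R) (m : R) :
  linkmx c x = linkmx c (fun k => x k - m) + const_mx ((Num.sqrt n%:R)^-1 * m).
Proof. by apply/matrixP => i j; rewrite !mxE -mulrDr subrK. Qed.

Lemma ntr_linkmx_perturb (x x' : nat -> R) :
  nsq (ntr (res y (linkmx c x')) - ntr (res y (linkmx c x))) <=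
  n%:R ^- 2 * \sum_i \sum_j (x (c i j) - x' (c i j)) ^+ 2.
Proof.
apply: le_trans (ntr_res_perturb n_gt0 y_ge1 (linkmx_tr cC x) (linkmx_tr cC x')) _.
have N0 : 0 < n%:R :> R by rewrite ltr0n.
apply: le_of_eq.
rewrite !mulr_sumr; apply: eq_bigr => i _; rewrite !mulr_sumr; apply: eq_bigr => j _.
rewrite !mxE -mulrBr exprMn mulrA; congr (_ * _).
by rewrite exprVn sqr_sqrtr ?ltW// expr2 invfM.
Qed.

Lemma ntr_linkmx_shift (x : nat -> R) (m : R) :
  nsq (ntr (res y (linkmx c x)) - ntr (res y (linkmx c (fun k => x k - m)))) <= m ^+ 2 / n%:R.
Proof.
rewrite {1}(linkmx_shift x m).
apply: le_trans (ntr_res_shift n_gt0 y_ge1 _ (linkmx_tr cC _)) _.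
by rewrite exprMn exprVn sqr_sqrtr// mulrC.
Qed.

End resolvent_comparison.

Lemma nsq_sum4 (R : rcfType) (z1 z2 z3 z4 z5 : R[i]) :
  nsq (z1 - z5) <= 4 * (nsq (z1 - z2) + nsq (z2 - z3) + nsq (z3 - z4) + nsq (z4 - z5)).
Proof.
have -> : z1 - z5 = ((z1 - z2) + (z2 - z3)) + ((z3 - z4) + (z4 - z5)).
  by rewrite !subrKA.
apply: le_trans (nsqD _ _) _.
have := nsqD (z1 - z2) (z2 - z3); have := nsqD (z3 - z4) (z4 - z5).
lra.
Qed.

Section resolvent_limit.
Context (R : realType) (d : measure_display) (T : measurableType d) (P : probability T R).
Context (d0 : measure_display) (T0 : measurableType d0) (P0 : probability T0 R).
Context (X : {RV P0 >-> R}) (X_ : nat -> {RV P >-> R}) (eps : R).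
Hypothesis copies : forall k : nat, (0 < k)%N -> same_distribution (X_ k) X.
Hypothesis indep : mutually_independent [set k : nat | (0 < k)%N] X_.
Hypotheses (eps_gt0 : 0 < eps)
  (momX : ('E_P0[fun w => (`|X w| `^ (2 + eps))%R] < +oo)%E).
Context (y b : R).
Hypotheses (y_ge3 : 3 <= y) (b_ge0 : 0 <= b) (bE : b ^+ 2 + y * b = 1).

Definition trace_gap n (w : T) : R :=
  nsq (ntr (res y (linkmx (@hlink n.+1) (fun k => X_ k w))) - (0 +i* b)%C).

Section grid_level.
Context (K dl e : R).
Hypotheses (K_ge4 : 4 <= K) (dl_gt0 : 0 < dl) (e_gt0 : 0 < e).

Let m : R := grid_mean X K dl.
(** Rounded values recentered to mean zero, as the Dyson equation requires; the shift by [m] is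
    undone by the rank-one comparison. *)
Let cval (a : option 'I_(grid_size K dl).+1) : R := grid_val a - m.
Let p := @grid_law _ _ _ _ X K dl.
Let p0 a : 0 <= p a. Proof. exact: grid_law_ge0. Qed.
Let p1 : \sum_a p a = 1. Proof. exact: grid_law_sum. Qed.
Let mcls := grid_cls_measurable (K := K) dl_gt0.
Let K0 : 0 < K. Proof. by apply: lt_le_trans K_ge4. Qed.

Let m_le : `|m| <= K.
Proof.
apply: le_trans (ler_norm_sum _ _ _) _; rewrite -[leRHS](wmean_cst p1).
by apply: ler_sum => a _; rewrite normrM ger0_norm// ler_wpM2l// grid_val_le.
Qed.

Let cval_le a : `|cval a| <= 2 * K.
Proof.
apply: le_trans (ler_normB _ _) _.
by have := grid_val_le K0 dl_gt0 a; have := m_le; lra.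
Qed.

Let cval_mean : \sum_a p a * cval a = 0.
Proof.
under eq_bigr do rewrite mulrBr.
by rewrite sumrB wmean_cst// subrr.
Qed.

Let Z n w := sample_link X_ (grid_cls K dl) cval n w.

Let grid_sqr_error_tail (x : R) :
  (x - grid_val (grid_cls K dl x)) ^+ 2 <= dl ^+ 2 + tail_sq K x.
Proof.
rewrite /tail_sq; have [Kx|xK] := ltP K `|x|.
  by rewrite grid_val_far// subr0 mulr1 lerDr sqr_ge0.
rewrite mulr0 addr0 -real_normK ?num_real// ler_sqr ?nnegrE ?normr_ge0 ?(ltW dl_gt0)//.
exact: grid_val_near.
Qed.

Let discretization_gap n w :
  nsq (ntr (res y (linkmx (@hlink n.+1) (fun k => X_ k w)))
     - ntr (res y (linkmx (@hlink n.+1) (fun k => grid_val (grid_cls K dl (X_ k w))))))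
  <= dl ^+ 2 + tail_avg K n.+1 (fun k => X_ k w).
Proof.
have y1 : 1 <= y by move: y_ge3; lra.
apply: le_trans (ntr_linkmx_perturb (ltn0Sn n) (@hlinkC _) y1 _ _) _.
have N0 : 0 < n.+1%:R :> R by rewrite ltr0n.
have -> : dl ^+ 2 + tail_avg K n.+1 (fun k => X_ k w) = n.+1%:R ^- 2 *
    \sum_(i < n.+1) \sum_(j < n.+1) (dl ^+ 2 + tail_sq K (X_ (hlink i j) w)).
  under eq_bigr do rewrite big_split /= sumr_const card_ord.
  rewrite big_split /= sumr_const card_ord mulrDr; congr (_ + _).
  by rewrite -mulrnA -[dl ^+ 2 *+ _]mulr_natl natrM; field; rewrite gt_eqF.
rewrite ler_wpM2l ?invr_ge0 ?sqr_ge0//.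
apply: ler_sum => i _; apply: ler_sum => j _.
by rewrite -sqrrN opprB grid_sqr_error_tail.
Qed.

Let centering_gap n w :
  nsq (ntr (res y (linkmx (@hlink n.+1) (fun k => grid_val (grid_cls K dl (X_ k w)))))
     - ntr (res y (linkmx (@hlink n.+1) (Z n.+1 w)))) <= m ^+ 2 / n.+1%:R.
Proof.
have y1 : 1 <= y by move: y_ge3; lra.
have -> : linkmx (@hlink n.+1) (Z n.+1 w) =
    linkmx (@hlink n.+1) (fun k => grid_val (grid_cls K dl (X_ k w)) - m).
  apply/matrixP => i j; rewrite !mxE /Z /sample_link /sampled hlink_iota.
  by rewrite /cval.
exact: (ntr_linkmx_shift (ltn0Sn n) (@hlinkC _) y1).
Qed.

Let r n : R := n.+1%:R `^ (4^-1).

Let rE n : n.+1%:R = r n ^+ 4.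
Proof. by rewrite -powR_mulrn ?powR_ge0// -powRrM mulVf// powRr1. Qed.

Let r_ge1 n : 1 <= r n.
Proof.
rewrite -(@ler_pXn2r _ 4) ?nnegrE ?powR_ge0// -rE expr1n.
by rewrite ler1n.
Qed.

Let r_large (C : R) : 0 <= C -> exists n0, forall n, (n0 <= n)%N -> C / r n <= e.
Proof.
move=> C0; exists (Num.truncn ((C / e) ^+ 4)) => n n0n.
rewrite ler_pdivrMr ?(lt_le_trans ltr01 (r_ge1 n))// mulrC -ler_pdivrMr//.
rewrite -(@ler_pXn2r _ 4) ?nnegrE ?powR_ge0 ?divr_ge0 ?(ltW e_gt0)// -rE.
have /andP[_ /ltW h] := truncn_itv (exprn_ge0 4 (divr_ge0 C0 (ltW e_gt0))).
by apply: le_trans h _; rewrite ler_nat ltnS.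
Qed.

Let s2 := grid_var X K dl.

Let C1 : R := 4 * (2 * K) ^+ 6 + 16 * s2 ^+ 2 * (2 * K) ^+ 2
   + 8 * s2 ^+ 2 * (2 * K) ^+ 2 * 101.

Let dyson_const_ge0 :
  [/\ 0 <= 4 * (2 * K) ^+ 6 + 16 * s2 ^+ 2 * (2 * K) ^+ 2,
      0 <= 8 * s2 ^+ 2 * (2 * K) ^+ 2 & 0 <= C1].
Proof.
have k6 : 0 <= (2 * K) ^+ 6 by rewrite exprn_ge0// mulr_ge0// ltW.
have sk : 0 <= s2 ^+ 2 * (2 * K) ^+ 2 by rewrite mulr_ge0// sqr_ge0.
by rewrite /C1; move: ((2 * K) ^+ 6) ((2 * K) ^+ 2) (s2 ^+ 2) k6 sk => k u v k6 sk; split; lra.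
Qed.

Let C1_ge0 : 0 <= C1.
Proof.
by have [] := dyson_const_ge0.
Qed.

Let expectation_gap n :
  nsq (ntr (ExM p cval (iota 1 (n.+1 ^ 2)) (resl (@hlink n.+1) y) (fun=> 0))
     - (0 +i* b)%C) <= C1 / r n + (s2 - 1) ^+ 2.
Proof.
have r0 : 0 < r n by apply: lt_le_trans (r_ge1 n).
have t0 : 0 < r n ^+ 3 by rewrite exprn_gt0.
(* The splitting parameter is N^(3/4), with r n = N^(1/4): with energy of order N^(9/4), both
   energy^2 / (tau N^4) and tau / N are then of order N^(-1/4). *)
have := dyson_trace p0 p1 (ltn0Sn n) (@hlinkC _) (@hlink_inj _) (@hlink_iota _)
  (iota_uniq _ _) cval_le y_ge3 cval_mean (erefl _) (fun=> 0) t0 b_ge0 bE.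
move=> H; apply: le_trans H _; rewrite -[\sum_a _]/s2 lerD2r.
have q0 : 0 < 4^-1 :> R by rewrite invr_gt0.
have En : (energy (@hlink n.+1))%:R <= 10 * r n ^+ 9 :> R.
  apply: le_trans (energy_powR n.+1 q0) _; rewrite -/(r n) invrK (rE n).
  by apply: le_of_eq; ring.
have En0 : 0 <= (energy (@hlink n.+1))%:R :> R by [].
have En2 : (energy (@hlink n.+1))%:R ^+ 2 / (r n ^+ 3 * n.+1%:R ^+ 4) <= 100 / r n :> R.
  rewrite (rE n); apply: (@le_trans _ _ ((10 * r n ^+ 9) ^+ 2 / (r n ^+ 3 * (r n ^+ 4) ^+ 4))).
    rewrite ler_wpM2r ?invr_ge0 ?mulr_ge0 ?exprn_ge0 ?(ltW r0)//.
    by rewrite ler_sqr ?nnegrE ?mulr_ge0 ?exprn_ge0 ?(ltW r0).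
  by apply: le_of_eq; field; rewrite gt_eqF.
have rN : r n ^+ 3 / n.+1%:R = (r n)^-1 by rewrite (rE n); field; rewrite gt_eqF.
have Nr : n.+1%:R^-1 <= (r n)^-1 :> R.
  rewrite lef_pV2 ?posrE ?ltr0n// (rE n) -[leLHS]expr1.
  exact: ler_weXn2l.
have [c1 c2 _] := dyson_const_ge0.
rewrite rN /C1 [leRHS]mulrDl; apply: lerD.
  by rewrite ler_wpM2l.
rewrite -[leRHS]mulrA ler_wpM2l//.
have -> : 101 / r n = 100 / r n + (r n)^-1 by rewrite -[X in _ + X]mul1r -mulrDl; congr (_ / _); ring.
by rewrite lerD2r.
Qed.

(** The four summands are the costs of rounding, recentering, fluctuation of the trace, and distance
    of its mean from i b. *)
Lemma trace_gap_eventually : {ae P, forall w, exists n0, forall n, (n0 <= n)%N ->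
  trace_gap n w <= 4 * ((dl ^+ 2 + 4 * (tail_bound X eps K + e)) + e + 2 * e ^+ 2
    + (e + (grid_var X K dl - 1) ^+ 2))}.
Proof.
have A1 := tail_law_large_numbers copies indep eps_gt0 momX K_ge4 e_gt0.
have A2 := trace_concentration copies indep mcls cval_le y_ge3 e_gt0.
apply: filterS2 A1 A2 => w [n1 H1] [n2 H2].
have [n3 H3] := r_large C1_ge0; have [n4 H4] := r_large (sqr_ge0 m).
exists (maxn n1 (maxn n2 (maxn n3 n4))) => n.
rewrite !geq_max => /and4P[nn1 nn2 nn3 nn4].
have r0 : 0 < r n by apply: lt_le_trans (r_ge1 n).
apply: le_trans (nsq_sum4 _
  (ntr (res y (linkmx (@hlink n.+1) (fun k => grid_val (grid_cls K dl (X_ k w))))))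
  (ntr (res y (linkmx (@hlink n.+1) (Z n.+1 w))))
  (ntr (ExM p cval (iota 1 (n.+1 ^ 2)) (resl (@hlink n.+1) y) (fun=> 0))) _) _.
rewrite ler_pM2l//; apply: lerD.
  apply: lerD; last exact: H2.
  apply: lerD.
    apply: le_trans (discretization_gap n w) _; rewrite lerD2l.
    by apply: H1; exact: leqW.
  apply: le_trans (centering_gap n w) _; apply: le_trans (H4 n nn4).
  rewrite ler_wpM2l ?sqr_ge0// lef_pV2 ?posrE ?ltr0n// (rE n) -[leLHS]expr1.
  exact: ler_weXn2l.
apply: le_trans (expectation_gap n) _; rewrite lerD2r; exact: H3.
Qed.

End grid_level.
End resolvent_limit.

Section deterministic_limit.
Context (R : realType).

Lemma sqrt_tends (u : nat -> R) : tends (fun n => u n ^+ 2) 0 -> tends u 0.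
Proof.
move=> H e e0; have [n0 Hn] := H _ (exprn_gt0 2 e0); exists n0 => n /Hn.
by rewrite !subr0 normrX ler_sqr ?nnegrE// ltW.
Qed.

Lemma tends_le (u v : nat -> R) : (forall n, 0 <= u n <= v n) -> tends v 0 -> tends u 0.
Proof.
move=> uv H e e0; have [n0 Hn] := H e e0; exists n0 => n /Hn.
rewrite !subr0; have /andP[u0 uvn] := uv n.
by rewrite !ger0_norm ?(le_trans u0 uvn)//; exact: le_trans.
Qed.

Definition level (k : nat) : R := 3 + k.+1%:R^-1.

Lemma level_ge3 k : 3 <= level k.
Proof. by rewrite lerDl invr_ge0. Qed.

(** The nonnegative root of b^2 + y b = 1 for [y >= 0]; i b is the semicircular Stieltjes transform
    at i y when [y > 0]. *)
Definition stieltjes_sc (y : R) : R := (Num.sqrt (y ^+ 2 + 4) - y) / 2.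

Lemma stieltjes_sc_eq y : stieltjes_sc y ^+ 2 + y * stieltjes_sc y = 1.
Proof.
rewrite /stieltjes_sc; set q := Num.sqrt _.
have q2 : q ^+ 2 = y ^+ 2 + 4 by rewrite sqr_sqrtr// addr_ge0// sqr_ge0.
transitivity ((q ^+ 2 - y ^+ 2) / 4); first by field.
by rewrite q2 [_ + 4]addrC addrK divff.
Qed.

Lemma stieltjes_sc_ge0 y : 0 <= y -> 0 <= stieltjes_sc y.
Proof.
move=> y0; rewrite divr_ge0// subr_ge0.
by rewrite -[leLHS](ger0_norm y0) -sqrtr_sqr ler_wsqrtr// lerDl.
Qed.

(** The real part of the trace gives the odd kernel, of semicircular mean 0, and the imaginary part
    gives the even kernel; the support of the semicircle supplies tightness. *)
Lemma weak_limit (A : forall n, 'M[R]_n) (A_sym : forall n, (A n)^T = A n) :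
  (forall k, tends (fun n => nsq (ntr (res (level k) (A n.+1)) -
     (0 +i* stieltjes_sc (level k))%C)) 0) ->
  weakly_converges (fun n => spectral_measure (A n)) (@semicircle R).
Proof.
move=> H; pose Ln n := spec_mean (A n.+1); pose L := prob_mean (@semicircle R).
have mLn n : is_mean (Ln n) by exact: spec_mean_is_mean.
have mL : is_mean L by exact: prob_mean_is_mean.
have y0 k : 0 < level k by apply: lt_le_trans (level_ge3 k).
have y1 k : 1 <= level k ^+ 2.
  by rewrite exprn_ege1// (le_trans _ (level_ge3 k))// ler1n.
have Re0 k : tends (fun n => Ln n (fun x => x * cauchy_k k x)) 0.
  apply: sqrt_tends; apply: tends_le (H k) => n.
  have [ReE _] := ntr_res_spec (A_sym n.+1) (y0 k).
  rewrite [Ln n _](_ : _ = complex.Re (ntr (res (level k) (A n.+1)))); last exact/esym.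
  by rewrite sqr_ge0 /nsq ReB subr0 lerDl sqr_ge0.
have Im0 k : tends (fun n => level k * Ln n (cauchy_k k)) (stieltjes_sc (level k)).
  have -> : (fun n => level k * Ln n (cauchy_k k)) =
      (fun n => stieltjes_sc (level k) +
        (level k * Ln n (cauchy_k k) - stieltjes_sc (level k))).
    by apply/funext => n; rewrite addrC subrK.
  rewrite -[X in tends _ X]addr0; apply: tendsD.
    by move=> e e0; exists 0%N => n _; rewrite subrr normr0 ltW.
  apply: sqrt_tends; apply: tends_le (H k) => n.
  have [_ ImE] := ntr_res_spec (A_sym n.+1) (y0 k).
  have -> : level k * Ln n (cauchy_k k) = complex.Im (ntr (res (level k) (A n.+1))).
    case: (mLn n) => _ _ LnZ _; rewrite -LnZ; first by rewrite ImE.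
    exact: (bcont_cauchy (y1 k)).
  by rewrite sqr_ge0 /nsq ImB lerDr sqr_ge0.
have Hc k : cclass Ln L (cauchy_k k).
  split; first exact: (bcont_cauchy (y1 k)).
  have := tendsZ (level k)^-1 (Im0 k).
  have -> : (fun n => (level k)^-1 * (level k * Ln n (cauchy_k k))) =
      (fun n => Ln n (cauchy_k k)).
    by apply/funext => n; rewrite mulKf ?gt_eqF.
  by rewrite /L sc_mean_cauchy// /stieltjes_sc mulrC -mulrA -invfM.
have Hs k : cclass Ln L (fun x => x * cauchy_k k x).
  split; first exact: (bcont_odd_cauchy (y1 k)).
  rewrite [L _]sc_mean_odd//; first exact: (bcont_odd_cauchy (y1 k)).
    by move=> x; exact: (odd_cauchy_le1 (y1 k)).
  by move=> x; rewrite /cauchy_k sqrrN mulNr.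
move=> f cf bf; have bcf : bcont f by split.
have [_ Hf] := cclass_bcont mLn mL Hc Hs (@sc_mean_support R) bcf.
(* The sequence is shifted because the matrix of size 0 has no spectral mean. *)
rewrite prob_meanE// -(cvg_shiftS (fun n => \int[spectral_measure (A n)]_x (f x)%:E)%E).
rewrite (_ : (fun n => _) = (fun n => (Ln n f)%:E)); last first.
  by apply/funext => n; rewrite integral_spectral_measure//; exact: bcont_measurable.
apply: cvg_EFin; first exact: nearW.
apply/cvgrPdist_le => e e0; have [n0 Hn] := Hf e e0.
by exists n0 => // n /= /Hn; rewrite distrC.
Qed.

End deterministic_limit.

Section almost_sure_resolvent.
Context (R : realType) (d : measure_display) (T : measurableType d) (P : probability T R).
Context (d0 : measure_display) (T0 : measurableType d0) (P0 : probability T0 R).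
Context (X : {RV P0 >-> R}) (X_ : nat -> {RV P >-> R}) (eps : R).
Hypothesis copies : forall k : nat, (0 < k)%N -> same_distribution (X_ k) X.
Hypothesis indep : mutually_independent [set k : nat | (0 < k)%N] X_.
Hypotheses (eps_gt0 : 0 < eps)
  (momX : ('E_P0[fun w => (`|X w| `^ (2 + eps))%R] < +oo)%E)
  (varX : 'V_P0[X] = 1%E).
Local Notation M := (abs_moment X eps).

Lemma grid_parameters (t : R) : 0 < t -> t <= 1 ->
  exists K dl, [/\ 4 <= K, 0 < dl, dl <= t,
    tail_bound X eps K <= t & `|grid_var X K dl - 1| <= 3 * t].
Proof.
move=> t0 t1; have M0 : 0 <= M := abs_moment_ge0 momX.
(* 18 = 2 * 9, so that [9 * M / A <= t ^+ 2 / 2], for [tail_bound] and for the moment part of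
   [grid_err] alike. *)
pose A := 18 * (M + 1) / t ^+ 2.
have A0 : 0 < A by rewrite divr_gt0 ?exprn_gt0// mulr_gt0// ltr_wpDl.
pose L := Num.max 2 (A `^ eps^-1).
have L2 : 2 <= L by rewrite le_max lexx.
have L0 : 0 < L by apply: lt_le_trans L2.
have LA : L `^ (- eps) <= A^-1.
  rewrite powRN lef_pV2 ?posrE ?powR_gt0//.
  have -> : A = (A `^ eps^-1) `^ eps by rewrite -powRrM mulVf ?gt_eqF// powRr1// ltW.
  apply: ge0_ler_powR; rewrite ?nnegrE ?powR_ge0 ?(ltW eps_gt0) ?(ltW L0)//.
  by rewrite le_max lexx orbT.
have AM : 9 * A^-1 * M <= t ^+ 2 / 2.
  have -> : 9 * A^-1 * M = t ^+ 2 / 2 * (M / (M + 1)).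
    by rewrite /A; field; rewrite !gt_eqF ?ltr_wpDl.
  rewrite ler_piMr ?divr_ge0 ?sqr_ge0//.
  by rewrite ler_pdivrMr ?mul1r ?lerDl// ltr_wpDl.
have tt : t ^+ 2 <= t by rewrite expr2 ler_piMr// ltW.
have LM : 9 * L `^ (- eps) * M <= t ^+ 2 / 2.
  by apply: le_trans AM; rewrite ler_wpM2r// ler_pM2l.
(* [tail_bound] evaluates the power at [K - 2], hence the shift; the mesh contributes only
   [t ^+ 2 / 4] to [grid_err]. *)
exists (L + 2), (t / 2); split.
- by rewrite -[leLHS](_ : 2 + 2 = 4 :> R) ?lerD2r//; ring.
- by rewrite divr_gt0.
- by move: t0; lra.
- rewrite /tail_bound addrK; apply: le_trans LM _.
  by move: tt t0; lra.
- apply: (grid_var_near eps_gt0 momX varX _ _ t0 t1).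
  + by rewrite addr_gt0.
  + by rewrite divr_gt0.
  rewrite /grid_err; have : (L + 2) `^ (- eps) * M <= 9 * L `^ (- eps) * M.
    rewrite ler_wpM2r//; apply: le_trans (_ : L `^ (- eps) <= _).
      rewrite !powRN lef_pV2 ?posrE ?powR_gt0 ?addr_gt0//.
      by apply: ge0_ler_powR; rewrite ?nnegrE ?(ltW eps_gt0) ?(ltW L0) ?addr_ge0 ?(ltW L0) ?lerDl.
    by rewrite ler_peMl ?powR_ge0// ler1n.
  have -> : (t / 2) ^+ 2 = t ^+ 2 / 4 by field.
  by move: LM (sqr_ge0 t); move: (t ^+ 2) => u; lra.
Qed.

Lemma trace_gap_tends (y b : R) : 3 <= y -> 0 <= b -> b ^+ 2 + y * b = 1 ->
  {ae P, forall w, tends (fun n => trace_gap X_ y b n w) 0}.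
Proof.
move=> y3 b0 bE.
(* All parameters are at most t = 1 / (j + 1), the variance error at most 3 t: the total is 4 (1 + 8
   + 1 + 2 + 1 + 9) t = 88 t. Countably many [j] suffice. *)
have level_gap (j : nat) : {ae P, forall w, exists n0, forall n, (n0 <= n)%N ->
    trace_gap X_ y b n w <= 88 * j.+1%:R^-1}.
  have t0 : 0 < j.+1%:R^-1 :> R by [].
  have t1 : j.+1%:R^-1 <= 1 :> R by rewrite invf_le1// ler1n.
  have [K [dl [K4 dl0 dlt Kt vt]]] := grid_parameters t0 t1.
  apply: filterS (trace_gap_eventually copies indep eps_gt0 momX y3 b0 bE K4 dl0 t0).
  move=> w [n0 Hn]; exists n0 => n /Hn H; apply: le_trans H _.
  have dl2 : dl ^+ 2 <= j.+1%:R^-1 ^+ 2 by rewrite ler_sqr ?nnegrE ?(ltW dl0) ?(ltW t0).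
  have v2 : (grid_var X K dl - 1) ^+ 2 <= (3 * j.+1%:R^-1) ^+ 2.
    by rewrite -real_normK ?num_real// ler_sqr ?nnegrE ?normr_ge0 ?mulr_ge0 ?(ltW t0).
  have tt : j.+1%:R^-1 ^+ 2 <= j.+1%:R^-1 :> R by rewrite expr2 ler_piMr// ltW.
  move: dl2 v2 Kt tt t0; rewrite exprMn.
  move: (j.+1%:R^-1) (dl ^+ 2) (tail_bound _ _ _) ((_ - 1) ^+ 2) => t u v q.
  by move: (t ^+ 2) => t2; lra.
apply: filterS (ae_foralln level_gap) => w H e e0.
have [j je] : exists j : nat, 88 * j.+1%:R^-1 <= e.
  exists (Num.truncn (88 / e)); rewrite ler_pdivrMr ?ltr0n// mulrC -ler_pdivrMr//.
  by have /andP[_ /ltW] := truncn_itv (divr_ge0 (ler0n R 88) (ltW e0)).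
have [n0 Hn] := H j; exists n0 => n /Hn Hle.
rewrite subr0 ger0_norm; first exact: le_trans Hle je.
by rewrite /trace_gap /nsq addr_ge0 ?sqr_ge0.
Qed.

End almost_sure_resolvent.

Theorem theorem1p1 (R : realType)
    (d0 : measure_display) (T0 : measurableType d0) (P0 : probability T0 R)
    (X : {RV P0 >-> R})
    (d : measure_display) (T : measurableType d) (P : probability T R)
    (X_ : nat -> {RV P >-> R}) (eps : R)
    (varX : 'V_P0[X] = 1%E)
    (eps_gt0 : 0 < eps)
    (momX : ('E_P0[fun w => (`|X w| `^ (2 + eps))%R] < +oo)%E)
    (copies : forall k : nat, (0 < k)%N -> same_distribution (X_ k) X)
    (indep : mutually_independent [set k : nat | (0 < k)%N] X_) :
  {ae P, forall w, weakly_converges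
    (fun n => spectral_measure
                ((Num.sqrt n%:R)^-1 *: helson (fun k => X_ k w) n))
    (@semicircle R)}.
Proof.
have levels (k : nat) : {ae P, forall w,
    tends (fun n => trace_gap X_ (level R k) (stieltjes_sc (level R k)) n w) 0}.
  have l3 := level_ge3 R k.
  apply: (trace_gap_tends copies indep eps_gt0 momX varX l3).
    by apply: stieltjes_sc_ge0; apply: le_trans l3.
  exact: stieltjes_sc_eq.
(* Countably many spectral parameters, so a single event of probability 1 serves them all, and hence
   all test functions. *)
apply: filterS (ae_foralln levels) => w H; apply: weak_limit => // n.
by rewrite linearZ /= helson_sym.
Qed.
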